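(* Assume $n\ne1$ and $0<\alpha_1\le\alpha_2\le\cdots\le\alpha_{n-1}\le\alpha_n<1$. For integers $N_T\ge1$ and $N\ge2$, let $\{u^k\}_{k=0}^{N_T}$ be the solution of the semi-discretized problem and $\{u_N^k\}_{k=0}^{N_T}$ the solution of the fully discrete (shifted Legendre collocation) problem, both described in the context, the latter with initial condition $u_N^0$ taken to be $I_Nu^0(x)$. Let $m>1$ be an integer and suppose that $u^k\in H^m(\Lambda)\cap H_0^1(\Lambda)$ for $k=1,2,\dots,N_T$. Then there exists a constant $\overline c>0$, independent of $N$, $N_T$ (equivalently, of $\Delta t$) and $k$, such that for all $k=1,\dots,N_T$, $$\|u^k-u_N^k\|_{1,\widehat N}\le\overline c\exp\left(\frac{\alpha_nT}{1-\alpha_n}\right)\left(N^{-m}\max_{0\le l\le k}\|f^l\|_m+(N-1)^{1-m}\max_{0\le l\le k}\|u^l\|_m\right).$$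
   Context: Let $T,S>0$, $\Lambda=(0,S)$, $n\in\mathbb N$ with $n\ge1$, and $d_i\ge0$ ($i=1,\dots,n$), not all zero. Let $\varphi$ on $\overline\Lambda$ (with $\varphi(0)=\varphi(S)=0$) and $f$ on $\overline\Lambda\times[0,T]$ be given sufficiently smooth functions, in particular $\varphi\in H^m(\Lambda)$ and $f(\cdot,t)\in H^m(\Lambda)$ for $t\in[0,T]$. For an integer $N_T\ge1$ put $\Delta t=T/N_T$, $t_k=k\Delta t$, $f^k=f(\cdot,t_k)$. (The underlying equation being discretized is $\sum_{i=1}^nd_i\,{}_0^{\mathrm{CF}}D_t^{\alpha_i}u=\partial_x^2u+f$ with Caputo-Fabrizio derivatives, $u(x,0)=\varphi(x)$ and homogeneous Dirichlet boundary conditions.) Coefficients: $\sigma_{j,k}^{(\alpha_i)}=\exp\left(-\alpha_i\frac{t_k-t_j}{1-\alpha_i}\right)$ for $0\le j\le k\le N_T$, and for $1\le j\le k\le N_T$ $$b_{j,k}^{(\alpha_i)}=\sigma_{j,k}^{(\alpha_i)}-\sigma_{j-1,k}^{(\alpha_i)},\qquad \eta_{j,k}=\sum_{i=1}^n\frac{d_i}{\alpha_i\Delta t}b_{j,k}^{(\alpha_i)},\qquad \zeta_{j,k}=\frac{\eta_{j,k}}{\eta_{k,k}},\qquad \kappa=\eta_{k,k}^{-1}$$ ($\kappa$ does not depend on $k$, since $b_{k,k}^{(\alpha_i)}=1-\exp(-\alpha_i\Delta t/(1-\alpha_i))$). Continuous norms: $(u,v)=\int_\Lambda uv\,\mathrm{d}x$,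 $\|v\|_0=(v,v)^{1/2}$, and for integers $m\ge2$, $\|v\|_m=\left(\sum_{k=0}^m\left\|\frac{\mathrm{d}^kv}{\mathrm{d}x^k}\right\|_0^2\right)^{1/2}$ on $H^m(\Lambda)$. Semi-discretized problem: $u^0=\varphi$, and for $k=1,\dots,N_T$ find $u^k\in H_0^1(\Lambda)$ such that for all $v\in H_0^1(\Lambda)$ $$(u^1,v)+\kappa\left(\frac{\partial u^1}{\partial x},\frac{\partial v}{\partial x}\right)=(u^0,v)+\kappa(f^1,v),$$ $$(u^k,v)+\kappa\left(\frac{\partial u^k}{\partial x},\frac{\partial v}{\partial x}\right)=\sum_{j=1}^{k-1}(\zeta_{j+1,k}-\zeta_{j,k})(u^j,v)+\zeta_{1,k}(u^0,v)+\kappa(f^k,v),\quad k\ge2 .$$ Discrete spaces and quadrature: $\mathbb P_N(\Lambda)$ is the space of polynomials of degree at most $N$ and $\mathbb P_N^0(\Lambda)=\mathbb P_N(\Lambda)\cap H_0^1(\Lambda)$. Let $L_N$ be the Legendre polynomial of degree $N$ on $[-1,1]$, $\xi_0,\dots,\xi_N$ the zeros of $(1-x^2)L_N'(x)$ and $\omega_p=\frac{2}{N(N+1)}\frac{1}{L_N^2(\xi_p)}$. The shifted Legendre-Gauss-Lobatto nodes and weights on $\overline\Lambda$ are $\hat\xi_p=\frac S2(\xi_p+1)$, $\hat\omega_p=\frac S2\omega_p$, $p=0,\dots,N$. For $\phi,\psi\in C(\overline\Lambda)$, $$(\phi,\psi)_{\widehat N}=\sum_{p=0}^N\phi(\hat\xi_p)\psi(\hat\xi_p)\hat\omega_p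 .$$ $I_N:C(\overline\Lambda)\to\mathbb P_N(\Lambda)$ is the interpolation operator at the nodes: $I_N\psi(\hat\xi_p)=\psi(\hat\xi_p)$, $p=0,\dots,N$. Define $$A_{\widehat N}(\phi,\psi)=(\phi,\psi)_{\widehat N}+\kappa\left(\frac{\partial\phi}{\partial x},\frac{\partial\psi}{\partial x}\right)_{\widehat N},\qquad \|\phi\|_{1,\widehat N}=A_{\widehat N}(\phi,\phi)^{1/2}$$ (for functions with continuous first derivative on $\overline\Lambda$). Fully discrete problem: $u_N^0=I_Nu^0$, and for $k=1,\dots,N_T$ find $u_N^k\in\mathbb P_N^0(\Lambda)$ such that for all $v_N\in\mathbb P_N^0(\Lambda)$ $$A_{\widehat N}(u_N^1,v_N)=(u_N^0,v_N)_{\widehat N}+\kappa(f^1,v_N)_{\widehat N},$$ $$A_{\widehat N}(u_N^k,v_N)=\sum_{j=1}^{k-1}(\zeta_{j+1,k}-\zeta_{j,k})(u_N^j,v_N)_{\widehat N}+\zeta_{1,k}(u_N^0,v_N)_{\widehat N}+\kappa(f^k,v_N)_{\widehat N},\quad k\ge2 .$$ *)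

(* Defs.v *)
From HB Require Import structures.
From mathcomp Require Export all_boot all_order all_algebra.
From mathcomp Require Export all_classical all_reals all_analysis.
Export Order.TTheory GRing.Theory Num.Theory.
Export numFieldNormedType.Exports.
Set Implicit Arguments.
Unset Strict Implicit.
Unset Printing Implicit Defensive.
Global Open Scope classical_set_scope.
Global Open Scope ring_scope.

(* Functions on the interval (0, S), or on its closure, are total functions
   R -> R whose values outside the interval are never used. *)

Section Sobolev.
Context {R : realType} (S : R).
Implicit Types (u v g psi : R -> R) (k m : nat).

Definition inner u v : R := \int[lebesgue_measure]_(x in `]0, S[) (u x * v x).

Definition in_L2 v : Prop :=
  measurable_fun `]0, S[ v /\
  lebesgue_measure.-integrable `]0, S[ (fun x => (v x ^+ 2)%:E).

Definition test_function psi : Prop :=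
  (forall k x, derivable (derive1n k psi) x 1) /\
  exists a b, [/\ 0 < a, b < S & forall x, x \notin `[a, b] -> psi x = 0].

Definition is_weak_derivative k v g : Prop :=
  forall psi, test_function psi ->
    inner v (derive1n k psi) = (-1) ^+ k * inner g psi.

(* A square-integrable k-th weak derivative: when there is one it is unique up
   to a null set, and only its integrals are used. *)
Definition weak_derivative k v : R -> R :=
  xget (fun=> 0) [set g | in_L2 g /\ is_weak_derivative k v g].

(* H^m(0, S) for m >= 1.  Each of its classes modulo null sets has exactly one
   representative that is continuous on [0, S]; elements are identified with
   this representative, which has the boundary and nodal values. *)
Definition Hm m v : Prop :=
  {within `[0, S], continuous v} /\
  forall k, (k <= m)%N -> exists g, in_L2 g /\ is_weak_derivative k v g.

Definition H10 v : Prop := [/\ Hm 1 v, v 0 = 0 & v S = 0].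

Definition norm0 v : R := Num.sqrt (inner v v).

Definition normm m v : R :=
  Num.sqrt (\sum_(0 <= k < m.+1) norm0 (weak_derivative k v) ^+ 2).

(* The classical derivative on [0, S], one-sided at both endpoints. *)
Definition deriv_on v : R -> R :=
  fun x => lim ((v y - v x) / (y - x) @[y --> within `[0, S] x^']).

End Sobolev.

Section Coefficients.
Context {R : realType} (dt : R) (n : nat) (d alpha : nat -> R).
(* d i and alpha i are used for 1 <= i <= n only. *)

Definition sigma (a : R) (j k : nat) : R :=
  expR (- (a * ((k%:R * dt - j%:R * dt) / (1 - a)))).

Definition bcoef (a : R) (j k : nat) : R := sigma a j k - sigma a j.-1 k.

Definition eta (j k : nat) : R :=
  \sum_(1 <= i < n.+1) d i / (alpha i * dt) * bcoef (alpha i) j k.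

Definition zeta (j k : nat) : R := eta j k / eta k k.

(* eta k k is the same for all k >= 1. *)
Definition kappa : R := (eta 1 1)^-1.

End Coefficients.

Section Quadrature.
Context {R : realType} (S : R) (N : nat).
Implicit Types phi psi : R -> R.

(* Rodrigues' formula. *)
Definition legendre : {poly R} :=
  (2 ^+ N * (N`!)%:R)^-1 *: derivn N (('X^2 - 1) ^+ N).

(* The zeros of (1 - x^2) L_N'(x), in increasing order. *)
Definition gll_nodes : N.+1.-tuple R :=
  xget [tuple of nseq N.+1 0] [set s : N.+1.-tuple R |
    sorted <%R s /\
    forall x, (x \in (s : seq R)) = root ((1 - 'X^2) * legendre^`()) x].

Definition xi (p : 'I_N.+1) : R := tnth gll_nodes p.

Definition omega (p : 'I_N.+1) : R :=
  2 / (N%:R * (N.+1)%:R) * (legendre.[xi p] ^+ 2)^-1.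

Definition xi_hat (p : 'I_N.+1) : R := S / 2 * (xi p + 1).

Definition omega_hat (p : 'I_N.+1) : R := S / 2 * omega p.

Definition innerN phi psi : R :=
  \sum_(p < N.+1) phi (xi_hat p) * psi (xi_hat p) * omega_hat p.

Definition interpolant psi : {poly R} :=
  xget 0 [set q : {poly R} | (size q <= N.+1)%N /\
    forall p, q.[xi_hat p] = psi (xi_hat p)].

Definition PN0 (q : {poly R}) : Prop :=
  (size q <= N.+1)%N /\ H10 S (fun x => q.[x]).

Definition AN (kap : R) phi psi : R :=
  innerN phi psi + kap * innerN (deriv_on S phi) (deriv_on S psi).

Definition norm1N (kap : R) phi : R := Num.sqrt (AN kap phi phi).

End Quadrature.

Section Schemes.
Context {R : realType} (T S : R) (n : nat) (d alpha : nat -> R).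
Context (NT : nat) (f : R -> R -> R).

Definition tstep : R := T / NT%:R.

Definition fk (k : nat) : R -> R := fun x => f x (k%:R * tstep).

Let zt := zeta tstep n d alpha.
Let kap := kappa tstep n d alpha.

Definition semidiscrete_solution (phi : R -> R) (u : nat -> R -> R) : Prop :=
  [/\ forall x, x \in `[0, S] -> u 0%N x = phi x,
      forall k, (1 <= k <= NT)%N -> H10 S (u k),
      forall v, H10 S v ->
        inner S (u 1%N) v
          + kap * inner S (weak_derivative S 1 (u 1%N)) (weak_derivative S 1 v)
        = inner S (u 0%N) v + kap * inner S (fk 1) v
    & forall k, (2 <= k <= NT)%N -> forall v, H10 S v ->
        inner S (u k) v
          + kap * inner S (weak_derivative S 1 (u k)) (weak_derivative S 1 v)
        = \sum_(1 <= j < k) (zt j.+1 k - zt j k) * inner S (u j) v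
          + zt 1 k * inner S (u 0%N) v + kap * inner S (fk k) v].

Definition fully_discrete_solution (N : nat) (u0 : R -> R)
    (uN : nat -> {poly R}) : Prop :=
  let ev (q : {poly R}) : R -> R := fun x => q.[x] in
  [/\ uN 0%N = interpolant S N u0,
      forall k, (1 <= k <= NT)%N -> PN0 S N (uN k),
      forall v, PN0 S N v ->
        AN S N kap (ev (uN 1%N)) (ev v)
        = innerN S N (ev (uN 0%N)) (ev v) + kap * innerN S N (fk 1) (ev v)
    & forall k, (2 <= k <= NT)%N -> forall v, PN0 S N v ->
        AN S N kap (ev (uN k)) (ev v)
        = \sum_(1 <= j < k) (zt j.+1 k - zt j k) * innerN S N (ev (uN j)) (ev v)
          + zt 1 k * innerN S N (ev (uN 0%N)) (ev v)
          + kap * innerN S N (fk k) (ev v)].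

End Schemes.

(* Main.v *)
(** All estimates are reduced to polynomials. A weak derivative on (0, S) may be
    tested against every polynomial vanishing at both endpoints; hence iterated
    antiderivatives of a polynomial close in L2 to the m-th weak derivative of u
    approximate u and all its lower derivatives, and, for m >= 2, also u and its
    difference quotients uniformly on [0, S].

    For a polynomial u let q'' be the orthogonal projection of u'' onto degree
    at most N - 3, and let q interpolate u at both endpoints. Then q v has degree
    at most 2N - 1 for every test polynomial v, so that quadrature is exact on
    all terms containing q, and theta^k = q^k - u_N^k solves the scheme with the
    approximation errors of u^j and the quadrature error of f^k as data. The
    quadrature error is controlled by the largest weight, which is O(1/N), through
    the Chebyshev-Markov-Stieltjes inequalities.

    The coefficients of the past values are nonnegative, sum to 1 and contain
    zeta_{1,k} >= exp(- alpha_n T / (1 - alpha_n)) as weight of the initial value,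
    so the energy estimate can be iterated without losing a factor per time step. *)

(* The error of a single time step carries no factor [dt]: [kappa] stays between positive constants
   as [dt] tends to 0, because (1 - exp(- r dt)) / dt does. Adding up the step errors would cost a
   factor N_T; the convex combination of past values prevents this, and the lower bound of the
   initial weight enters the constant through its reciprocal.

   The norm of the claim evaluates derivatives at nodes, where a weak derivative has no value.
   Control of difference quotients settles this without constructing a continuous representative of
   u'.

   A Gauss-Lobatto weight is a multiple of 1 / (N (N + 1) L_N^2), so weights of order 1/N mean that
   L_N^2 is at least of order 1/N at the nodes. There Sonin's function reduces to a multiple of
   L_N^2; its minimum is at 0, where L_N and L_N' are given by central binomial coefficients.

   Functions in H^m are replaced by polynomials within an arbitrary [e]. All constants are
   independent of [e], which tends to 0 only at the end of each estimate. *)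
Require Import Defs.
From HB Require Import structures.
From mathcomp Require Import measurable_realfun.
From mathcomp Require Import polyrcf ring lra zify.
Set Implicit Arguments.
Unset Strict Implicit.
Unset Printing Implicit Defensive.

(** * Formal integration of polynomials *)

Section PolyIntegral.
Context {R : rcfType}.
Implicit Types (p q : {poly R}) (a b c t : R).

Definition antideriv p : {poly R} :=
  \poly_(i < (size p).+1) (p`_i.-1 / i%:R).

(** This includes [i = 0], where division by zero yields the constant coefficient 0. *)
Lemma coef_antideriv p i : (antideriv p)`_i = p`_i.-1 / i%:R.
Proof.
rewrite coef_poly; case: ltnP => // hi.
by rewrite nth_default ?mul0r //; case: i hi.
Qed.

Lemma size_antideriv p : (size (antideriv p) <= (size p).+1)%N.
Proof. exact: size_poly. Qed.

Lemma deriv_antideriv p : (antideriv p)^`() = p.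
Proof.
apply/polyP => i.
by rewrite coef_deriv coef_antideriv /= -[LHS]mulr_natr divfK // pnatr_eq0.
Qed.

Lemma size_deriv_leq p n : (size p <= n.+1)%N -> (size p^`() <= n)%N.
Proof. by rewrite polyorder.size_deriv; case: (size p). Qed.

Lemma deriv_eq0 p : p^`() = 0 -> p = (p`_0)%:P.
Proof.
move=> dp; apply: size1_polyC; have := polyorder.size_deriv p.
by rewrite dp size_poly0; case: (size p) => [|[]].
Qed.

(** Integration without measure theory; [inner_poly] identifies it with the Lebesgue integral. The
    lock keeps simplification from exposing the antiderivative. *)
Definition pint a b p : R := locked ((antideriv p).[b] - (antideriv p).[a]).

Lemma pintE a b p : pint a b p = (antideriv p).[b] - (antideriv p).[a].
Proof. by rewrite /pint -lock. Qed.

Lemma pint_deriv a b p : pint a b p^`() = p.[b] - p.[a].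
Proof.
have : (antideriv p^`() - p)^`() = 0 by rewrite derivB deriv_antideriv subrr.
move/deriv_eq0/(canRL (subrK _)); set c := (X in X%:P) => e.
by rewrite pintE e !hornerD !hornerC; ring.
Qed.

Lemma pint_is_linear a b : scalar (pint a b).
Proof.
move=> c p q; rewrite !pintE.
have -> : antideriv (c *: p + q) = c *: antideriv p + antideriv q.
  apply/polyP => i; rewrite !(coefD, coefZ, coef_antideriv); ring.
by rewrite !hornerD !hornerZ; ring.
Qed.

HB.instance Definition _ a b :=
  GRing.isLinear.Build R {poly R} R *%R (pint a b) (pint_is_linear a b).

Lemma pintD a b p q : pint a b (p + q) = pint a b p + pint a b q.
Proof. exact: raddfD. Qed.

Lemma pintB a b p q : pint a b (p - q) = pint a b p - pint a b q.
Proof. exact: raddfB. Qed.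

Lemma pintN a b p : pint a b (- p) = - pint a b p.
Proof. exact: raddfN. Qed.

Lemma pint0 a b : pint a b 0 = 0.
Proof. exact: raddf0. Qed.

Lemma pintZ a b c p : pint a b (c *: p) = c * pint a b p.
Proof. by rewrite linearZ. Qed.

Lemma pintMl a b c p : pint a b (c%:P * p) = c * pint a b p.
Proof. by rewrite mul_polyC linearZ. Qed.

Lemma pintC a b c : pint a b c%:P = c * (b - a).
Proof.
have -> : c%:P = (c *: 'X)^`() :> {poly R}.
  by rewrite derivZ derivX alg_polyC.
by rewrite pint_deriv !hornerE mulrBr.
Qed.

Lemma pint_split a c b p : pint a b p = pint a c p + pint c b p.
Proof. by rewrite !pintE; ring. Qed.

Lemma pint_parts a b p q :
  pint a b (p^`() * q) = p.[b] * q.[b] - p.[a] * q.[a] - pint a b (p * q^`()).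
Proof.
apply/eqP; rewrite eq_sym subr_eq -raddfD /= -derivM pint_deriv !hornerM.
exact: eqxx.
Qed.

Lemma pint_ge0_oo a b p : a <= b -> (forall x, x \in `]a, b[ -> 0 <= p.[x]) ->
  0 <= pint a b p.
Proof.
move=> ab p0; rewrite pintE subr_ge0; apply: (@ler_hornerW _ a b) => //.
- by move=> x xab; rewrite deriv_antideriv; apply: p0.
- by rewrite in_itv /= lexx ab.
- by rewrite in_itv /= lexx ab.
Qed.

Lemma pint_ge0 a b p : a <= b -> (forall x, x \in `[a, b] -> 0 <= p.[x]) ->
  0 <= pint a b p.
Proof.
move=> ab p0; apply: pint_ge0_oo => // x; rewrite in_itv /= => /andP[ax xb].
by apply: p0; rewrite in_itv /= !ltW.
Qed.

Lemma le_pint a b p q : a <= b ->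
  (forall x, x \in `[a, b] -> p.[x] <= q.[x]) -> pint a b p <= pint a b q.
Proof.
move=> ab pq; rewrite -subr_ge0 -raddfB; apply: pint_ge0 => // x /pq.
by rewrite hornerD hornerN subr_ge0.
Qed.

Lemma pint_sqr_ge0 a b p : a <= b -> 0 <= pint a b (p * p).
Proof. by move=> ab; apply: pint_ge0 => // x _; rewrite hornerM -expr2 sqr_ge0. Qed.

(** A nonzero polynomial has fewer roots than its size, while [s] lists [size p] distinct points of
    the interval. *)
Lemma poly_eq0_itv a b p : a < b -> (forall x, x \in `[a, b] -> p.[x] = 0) -> p = 0.
Proof.
move=> ab p0; apply/eqP/negPn/negP => /max_poly_roots H.
pose s := [seq a + (b - a) / (i.+1)%:R | i <- iota 0 (size p)].
suff : (size s < size p)%N by rewrite size_map size_iota ltnn.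
apply: H.
  apply/allP => x /mapP[i _ ->]; apply/rootP/p0.
  have i0 : 0 < (i.+1)%:R :> R by rewrite ltr0n.
  have i1 : (i.+1)%:R^-1 <= 1 :> R by rewrite invf_le1 // ler1n.
  have i2 : 0 < (i.+1)%:R^-1 :> R by rewrite invr_gt0.
  have h : (b - a) * (i.+1)%:R^-1 <= b - a by rewrite ler_piMr // subr_ge0 ltW.
  have h' : 0 <= (b - a) * (i.+1)%:R^-1 by rewrite mulr_ge0 ?ltW ?subr_gt0.
  by rewrite in_itv /=; apply/andP; split; [rewrite lerDl | rewrite addrC -lerBrDr].
rewrite map_inj_uniq ?iota_uniq // => i j /addrI.
have ba : b - a != 0 by lra.
by move/(mulfI ba)/invr_inj/eqP; rewrite eqr_nat eqSS => /eqP.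
Qed.

(** The antiderivative is nondecreasing with equal values at both ends, hence constant. *)
Lemma pint_eq0 a b p : a < b -> (forall x, x \in `]a, b[ -> 0 <= p.[x]) ->
  pint a b p = 0 -> p = 0.
Proof.
move=> ab p0 I0; set P := antideriv p.
have mono : {in `[a, b] &, {homo horner P : x y / x <= y}}.
  by apply: ler_hornerW => x xab; rewrite deriv_antideriv; apply: p0.
have aI : a \in `[a, b] by rewrite in_itv /= lexx ltW.
have bI : b \in `[a, b] by rewrite in_itv /= lexx ltW.
have Pc : P - (P.[a])%:P = 0.
  apply: (@poly_eq0_itv a b) => // x xab; rewrite hornerD hornerN hornerC.
  move: (xab); rewrite in_itv /= => /andP[ax xb].
  have h1 := mono _ _ aI xab ax; have h2 := mono _ _ xab bI xb.
  by move: I0; rewrite pintE -/P; lra.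
by rewrite -(deriv_antideriv p) -/P (subr0_eq Pc) derivC.
Qed.

Lemma pint_sqr_eq0 a b p : a < b -> pint a b (p * p) = 0 -> p = 0.
Proof.
move=> ab I0; have : p * p = 0.
  apply: (pint_eq0 ab) => // x _; by rewrite hornerM -expr2 sqr_ge0.
by move/eqP; rewrite mulf_eq0 orbb => /eqP.
Qed.

(** For [C > 0] the minimiser [t = - B / C] gives the claim; for [C = 0] a nonzero slope would
    produce the value -1. All Cauchy-Schwarz inequalities below come from here. *)
Lemma quad_ge0_disc (A B C : R) : 0 <= C ->
  (forall t, 0 <= A + 2 * t * B + t ^+ 2 * C) -> B ^+ 2 <= A * C.
Proof.
move=> C0 H; have [C1|] := eqVneq C 0; last first.
  move=> Cn0; have Cp : 0 < C by rewrite lt_neqAle eq_sym Cn0.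
  have := H (- B / C); rewrite -(ler_pM2r Cp) mul0r.
  have -> : (A + 2 * (- B / C) * B + (- B / C) ^+ 2 * C) * C = A * C - B ^+ 2 by field.
  by rewrite subr_ge0.
rewrite C1 mulr0; have [->|Bn0] := eqVneq B 0; first by rewrite expr0n.
have := H (- (A + 1) / (2 * B)); rewrite C1 mulr0 addr0.
have -> : A + 2 * (- (A + 1) / (2 * B)) * B = -1 by field.
lra.
Qed.

Lemma pint_CS a b p q : a <= b ->
  pint a b (p * q) ^+ 2 <= pint a b (p * p) * pint a b (q * q).
Proof.
move=> ab; apply: quad_ge0_disc; first exact: pint_sqr_ge0.
move=> t; have := pint_sqr_ge0 (p + t *: q) ab.
have -> : (p + t *: q) * (p + t *: q) =
    p * p + (t *: (p * q)) *+ 2 + t *: (t *: (q * q)).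
  by rewrite -!mul_polyC; ring.
by rewrite !raddfD /= !pintZ => h; lra.
Qed.

Lemma poincare a b p x : a <= b -> p.[a] = 0 -> x \in `[a, b] ->
  p.[x] ^+ 2 <= (b - a) * pint a b (p^`() * p^`()).
Proof.
move=> ab pa; rewrite in_itv /= => /andP[ax xb].
have := @pint_CS a x p^`() 1 ax; rewrite mulr1 pint_deriv pa subr0 mulr1.
rewrite -[1]/(1%:P) pintC mul1r => h; apply: le_trans h _; rewrite mulrC.
have h1 := @pint_sqr_ge0 a x p^`() ax; have h2 := @pint_sqr_ge0 x b p^`() xb.
rewrite [pint a b _](pint_split a x b).
by apply: ler_pM => //; lra.
Qed.

Lemma poincare_int a b p : a <= b -> p.[a] = 0 ->
  pint a b (p * p) <= (b - a) ^+ 2 * pint a b (p^`() * p^`()).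
Proof.
move=> ab pa; set J := pint a b (p^`() * p^`()).
have : pint a b (p * p) <= pint a b ((b - a) * J)%:P.
  apply: le_pint => // x xab; rewrite hornerC hornerM -expr2; exact: poincare.
by rewrite pintC => h; apply: le_trans h _; rewrite mulrAC expr2.
Qed.

End PolyIntegral.

(** * Rodrigues polynomials and orthogonal projection *)

Section Rodrigues.
Context {R : rcfType} (a b : R).
Implicit Types (p q r e g : {poly R}) (n M : nat) (c : R).

Lemma derivn_XsubC_exp k n q c : (k <= n)%N ->
  ((('X - c%:P) ^+ n * q)^`(k)).[c] = if k == n then q.[c] *+ n`! else 0.
Proof.
elim: k n q => [|k IH] [|n] q //.
- by move=> _; rewrite expr0 mul1r fact0.
- by move=> _; rewrite hornerM horner_exp hornerXsubC subrr expr0n mul0r.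
rewrite ltnS => kn.
have -> : ((('X - c%:P) ^+ n.+1 * q)^`(k.+1)) =
    (('X - c%:P) ^+ n * (q *+ n.+1 + ('X - c%:P) * q^`()))^`(k).
  rewrite derivSn derivM deriv_exp derivB derivX derivC subr0 mul1r exprS /=.
  by rewrite mulrDr mulrnAl mulrnAr mulrA [_ ^+ n * (_ - _)]mulrC.
rewrite IH // eqSS; case: eqP => // _.
by rewrite hornerD hornerMn hornerM hornerXsubC subrr mul0r addr0 -mulrnA factS.
Qed.

(** Minus the weight of Legendre's Sturm-Liouville operator; it is nonpositive between [a] and
    [b]. *)
Definition wpoly : {poly R} := ('X - a%:P) * ('X - b%:P).

(** Up to a factor, the Legendre polynomial of degree [n] for the interval from [a] to [b]. *)
Definition rodrigues n : {poly R} := (wpoly ^+ n)^`(n).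

Lemma size_wpoly : size wpoly = 3.
Proof. by rewrite size_mul ?polyXsubC_eq0 // !size_XsubC. Qed.

Lemma wpolyE : wpoly = 'X * 'X + (- (a + b))%:P * 'X + (a * b)%:P.
Proof. by rewrite /wpoly polyCN polyCD polyCM; ring. Qed.

Lemma wpoly_a : wpoly.[a] = 0.
Proof. by rewrite hornerM hornerXsubC subrr mul0r. Qed.

Lemma wpoly_b : wpoly.[b] = 0.
Proof. by rewrite hornerM !hornerXsubC subrr mulr0. Qed.

Lemma monic_wpoly : wpoly \is monic.
Proof. by rewrite monicMl ?monicXsubC. Qed.

Lemma size_wpoly_exp n : size (wpoly ^+ n) = (n.*2).+1.
Proof.
have := size_exp wpoly n; rewrite size_wpoly /= => h.
have : (0 < size (wpoly ^+ n))%N.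
  by rewrite size_poly_gt0 expf_neq0 // monic_neq0 // monic_wpoly.
by move: h; case: (size _) => //= k -> _; rewrite -muln2 mulnC.
Qed.

Lemma coef_rodrigues_neq0 n : (rodrigues n)`_n != 0.
Proof.
rewrite coef_derivn mulrn_eq0 negb_or -lt0n ffact_gt0 leq_addr /=.
have -> : (n + n)%N = (size (wpoly ^+ n)).-1 by rewrite size_wpoly_exp addnn.
by rewrite -lead_coefE lead_coef_eq0 expf_neq0 // monic_neq0 // monic_wpoly.
Qed.

Lemma size_rodrigues n : size (rodrigues n) = n.+1.
Proof.
apply/eqP; rewrite eqn_leq; apply/andP; split; last first.
  rewrite ltnNge; apply/negP => h; have /eqP := coef_rodrigues_neq0 n; apply.
  by rewrite nth_default.
apply/leq_sizeP => j nj; rewrite coef_derivn nth_default ?mul0rn //.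
by rewrite size_wpoly_exp; lia.
Qed.

Lemma derivn_wpoly_exp_a k n : (k < n)%N -> ((wpoly ^+ n)^`(k)).[a] = 0.
Proof.
by move=> kn; rewrite exprMn derivn_XsubC_exp ?(ltnW kn) // (ltn_eqF kn).
Qed.

Lemma derivn_wpoly_exp_b k n : (k < n)%N -> ((wpoly ^+ n)^`(k)).[b] = 0.
Proof.
by move=> kn; rewrite exprMn mulrC derivn_XsubC_exp ?(ltnW kn) // (ltn_eqF kn).
Qed.

(** Integrate by parts [n] times: the derivatives of [wpoly ^+ n] of order below [n] vanish at both
    endpoints, and [q] has no [n]-th derivative left. *)
Lemma rodrigues_orth n q : (size q <= n)%N -> pint a b (rodrigues n * q) = 0.
Proof.
move=> sq.
suff H k : (k <= n)%N -> pint a b (rodrigues n * q) =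
    (-1) ^+ k * pint a b ((wpoly ^+ n)^`(n - k) * q^`(k)).
  by rewrite (H n) // (derivn_poly0 sq) mulr0 pint0 mulr0.
elim: k => [|k IH] kn; first by rewrite subn0 mul1r.
rewrite (IH (ltnW kn)) -[in LHS](subnSK kn) derivnS pint_parts.
rewrite derivn_wpoly_exp_a ?derivn_wpoly_exp_b; try lia.
by rewrite !mul0r subrr sub0r exprS mulrN mulN1r mulNr derivnS.
Qed.

Hypothesis ab : a < b.

Lemma eq0_of_orth n p : (size p <= n)%N ->
  (forall q, (size q <= n)%N -> pint a b (p * q) = 0) -> p = 0.
Proof. by move=> sp H; apply: (pint_sqr_eq0 ab); apply: H. Qed.

Lemma pint_sturm_liouville p q :
  pint a b ((wpoly * p^`())^`() * q) = - pint a b (wpoly * (p^`() * q^`())).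
Proof.
by rewrite pint_parts !(hornerM wpoly) wpoly_a wpoly_b !mul0r subrr sub0r mulrA.
Qed.

Lemma size_sturm_liouville p n : (size p <= n)%N ->
  (size ((wpoly * p^`())^`()) <= n)%N.
Proof.
case: n => [|n] sp.
  by move: sp; rewrite leqn0 size_poly_eq0 => /eqP ->; rewrite linear0 mulr0 linear0 size_poly0.
have [->|dp0] := eqVneq p^`() 0; first by rewrite mulr0 linear0 size_poly0.
apply: size_deriv_leq; rewrite size_mul // ?monic_neq0 ?monic_wpoly //.
by rewrite size_wpoly polyorder.size_deriv; move: sp; case: (size p).
Qed.

(** The leading coefficients cancel, so the difference of the two sides has degree below [n]. It is
    also orthogonal to all such polynomials, since the operator is symmetric and does not raise
    degrees. *)
Lemma rodrigues_ode n :
  (wpoly * (rodrigues n)^`())^`() = (n * n.+1)%:R *: rodrigues n.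
Proof.
set L := rodrigues n; set D := _^`(); apply/subr0_eq; set p := _ - _.
have sL : (size L <= n.+1)%N by rewrite size_rodrigues.
have sD : (size D <= n.+1)%N by apply: size_sturm_liouville.
have pn : p`_n = 0.
  rewrite coefB coefZ /D coef_deriv wpolyE !mulrDl !coefD -!mulrA coefXM /=.
  rewrite !coefCM !coefXM /= !coef_deriv (nth_default _ sL).
  have -> : L`_n.+2 = 0 by rewrite nth_default // (leq_trans sL).
  rewrite !mul0rn !mulr0 !addr0.
  case: (n) => [|k] /=; first by rewrite !mul0r mul0rn subrr.
  by rewrite -mulrnA mulr_natl subrr.
have sp : (size p <= n)%N.
  apply/leq_sizeP => j; rewrite leq_eqVlt => /predU1P[<-//|nj].
  rewrite coefB coefZ (nth_default _ (leq_trans sD nj)).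
  by rewrite (nth_default _ (leq_trans sL nj)) mulr0 subr0.
apply: (eq0_of_orth sp) => q sq.
rewrite /p mulrBl -scalerAl pintB pintZ rodrigues_orth // mulr0 subr0.
rewrite pint_sturm_liouville (mulrC L^`()) -pint_sturm_liouville mulrC.
by rewrite rodrigues_orth ?oppr0 // size_sturm_liouville.
Qed.

Lemma poly_split_lead n p : (size p <= n.+1)%N ->
  exists c, (size (p - c *: rodrigues n)%R <= n)%N.
Proof.
move=> sp; exists (p`_n / (rodrigues n)`_n); apply/leq_sizeP => j.
rewrite leq_eqVlt coefB coefZ => /predU1P[<-|nj].
  by rewrite divfK ?subrr // coef_rodrigues_neq0.
by rewrite (nth_default _ (leq_trans sp nj)) [(rodrigues n)`_j]nth_default ?size_rodrigues //
  mulr0 subr0.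
Qed.

(** Strip leading multiples of [rodrigues n] with [n >= M]; each is orthogonal to every polynomial
    of size at most [M]. *)
Lemma proj_exists M g : exists2 q : {poly R}, (size q <= M)%N &
  forall r, (size r <= M)%N -> pint a b ((g - q) * r) = 0.
Proof.
have [n] := ubnP (size g); elim: n g => // n IH g; rewrite ltnS => sg.
have [sM|Ms] := leqP (size g) M.
  by exists g => // r _; rewrite subrr mul0r pint0.
case: n sg IH => [|n] sg IH; first lia.
have [c sc] := poly_split_lead sg.
have [q sq qr] := IH (g - c *: rodrigues n) sc; exists q => // r sr.
have -> : g - q = (g - c *: rodrigues n - q) + c *: rodrigues n by ring.
rewrite mulrDl pintD qr // add0r -scalerAl pintZ rodrigues_orth ?mulr0 //.
by lia.
Qed.

(** Such an [e] is a combination of eigenfunctions [rodrigues n] with [n >= M], whose eigenvalues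
    [n (n + 1)] are at least [M (M + 1)]. The induction removes the leading one, and both quadratic
    forms split without cross terms. *)
Lemma orth_spectral_gap M e :
  (forall r, (size r <= M)%N -> pint a b (e * r) = 0) ->
  (M * M.+1)%:R * pint a b (e * e) <= - pint a b (wpoly * (e^`() * e^`())).
Proof.
have [n] := ubnP (size e); elim: n e => // n IH e; rewrite ltnS => se eo.
have [sM|Ms] := leqP (size e) M.
  by rewrite (eq0_of_orth sM eo) linear0 !mul0r !mulr0 pint0 mulr0 oppr0.
case: n se IH => [|n] se IH; first lia.
have [c sc] := poly_split_lead se.
set L := rodrigues n in sc *; set e1 := e - c *: L in sc.
have oL1 : pint a b (L * e1) = 0 by rewrite rodrigues_orth.
have e1o r : (size r <= M)%N -> pint a b (e1 * r) = 0.
  move=> sr; rewrite mulrBl pintB eo // -scalerAl pintZ rodrigues_orth ?mulr0 ?subrr //.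
  by lia.
have eE : e = e1 + c *: L by rewrite subrK.
have := IH e1 sc e1o.
have ode p : - pint a b (wpoly * (L^`() * p^`())) = (n * n.+1)%:R * pint a b (L * p).
  by rewrite -pint_sturm_liouville rodrigues_ode -scalerAl pintZ.
have -> : pint a b (e * e) = pint a b (e1 * e1) + c ^+ 2 * pint a b (L * L).
  rewrite eE.
  have -> : (e1 + c *: L) * (e1 + c *: L) =
     e1 * e1 + (c *: (L * e1)) *+ 2 + c *: (c *: (L * L)).
    by rewrite -!mul_polyC; ring.
  by rewrite !pintD !pintZ oL1; ring.
have -> : - pint a b (wpoly * (e^`() * e^`())) =
   - pint a b (wpoly * (e1^`() * e1^`())) + c ^+ 2 * ((n * n.+1)%:R * pint a b (L * L)).
  rewrite {1 2}eE [(e1 + _)^`()]derivD derivZ.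
  have -> : wpoly * ((e1^`() + c *: L^`()) * (e1^`() + c *: L^`())) =
     wpoly * (e1^`() * e1^`()) + (c *: (wpoly * (L^`() * e1^`()))) *+ 2
     + c *: (c *: (wpoly * (L^`() * L^`()))).
    by rewrite -!mul_polyC; ring.
  rewrite !pintD !pintZ -ode.
  have -> : pint a b (wpoly * (L^`() * e1^`())) = 0.
    by apply/oppr_inj; rewrite ode oL1 mulr0 oppr0.
  by ring.
move=> h; rewrite mulrDr lerD // mulrCA ler_wpM2l ?sqr_ge0 // ler_wpM2r ?pint_sqr_ge0 ?(ltW ab) //.
by rewrite ler_nat; nia.
Qed.

Lemma wpoly_bound x : x \in `[a, b] -> 0 <= - wpoly.[x] <= (b - a) ^+ 2.
Proof.
rewrite in_itv /= hornerM !hornerXsubC => /andP[ax xb].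
by apply/andP; split; nra.
Qed.

Lemma pint_wpoly_le e : - pint a b (wpoly * (e * e)) <= (b - a) ^+ 2 * pint a b (e * e).
Proof.
rewrite -pintN -pintZ; apply: le_pint; first exact: ltW.
move=> x /wpoly_bound/andP[w0 w1]; rewrite hornerN hornerZ (hornerM wpoly) (hornerM e) -mulNr.
by rewrite ler_wpM2r // -expr2 sqr_ge0.
Qed.

Lemma proj_min M g q q' : (size q <= M)%N -> (size q' <= M)%N ->
  (forall r, (size r <= M)%N -> pint a b ((g - q) * r) = 0) ->
  pint a b ((g - q) * (g - q)) <= pint a b ((g - q') * (g - q')).
Proof.
move=> sq sq' qo; set e := g - q; pose d := q - q'.
have -> : g - q' = e + d by rewrite /e /d; ring.
have -> : (e + d) * (e + d) = e * e + (e * d) *+ 2 + d * d by ring.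
have ed : pint a b (e * d) = 0.
  by apply: qo; rewrite (leq_trans (size_polyD _ _)) // size_polyN geq_max sq.
rewrite !pintD ed !addr0.
by rewrite lerDl pint_sqr_ge0 // ltW.
Qed.

Lemma proj_le M g q : (size q <= M)%N ->
  (forall r, (size r <= M)%N -> pint a b ((g - q) * r) = 0) ->
  pint a b ((g - q) * (g - q)) <= pint a b (g * g).
Proof.
by move=> sq qo; have := @proj_min M g q 0 sq; rewrite size_poly0 subr0; apply.
Qed.

(** The weighted energy of [g] is the sum of those of [g - q] and [q]: the operator maps [q] to a
    polynomial of size at most [M], so the cross term vanishes. Hence the energy in
    [orth_spectral_gap] is at most that of [g]. *)
Lemma jackson1 M g q : (size q <= M)%N ->
  (forall r, (size r <= M)%N -> pint a b ((g - q) * r) = 0) ->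
  M%:R ^+ 2 * pint a b ((g - q) * (g - q)) <= (b - a) ^+ 2 * pint a b (g^`() * g^`()).
Proof.
move=> sq qo; have [e eE] : exists e, e = g - q by exists (g - q).
rewrite -!eE in qo *.
apply: (@le_trans _ _ ((M * M.+1)%:R * pint a b (e * e))).
  by rewrite ler_wpM2r ?pint_sqr_ge0 ?(ltW ab) // -natrX ler_nat; nia.
apply: (le_trans (orth_spectral_gap qo)).
apply: (@le_trans _ _ (- pint a b (wpoly * (g^`() * g^`())))); last exact: pint_wpoly_le.
have cross : pint a b (wpoly * (q^`() * e^`())) = 0.
  apply/oppr_inj; rewrite -pint_sturm_liouville oppr0 mulrC qo //.
  exact: size_sturm_liouville.
have -> : g = e + q by rewrite eE subrK.
rewrite [(e + q)^`()]derivD.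
have -> : wpoly * ((e^`() + q^`()) * (e^`() + q^`())) =
  wpoly * (e^`() * e^`()) + (wpoly * (q^`() * e^`())) *+ 2 + wpoly * (q^`() * q^`()).
  by ring.
rewrite !pintD cross !addr0 opprD lerDl -pintN.
apply: pint_ge0; first exact: ltW.
move=> x /wpoly_bound/andP[w0 _]; rewrite hornerN (hornerM wpoly) (hornerM q^`()) -mulNr mulr_ge0 // -expr2.
exact: sqr_ge0.
Qed.

End Rodrigues.

(** * Jackson-type estimates for polynomials *)

Section Jackson.
Context {R : rcfType} (a b : R).
Hypothesis ab : a < b.
Implicit Types (p q r e g u : {poly R}) (n M N : nat).

Definition hsq n g : R := \sum_(0 <= k < n.+1) pint a b (g^`(k) * g^`(k)).

Lemma hsq_ge0 n g : 0 <= hsq n g.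
Proof. by apply: sumr_ge0 => k _; rewrite pint_sqr_ge0 // ltW. Qed.

Lemma hsqS n g : hsq n.+1 g = pint a b (g * g) + hsq n g^`().
Proof.
rewrite /hsq big_nat_recl //=; congr (_ + _).
by apply: eq_bigr => k _; rewrite -derivSn.
Qed.

(** Each derivative gains one power of the dimension: subtract from [g] an antiderivative of the
    projection of [g'] and apply [jackson1]. The weight [M.+1] instead of [M] keeps the bound
    meaningful for [M = 0]. *)
Lemma jackson n : exists2 C, 0 <= C & forall M g q, (size q <= M)%N ->
  (forall r, (size r <= M)%N -> pint a b ((g - q) * r) = 0) ->
  M.+1%:R ^+ (2 * n) * pint a b ((g - q) * (g - q)) <= C * hsq n g.
Proof.
elim: n => [|n [C C0 IH]].
  exists 1 => //.
  by move=> M g q sq qo; rewrite !mul1r /hsq big_nat1; apply: (proj_le ab sq qo).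
have D0 : 0 <= 4 ^+ n.+1 * (b - a) ^+ 2 * C.
  by apply: mulr_ge0 => //; apply: mulr_ge0; [apply: exprn_ge0; rewrite ler0n | rewrite sqr_ge0].
exists (1 + 4 ^+ n.+1 * (b - a) ^+ 2 * C); first by rewrite addr_ge0.
move=> [|M] g q sq qo.
  rewrite expr1n mul1r (le_trans (proj_le ab sq qo)) // mulrDl mul1r hsqS.
  by rewrite -addrA lerDl addr_ge0 ?hsq_ge0 // -hsqS mulr_ge0 ?hsq_ge0.
have [q1 sq1 q1o] := proj_exists ab M g^`().
pose p := antideriv q1.
have sp : (size p <= M.+1)%N by rewrite (leq_trans (size_antideriv _)).
have h1 : M.+1%:R ^+ 2 * pint a b ((g - q) * (g - q)) <=
    (b - a) ^+ 2 * pint a b ((g^`() - q1) * (g^`() - q1)).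
  (* As [p] lies in the space projected onto, [g - p] has the same projection error as [g]. *)
  have := @jackson1 _ a b ab M.+1 (g - p) (q - p).
  have -> : g - p - (q - p) = g - q by ring.
  rewrite derivB deriv_antideriv; apply => //.
  by rewrite (leq_trans (size_polyD _ _)) // size_polyN geq_max sq.
have h2 := IH M g^`() q1 sq1 q1o.
have h3 : (M.+2%:R : R) ^+ (2 * n.+1) <= 4 ^+ n.+1 * M.+1%:R ^+ (2 * n.+1).
  by rewrite !exprM -exprMn -!natrX -natrM -!natrX ler_nat leq_exp2r //; nia.
apply: (@le_trans _ _ (4 ^+ n.+1 * (b - a) ^+ 2 * C * hsq n.+1 g)); last first.
  by rewrite mulrDl lerDr mul1r hsq_ge0.
apply: (le_trans (ler_wpM2r (pint_sqr_ge0 _ (ltW ab)) h3)).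
have -> : 4 ^+ n.+1 * (b - a) ^+ 2 * C * hsq n.+1 g =
  4 ^+ n.+1 * ((b - a) ^+ 2 * (C * hsq n.+1 g)) by ring.
rewrite -(mulrA (4 ^+ _)) ler_wpM2l ?exprn_ge0 ?ler0n //.
rewrite mulnS exprD -mulrA mulrCA.
apply: (le_trans (ler_wpM2l (exprn_ge0 _ (ler0n _ _)) h1)).
rewrite mulrCA ler_wpM2l ?sqr_ge0 //.
apply: (le_trans h2); rewrite ler_wpM2l // hsqS lerDr pint_sqr_ge0 //.
exact: ltW.
Qed.

(* [q^`(2)] is the orthogonal projection of [u^`(2)] and [q] interpolates [u] at both
   endpoints; the additional power of [N] for [e^`()] comes from duality. *)
Lemma h2_approx n : exists2 C, 0 <= C & forall N u, (2 <= N)%N ->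
  exists q, [/\ (size q <= N)%N, q.[a] = u.[a], q.[b] = u.[b] &
    let e := u - q in let H := hsq n u^`(2) in
    [/\ N.-1%:R ^+ (2 * n) * pint a b (e^`(2) * e^`(2)) <= C * H,
        N.-1%:R ^+ (2 * n.+1) * pint a b (e^`() * e^`()) <= C * H &
        N.-1%:R ^+ (2 * n.+1) * pint a b (e * e) <= C * H]].
Proof.
have [C C0 hC] := jackson n.
have ba : 0 < b - a by rewrite subr_gt0.
have ba' : b - a != 0 by rewrite gt_eqF.
have B0 : 0 <= (b - a) ^+ 2 by rewrite sqr_ge0.
have [D D0 DE] : exists2 D, 0 <= D & D = 4 * (b - a) ^+ 2.
  by exists (4 * (b - a) ^+ 2) => //; apply: mulr_ge0 B0; rewrite ler0n.
exists (C + D * C + (b - a) ^+ 2 * D * C).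
  by apply: addr_ge0; [apply: addr_ge0|] => //; apply: mulr_ge0 => //; apply: mulr_ge0.
move=> [//|[//|M]] u _ /=.
have [q2 sq2 q2o] := proj_exists ab M u^`()^`().
pose q1 := antideriv (antideriv q2); pose d := u - q1.
(* The affine [l] corrects the endpoint values of [q1] without changing its second derivative. *)
pose c1 := (d.[b] - d.[a]) / (b - a).
pose l : {poly R} := (d.[a])%:P + c1%:P * ('X - a%:P).
have la : l.[a] = d.[a] by rewrite hornerD hornerC hornerM hornerC hornerXsubC subrr mulr0 addr0.
have lb : l.[b] = d.[b].
  rewrite hornerD hornerC hornerM hornerC hornerXsubC /c1 divfK //.
  by rewrite addrC subrK.
have l2 : l^`()^`() = 0.
  by rewrite !(derivD, derivM, derivN, derivC, derivX); ring.
have sl : (size l <= 2)%N.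
  rewrite (leq_trans (size_polyD _ _)) // geq_max.
  rewrite (leq_trans (size_polyC_leq1 _)) //= mul_polyC.
  by rewrite (leq_trans (size_scale_leq _ _)) // size_XsubC.
have hq1 : (size q1 <= M.+2)%N.
  by rewrite (leq_trans (size_antideriv _)) // ltnS (leq_trans (size_antideriv _)).
set q := q1 + l; set e := u - q.
have ea : e.[a] = 0 by rewrite /e /q opprD addrA hornerD hornerN la subrr.
have eb : e.[b] = 0 by rewrite /e /q opprD addrA hornerD hornerN lb subrr.
have ddq : q^`()^`() = q2 by rewrite (derivD q1 l) (derivD q1^`()) l2 addr0 !deriv_antideriv.
have dde : e^`()^`() = u^`()^`() - q2 by rewrite (derivB u q) (derivB u^`()) ddq.
exists q; split.
- by rewrite (leq_trans (size_polyD _ _)) // geq_max hq1 (leq_trans sl).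
- by apply/esym/subr0_eq; rewrite -hornerN -hornerD.
- by apply/esym/subr0_eq; rewrite -hornerN -hornerD.
set H := hsq _ _; have H0 : 0 <= H by apply: hsq_ge0.
set X := pint a b (e^`() * e^`()); set Y := pint a b (e^`()^`() * e^`()^`()).
have X0 : 0 <= X by rewrite pint_sqr_ge0 ?ltW.
have Y0 : 0 <= Y by rewrite pint_sqr_ge0 ?ltW.
set K : R := M.+1%:R; have K0 : 0 <= K by rewrite ler0n.
have hY : K ^+ (2 * n) * Y <= C * H by rewrite /Y dde; apply: hC.
have hee : pint a b (e * e) <= (b - a) ^+ 2 * X by apply: poincare_int => //; apply: ltW.
have hX : K ^+ 2 * X <= D * Y.
  have [s ss so] := proj_exists ab M e.
  (* After an integration by parts, the projection [s] of [e] may be subtracted because [e''] is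
     orthogonal to it. Cauchy-Schwarz then bounds [X^2] by [Z * Y], where [Z] is itself controlled
     by [X]. *)
  have XE : X = - pint a b ((e - s) * e^`()^`()).
    rewrite mulrBl pintB (mulrC s) {2}dde q2o // subr0.
    by rewrite /X pint_parts ea eb !mul0r subrr sub0r.
  have cs := @pint_CS _ a b (e - s) e^`()^`() (ltW ab).
  rewrite -sqrrN -XE -/Y in cs.
  set Z := pint a b ((e - s) * (e - s)) in cs.
  have Z0 : 0 <= Z by rewrite pint_sqr_ge0 ?ltW.
  have hZ1 : M%:R ^+ 2 * Z <= (b - a) ^+ 2 * X by apply: jackson1.
  have hZ2 : Z <= (b - a) ^+ 2 * X by apply: (le_trans (proj_le ab ss so)).
  (* [(M + 1)^2 <= 2 (M^2 + 1)] combines [hZ1] and [hZ2], which explains the 4 in [D]. *)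
  have hZ : K ^+ 2 * Z <= D * X.
    have -> : K = M%:R + 1 by rewrite /K -natr1.
    have := sqr_ge0 (M%:R - 1 : R); rewrite DE; nra.
  have [->|Xn0] := eqVneq X 0; first by rewrite mulr0 mulr_ge0.
  have Xp : 0 < X by rewrite lt_neqAle eq_sym Xn0.
  rewrite -(ler_pM2r Xp) -mulrA -expr2.
  apply: (le_trans (ler_wpM2l (sqr_ge0 K) cs)).
  by rewrite (mulrA (K ^+ 2)) (mulrAC D); apply: ler_wpM2r.
have hX' : K ^+ (2 * n.+1) * X <= D * C * H.
  rewrite mulnS exprD -mulrA mulrCA.
  apply: (le_trans (ler_wpM2l (exprn_ge0 _ K0) hX)).
  by rewrite mulrCA -mulrA ler_wpM2l.
have t1 : 0 <= C * H by rewrite mulr_ge0.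
have t2 : 0 <= D * C * H by apply: mulr_ge0 => //; apply: mulr_ge0.
have t3 : 0 <= (b - a) ^+ 2 * D * C * H.
  by apply: mulr_ge0 => //; apply: mulr_ge0 => //; apply: mulr_ge0.
have -> : (C + D * C + (b - a) ^+ 2 * D * C) * H =
  C * H + D * C * H + (b - a) ^+ 2 * D * C * H by ring.
split.
- by apply: (le_trans hY); lra.
- by apply: (le_trans hX'); lra.
apply: (le_trans (ler_wpM2l (exprn_ge0 _ K0) hee)).
rewrite mulrCA.
apply: (le_trans (ler_wpM2l B0 hX')).
by rewrite !mulrA; lra.
Qed.

End Jackson.

(** * Legendre polynomials and Gauss-Lobatto quadrature *)

Section CentralBinomial.

Lemma central_binomial_rec k : (k.+1 * 'C(k.+1.*2, k.+1) = 2 * k.*2.+1 * 'C(k.*2, k))%N.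
Proof.
have e1 : 'C(k.+1.*2, k.+1) = (2 * 'C(k.*2.+1, k.+1))%N.
  rewrite doubleS binS mulSn mul1n; congr (_ + _)%N.
  by rewrite -(@bin_sub k.*2.+1 k.+1) ?subSS -?addnn ?addnK // ltnS leq_addr.
have e2 : (k.*2.+1 * 'C(k.*2, k) = k.+1 * 'C(k.*2.+1, k.+1))%N by exact: mul_bin_diag.
by rewrite e1 mulnCA -e2 mulnA.
Qed.

(** The squared form of C(2k, k) >= 4^k / (2 sqrt k), for the size of Legendre polynomials at 0. The
    induction step rests on 4 k (k + 1) <= (2k + 1)^2. *)
Lemma central_binomial_ge k : (16 ^ k.+1 <= 4 * k.+1 * 'C(k.+1.*2, k.+1) ^ 2)%N.
Proof.
elim: k => [|k IH]; first by [].
have e := central_binomial_rec k.+1.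
rewrite -(@leq_pmul2l (k.+2 ^ 1)) // expn1.
have -> : (k.+2 * (4 * k.+2 * 'C(k.+2.*2, k.+2) ^ 2) =
  4 * (k.+2 * 'C(k.+2.*2, k.+2)) ^ 2)%N by rewrite expnMn; ring.
rewrite e !expnMn expnS.
have h : (4 * k.+1 * k.+2 <= k.+1.*2.+1 ^ 2)%N by nia.
set C2 := ('C(k.+1.*2, k.+1) ^ 2)%N in IH *.
apply: (@leq_trans (k.+2 * (16 * (4 * k.+1 * C2)))).
  by rewrite leq_mul2l leq_mul2l IH !orbT.
have -> : (k.+2 * (16 * (4 * k.+1 * C2)) = 16 * (4 * k.+1 * k.+2) * C2)%N by ring.
have -> : (4 * (2 ^ 2 * k.+1.*2.+1 ^ 2 * C2) = 16 * k.+1.*2.+1 ^ 2 * C2)%N by ring.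
by rewrite leq_mul2r leq_mul2l h !orbT.
Qed.

End CentralBinomial.

Section RolleSeq.
Context {R : rcfType}.
Implicit Types (p : {poly R}) (s : seq R) (x : R).

(** Rolle on every gap of [x :: s]. The strict inequality of the last entries allows the right
    endpoint to be appended again before the next derivative. *)
Lemma rolle_seq p x s : p.[x] = 0 -> path <%R x s -> all (root p) s ->
  exists s', [/\ size s' = size s, path <%R x s', all (root p^`()) s' &
    s != [::] -> last x s' < last x s].
Proof.
elim: s x => [|y s IH] x px /=; first by move=> _ _; exists [::].
move=> /andP[xy ys] /andP[py sp].
have [s' [ss' ps' rs' ls']] := IH y (rootP py) ys sp.
have [c] := poly_rolle xy (etrans px (esym (rootP py))).
rewrite in_itv /= => /andP[xc cy] dc.
exists (c :: s'); split => //=; first by rewrite ss'.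
- by rewrite xc; case: s' ps' {ss' rs' ls'} => //= z s' /andP[/(lt_trans cy)-> ->].
- by rewrite rs' andbT; apply/rootP.
move=> _; case: s ss' ys sp IH ls' => [|z s] ss' /= ys sp IH ls'.
  by move: ss' => /size0nil ->.
by case: s' ss' ps' ls' {rs'} => //= z' s' _ _; apply.
Qed.

End RolleSeq.

Section Legendre.
Context {R : rcfType} (N : nat).
Hypothesis N2 : (2 <= N)%N.
Implicit Types (p q r : {poly R}) (x y : R).

Local Notation w := (wpoly (-1 : R) 1).
Local Notation I := (pint (-1 : R) 1).

Definition legp : {poly R} := (2 ^+ N * (N`!)%:R)^-1 *: rodrigues (-1) 1 N.

Local Notation L := legp.
Local Notation lam := ((N * N.+1)%:R : R).

Let m11 : (-1 : R) < 1. Proof. lra. Qed.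

Lemma legp_coef_neq0 : (2 ^+ N * (N`!)%:R)^-1 != 0 :> R.
Proof. by rewrite invr_eq0 mulf_neq0 ?expf_neq0 ?pnatr_eq0 // -lt0n fact_gt0. Qed.

Lemma size_legp : size L = N.+1.
Proof. by rewrite size_scale ?size_rodrigues ?legp_coef_neq0. Qed.

Lemma legp_orth q : (size q <= N)%N -> I (L * q) = 0.
Proof. by move=> sq; rewrite -scalerAl pintZ rodrigues_orth ?mulr0. Qed.

Lemma legp_ode : (w * L^`())^`() = lam *: L.
Proof.
by rewrite /legp derivZ -scalerAr derivZ rodrigues_ode // !scalerA mulrC.
Qed.

Lemma legp_1 : L.[1] = 1.
Proof.
have wE : w ^+ N = ('X - 1%:P) ^+ N * ('X - (-1)%:P) ^+ N by rewrite exprMn mulrC.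
rewrite hornerZ /rodrigues wE derivn_XsubC_exp // eqxx horner_exp.
have -> : ('X - (-1)%:P).[1] = 2 :> R by rewrite hornerXsubC; ring.
by rewrite -(mulr_natr (2 ^+ N)) mulVf // mulf_neq0 ?expf_neq0 ?pnatr_eq0.
Qed.

Lemma legp_N1 : L.[-1] ^+ 2 = 1.
Proof.
have wE : w ^+ N = ('X - (-1)%:P) ^+ N * ('X - 1%:P) ^+ N by rewrite exprMn.
rewrite hornerZ /rodrigues wE derivn_XsubC_exp // eqxx horner_exp.
have -> : ('X - 1%:P).[-1] = (-1) * 2 :> R by rewrite hornerXsubC; ring.
rewrite -(mulr_natr (_ ^+ N)) (exprMn _ (-1)) -(mulrA ((-1) ^+ N)) mulrCA.
by rewrite mulVf ?mulr1 ?sqrr_sign.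
Qed.

Lemma coef_wpolyM q k : (size q <= k.+1)%N -> (w * q)`_k.+2 = q`_k.
Proof.
move=> sq; rewrite wpolyE !mulrDl !coefD -!mulrA coefXM /= !coefCM !coefXM /=.
have h1 : q`_k.+1 = 0 by rewrite nth_default.
have h2 : q`_k.+2 = 0 by rewrite nth_default // (leq_trans sq).
by rewrite h1 h2 !mulr0 !addr0.
Qed.

Lemma pint_legp_lead p : (size p <= N.+1)%N ->
  I (L * p) = p`_N / L`_N * I (L * L).
Proof.
move=> sp; set c := p`_N / _.
have Ln : L`_N != 0 by rewrite coefZ mulf_neq0 ?legp_coef_neq0 ?coef_rodrigues_neq0.
have se : (size (p - c *: L)%R <= N)%N.
  apply/leq_sizeP => j; rewrite leq_eqVlt coefB coefZ => /predU1P[<-|nj].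
    by rewrite /c divfK ?subrr.
  rewrite (nth_default _ (leq_trans sp nj)).
  by rewrite [L`_j]nth_default ?size_legp // mulr0 subr0.
have -> : p = (p - c *: L) + c *: L by rewrite subrK.
by rewrite mulrDr pintD legp_orth // add0r -scalerAr pintZ.
Qed.

(** Integrate the derivative of ['X * (L * L)]: the boundary contributes 2, and comparing leading
    coefficients turns ['X * L'] into [N] times [L] under the integral against [L]. *)
Lemma pint_legp_sqr : (2 * N + 1)%:R * I (L * L) = 2.
Proof.
have Ln : L`_N != 0 by rewrite coefZ mulf_neq0 ?legp_coef_neq0 ?coef_rodrigues_neq0.
have h1 : I (L * ('X * L^`())) = N%:R * I (L * L).
  have sd : (size L^`() <= N)%N by rewrite size_deriv_leq // size_legp.
  rewrite pint_legp_lead; last first.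
    apply/leq_sizeP => j nj; rewrite coefXM; case: j nj => // j nj.
    by rewrite nth_default // (leq_trans sd).
  congr (_ * _); rewrite coefXM; case: (N) N2 Ln => // k _ Ln /=.
  by rewrite coef_deriv mulrnAl divff.
have := pint_deriv (-1) 1 ('X * (L * L)).
have -> : ('X * (L * L))^`() = L * L + (L * ('X * L^`())) *+ 2.
  by rewrite !derivM derivX; ring.
rewrite !pintD h1 !hornerM !hornerX legp_1 !mul1r -!expr2 legp_N1 => e.
by rewrite natrD natrM; move: e; lra.
Qed.

Lemma size_wlegp : (size (w * L^`())%R <= N.+2)%N.
Proof.
apply: (leq_trans (size_polyMleq _ _)).
by rewrite size_wpoly polyorder.size_deriv size_legp.
Qed.

Lemma size_factor q y : (size (q * ('X - y%:P))%R <= N.+2)%N -> (size q <= N.+1)%N.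
Proof.
have [->|q0] := eqVneq q 0; first by rewrite size_poly0.
by rewrite size_Mmonic ?monicXsubC // size_XsubC addn2.
Qed.

Lemma coef_MXsubC q y k : (size q <= k.+1)%N -> (q * ('X - y%:P))`_k.+1 = q`_k.
Proof.
by move=> sq; rewrite mulrBr coefB coefMX /= coefMC (@nth_default _ 0 q) // mul0r subr0.
Qed.

(** [Q] is the Lagrange basis polynomial at the node [y] up to a factor, and its integral yields the
    weight. With [D] the quotient of [L - L(y)] by ['X - y], one has [L(y) Q = L Q - L' w D]; after
    integrating the last term by parts, both integrals depend on leading coefficients only. *)
Lemma legp_factor y : (w * L^`()).[y] = 0 ->
  exists Q, [/\ w * L^`() = Q * ('X - y%:P), (size Q <= N.+1)%N,
    Q.[y] = lam * L.[y] & L.[y] * I Q = 2].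
Proof.
move=> /rootP/factor_theorem[Q QE]; exists Q.
have sd : (size L^`() <= N)%N by rewrite size_deriv_leq // size_legp.
have sQ : (size Q <= N.+1)%N by apply: (@size_factor _ y); rewrite -QE size_wlegp.
split => //.
  have := legp_ode; rewrite QE derivM derivXsubC mulr1 => /(congr1 (horner^~ y)).
  by rewrite hornerD hornerM hornerXsubC subrr mulr0 add0r hornerZ.
have Ln : L`_N != 0 by rewrite coefZ mulf_neq0 ?legp_coef_neq0 ?coef_rodrigues_neq0.
have [k kN] : exists k, N = k.+1 by case: (N) N2 => // k _; exists k.
have QN : Q`_N = N%:R * L`_N.
  rewrite -(coef_MXsubC y sQ) -QE {1}kN coef_wpolyM -?kN //.
  by rewrite coef_deriv -kN mulr_natl.
have /factor_theorem[D DE] : root (L - (L.[y])%:P) y.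
  by apply/rootP; rewrite hornerD hornerN hornerC subrr.
have sD : (size D <= N)%N.
  have [->|D0] := eqVneq D 0; first by rewrite size_poly0.
  have : (size (L - (L.[y])%:P)%R <= N.+1)%N.
    rewrite (leq_trans (size_polyD _ _)) // size_polyN geq_max size_legp leqnn.
    by rewrite (leq_trans (size_polyC_leq1 _)).
  by rewrite DE size_Mmonic ?monicXsubC // size_XsubC addn2.
have DN : D`_k = L`_N.
  have sD' : (size D <= k.+1)%N by rewrite -kN.
  rewrite -(coef_MXsubC y sD') -DE coefB coefC kN /= subr0 //.
have e1 : L.[y] * I Q = I (L * Q) - I (L^`() * (w * D)).
  rewrite -pintMl -pintB; congr (pint _ _ _).
  have -> : (L.[y])%:P = L - D * ('X - y%:P) by rewrite -DE; ring.
  have -> : L^`() * (w * D) = D * (w * L^`()) by ring.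
  by rewrite QE; ring.
rewrite e1 pint_parts !(hornerM w) wpoly_a wpoly_b !mul0r !mulr0 subrr sub0r opprK.
have swD : (size (w * D)%R <= N.+2)%N.
  apply: (leq_trans (size_polyMleq _ _)).
  by rewrite size_wpoly.
rewrite (pint_legp_lead sQ) (pint_legp_lead (size_deriv_leq swD)) QN coef_deriv.
rewrite [in (w * D)`_N.+1]kN coef_wpolyM -?kN // DN.
have := pint_legp_sqr; rewrite natrD natrM => h.
rewrite mulfK // -(mulr_natr L`_N) [L`_N * _ / _]mulrAC divff // mul1r -natr1.
by move: h; set z := pint _ _ _; lra.
Qed.

(** Repeated use of Rolle, from [w ^+ N] on, gives [N] roots of [L] inside the interval and [N - 1]
    of [L']. Together with the endpoints these are [N + 1] roots of a polynomial of size at most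
    [N + 2], so there are no others. *)
Lemma gll_nodes_exist : exists s : seq R,
  [/\ size s = N.+1, sorted <%R s, nth 0 s 0 = -1, nth 0 s N = 1 &
    forall x, (x \in s) = root (w * L^`()) x].
Proof.
have chain k : (k <= N)%N -> exists s, [/\ size s = k, path <%R (-1) s,
    all (root ((w ^+ N)^`(k))) s & last (-1) s < 1].
  elim: k => [|k IH] kN; first by exists [::]; split.
  have [s [ss ps rs ls]] := IH (ltnW kN).
  have [|||s' [ss' ps' rs' ls']] := @rolle_seq _ ((w ^+ N)^`(k)) (-1) (rcons s 1).
  - exact: derivn_wpoly_exp_a.
  - by rewrite rcons_path ps.
  - by rewrite all_rcons rs andbT; apply/rootP; apply: derivn_wpoly_exp_b.
  exists s'; split; rewrite ?ss' ?size_rcons ?ss //.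
  by move: ls'; rewrite last_rcons; apply; case: (s).
have [[|x s] [ss ps rs ls]] := chain N (leqnn N); first by move: N2; rewrite -ss.
move: ps rs ls => /= /andP[m1x ps] /andP[rx rs] ls.
have [t [st pt rt lt]] := rolle_seq (rootP rx) ps rs.
have s0 : s != [::] by apply/eqP => s0; move: N2; rewrite -ss s0.
have lt1 : last x t < 1 by apply: lt_trans ls; exact: lt.
pose r := -1 :: rcons t 1.
have sr : size r = N.+1 by rewrite /= size_rcons st; move: ss => /= ->.
have or : sorted <%R r.
  rewrite /= rcons_path; case: (t) pt lt1 => [|y t'] /=.
    by move=> _ _; rewrite m11.
  by move=> /andP[xy ->] ->; rewrite (lt_trans m1x).
have rr : all (root (w * L^`())) r.
  apply/allP => y; rewrite inE mem_rcons inE => /or3P[/eqP->|/eqP->|yt];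
    rewrite rootE hornerM ?wpoly_a ?wpoly_b ?mul0r //.
  by move: (allP rt _ yt); rewrite rootE derivZ hornerZ => /eqP->; rewrite !mulr0.
have wL0 : w * L^`() != 0.
  rewrite mulf_neq0 ?(monic_neq0 (monic_wpoly _ _)) // -size_poly_gt0.
  by rewrite polyorder.size_deriv size_legp ltnW.
exists r; split => //.
  by rewrite /= -[N](prednK (ltnW N2)) /= nth_rcons st; move: ss => /= [<-]; rewrite /= ltnn eqxx.
move=> y; apply/idP/idP => [yr|ry]; first exact: (allP rr).
apply/negPn/negP => yr.
have ur : uniq (y :: r) by rewrite cons_uniq yr lt_sorted_uniq.
have : (size (y :: r) < size (w * L^`())%R)%N by apply: max_poly_roots => //=; rewrite ry.
have -> : size (y :: r) = N.+2 by rewrite -sr.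
by rewrite ltnNge size_wlegp.
Qed.

(* The right-hand side, Sonin's function, has a derivative with the sign of [y]. *)
Lemma legp_amplitude y :
  lam * L.[0] ^+ 2 + L^`().[0] ^+ 2 <= lam * L.[y] ^+ 2 - (w * (L^`() * L^`())).[y].
Proof.
set G : {poly R} := lam *: (L * L) - w * (L^`() * L^`()).
have dG : G^`() = 'X * (L^`() * L^`()) *+ 2.
  have ode := legp_ode; rewrite derivM in ode.
  have dw : w^`() = 'X *+ 2.
    by rewrite derivM !derivXsubC mul1r mulr1 polyCN; ring.
  rewrite /G derivB derivZ (derivM L) (derivM w) (derivM L^`()) dw -!mul_polyC.
  have -> : lam%:P * (L^`() * L + L * L^`()) = (lam *: L) * L^`() *+ 2.
    by rewrite -mul_polyC; ring.
  by rewrite -ode dw; ring.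
have GE z : G.[z] = lam * L.[z] ^+ 2 - (w * (L^`() * L^`())).[z].
  by rewrite hornerD hornerN hornerZ hornerM expr2.
have -> : lam * L.[0] ^+ 2 + L^`().[0] ^+ 2 = G.[0].
  by rewrite GE !hornerM !hornerXsubC -expr2; ring.
have dGE z : G^`().[z] = z * L^`().[z] ^+ 2 *+ 2.
  by rewrite dG hornerMn hornerM hornerX hornerM expr2.
rewrite -GE; have [y0|/ltW y0] := leP 0 y.
  apply: (@ler_hornerW _ 0 y) => //; rewrite ?in_itv /= ?lexx ?y0 //.
  move=> z; rewrite in_itv /= => /andP[/ltW z0 _].
  by rewrite dGE mulrn_wge0 // mulr_ge0 // sqr_ge0.
rewrite -lerN2 -!hornerN.
apply: (@ler_hornerW _ y 0) => //; rewrite ?in_itv /= ?lexx ?y0 //.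
move=> z; rewrite in_itv /= => /andP[_ /ltW z0].
by rewrite derivN hornerN dGE -mulNrn -mulNr mulrn_wge0 // mulr_ge0 ?sqr_ge0 ?oppr_ge0.
Qed.

(** Squaring removes the alternating sign in the expansion of [('X^2 - 1) ^+ N]. *)
Lemma coef_wN_exp k : (k <= N)%N -> (w ^+ N)`_(k.*2) ^+ 2 = ('C(N, k)%:R) ^+ 2 :> R.
Proof.
move=> kN.
have -> : w = 'X ^+ 2 - 1.
  by rewrite /wpoly polyCN; ring.
rewrite exprBn coef_sum (bigD1 (Ordinal (leq_subr k N : (N - k < N.+1)%N))) //=.
rewrite big1 => [|i /eqP/val_eqP /= ik].
  rewrite addr0 coefMn expr1n mulr1 subKn // -exprM mul2n.
  rewrite -[(-1) ^+ (N - k)]/(((-1) : {poly R}) ^+ _) -signr_odd bin_sub //.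
  by case: (odd _); rewrite ?expr0 ?expr1 ?mulN1r ?mul1r ?coefN coefXn eqxx ?mulNrn ?sqrrN.
rewrite coefMn expr1n mulr1 -exprM -signr_odd.
have -> : ((-1) ^+ odd i * 'X^(2 * (N - i)))`_k.*2 = 0 :> R.
  have h : (k.*2 == 2 * (N - i))%N = false by apply/negbTE/eqP; move: (ltn_ord i) ik; lia.
  by case: (odd _); rewrite ?expr0 ?expr1 ?mulN1r ?mul1r ?coefN coefXn h ?oppr0.
by rewrite mul0rn.
Qed.

Lemma coef0_legp : L.[0] ^+ 2 = ((w ^+ N)`_N / 2 ^+ N) ^+ 2.
Proof.
rewrite hornerZ horner_coef0 /rodrigues coef_derivn addn0 ffactnn; congr (_ ^+ 2).
have f0 : (N`!)%:R != 0 :> R by rewrite pnatr_eq0 -lt0n fact_gt0.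
have t0 : 2 ^+ N != 0 :> R by rewrite expf_neq0 // pnatr_eq0.
by rewrite -(mulr_natr (_ `_N)); field; rewrite f0 t0.
Qed.

Lemma coef1_legp : L^`().[0] ^+ 2 = (N.+1%:R * (w ^+ N)`_N.+1 / 2 ^+ N) ^+ 2.
Proof.
rewrite derivZ hornerZ horner_coef0 /rodrigues coef_deriv coef_derivn addn1; congr (_ ^+ 2).
rewrite mulr1n ffactSS ffact1 || idtac.
have f0 : (N`!)%:R != 0 :> R by rewrite pnatr_eq0 -lt0n fact_gt0.
have t0 : 2 ^+ N != 0 :> R by rewrite expf_neq0 // pnatr_eq0.
have -> : (N.+1 ^_ N = N.+1`!)%N by rewrite -[RHS](@ffact_fact N.+1 N) // subSnn muln1.
rewrite -(mulr_natr (_ `_N.+1)) factS natrM.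
by field; rewrite f0 t0.
Qed.

(** Where [w L'] vanishes, the amplitude is [lam * L(y)^2], hence at least its value at 0. For odd
    [N] the term [L'(0)^2] of that value is kept, for even [N] the term [lam * L(0)^2]; each is a
    squared central binomial coefficient up to explicit factors. *)
Lemma legp_lower y : (w * L^`()).[y] = 0 -> (2 * N%:R)^-1 <= L.[y] ^+ 2.
Proof.
move=> wy; have := legp_amplitude y.
have -> : (w * (L^`() * L^`())).[y] = 0 by rewrite mulrA hornerM wy mul0r.
rewrite subr0 => h.
have N0 : 0 < N%:R :> R by rewrite ltr0n; lia.
have lam0 : 0 < lam by rewrite ltr0n; lia.
have two0 : 0 < 2 ^+ N :> R by rewrite exprn_gt0.
rewrite -(ler_pM2l lam0); apply: le_trans h.
have -> : lam / (2 * N%:R) = N.+1%:R / 2.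
  by rewrite natrM; field; rewrite gt_eqF.
have pE K e : (N * 2 + e = K * 4)%N -> ((2 : R) ^+ N) ^+ 2 * 2 ^+ e = 16 ^+ K.
  by move=> E; rewrite -exprM -exprD E mulnC exprM; congr (_ ^+ _); ring.
have [k [kN|kN]] : exists k, N.+1 = k.+1.*2 \/ N = k.+1.*2.
- exists N.-1./2; clear - N2; have [oN|eN] := boolP (odd N); [left|right]; lia.
- have C1 : ('C(k.+1.*2, k.+1) = 2 * 'C(N, k.+1))%N.
    rewrite -kN binS mulSn mul1n; congr (_ + _)%N.
    have kN1 : (k.+1 <= N)%N by clear - kN; lia.
    by rewrite -(bin_sub kN1); congr 'C(_, _); clear - kN; lia.
  have := central_binomial_ge k; rewrite C1 => H.
  have e2 : (N * 2 + 2 = k.+1 * 4)%N by clear - kN; lia.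
  have kN1 : (k.+1 <= N)%N by clear - kN; lia.
  rewrite coef1_legp kN !(exprMn 2) coef_wN_exp //.
  have H' : 16 ^+ k.+1 <= 16 * k.+1%:R * ('C(N, k.+1)%:R) ^+ 2 :> R.
    rewrite -!natrX -!natrM ler_nat (leq_trans H) // expnMn.
    by rewrite leq_eqVlt; apply/orP; left; apply/eqP; ring.
  have {}e2 := pE _ _ e2; rewrite -e2 in H'.
  have L0 : 0 <= lam * L.[0] ^+ 2 by rewrite mulr_ge0 ?sqr_ge0 // ltW.
  apply: (@le_trans _ _ ((k.+1.*2)%:R ^+ 2 * 'C(N, k.+1)%:R ^+ 2 * 2 ^- N ^+ 2)); last by rewrite lerDr -kN.
  have T0 : 0 < (2 ^+ N) ^+ 2 :> R by rewrite exprn_gt0.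
  rewrite exprVn ler_pdivlMr // -mul2n natrM.
  have K0 : 0 < k.+1%:R :> R by rewrite ltr0n.
  by move: H'; set T := (2 ^+ N) ^+ 2; set K := k.+1%:R in K0 *; nra.
have := central_binomial_ge k; rewrite -kN => H.
have e2 : (N * 2 + 0 = k.+1 * 4)%N by clear - kN; lia.
have kN1 : (k.+1 <= N)%N by clear - kN; lia.
have {}e2 := pE _ _ e2; rewrite mulr1 in e2.
have H' : 16 ^+ k.+1 <= 2 * N%:R * ('C(N, k.+1)%:R) ^+ 2 :> R.
  have NE : (2 * N = 4 * k.+1)%N by clear - kN; lia.
  by rewrite -!natrX -!natrM NE ler_nat.
rewrite -e2 in H'.
have T0 : 0 < (2 ^+ N) ^+ 2 :> R by rewrite exprn_gt0.
apply: (@le_trans _ _ (lam * L.[0] ^+ 2)); last by rewrite lerDl sqr_ge0.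
have hc : (w ^+ N)`_N ^+ 2 = 'C(N, k.+1)%:R ^+ 2 by rewrite -coef_wN_exp // -kN.
rewrite coef0_legp (exprMn 2) hc exprVn mulrA ler_pdivlMr // natrM.
have N1 : 0 < N.+1%:R :> R by rewrite ltr0n.
by move: H'; set T := (2 ^+ N) ^+ 2; set K := N.+1%:R in N1 *; nra.
Qed.

Section Quadrature.
Variable xs : 'I_N.+1 -> R.
Hypothesis xs_lt : forall i j : 'I_N.+1, (i < j)%N -> xs i < xs j.
Hypothesis xs_root : forall i, (w * L^`()).[xs i] = 0.

Definition gllw (i : 'I_N.+1) : R := 2 / (N%:R * N.+1%:R) * (L.[xs i] ^+ 2)^-1.

Lemma gllw_ge0 i : 0 <= gllw i.
Proof. by rewrite mulr_ge0 ?divr_ge0 ?invr_ge0 ?sqr_ge0 // mulr_ge0. Qed.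

Lemma gllw_le i : gllw i <= 4 / N.+1%:R.
Proof.
have h := legp_lower (xs_root i).
have N0 : 0 < N%:R :> R by rewrite ltr0n ltnW.
have N10 : 0 < N.+1%:R :> R by rewrite ltr0n.
have fE (A B : R) : A != 0 -> B != 0 -> 4 / B = 2 / (A * B) * (2 * A).
  by move=> A0 B0; field; rewrite A0 B0.
rewrite (fE N%:R) ?gt_eqF //.
rewrite ler_wpM2l ?divr_ge0 ?mulr_ge0 //.
have i0 : 0 < (2 * N%:R)^-1 :> R by rewrite invr_gt0 mulr_gt0.
by rewrite -[leRHS]invrK lef_pV2 ?posrE // (lt_le_trans i0).
Qed.

Lemma xs_inj : injective xs.
Proof.
move=> i j e; apply/val_inj; have [/xs_lt|/xs_lt|//] := ltngtP (val i) (val j);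
  by rewrite e ltxx.
Qed.

Lemma lagrange_basis : exists l : 'I_N.+1 -> {poly R}, forall i,
  [/\ (size (l i) <= N.+1)%N, forall j, (l i).[xs j] = (i == j)%:R &
    I (l i) = gllw i].
Proof.
apply: (@fin_all_exists _ (fun=> {poly R}) (fun i l => [/\ (size l <= N.+1)%N,
  forall j, l.[xs j] = (i == j)%:R & I l = gllw i])) => i.
have [Q [QE sQ Qi IQ]] := legp_factor (xs_root i).
have L0 : L.[xs i] != 0.
  by apply/eqP => L0; move: IQ; rewrite L0 mul0r => /esym/eqP; rewrite pnatr_eq0.
have N0 : N%:R != 0 :> R by rewrite pnatr_eq0 -lt0n ltnW.
have lam0 : lam != 0 by rewrite natrM mulf_neq0 ?pnatr_eq0 // -lt0n ltnW.
exists ((lam * L.[xs i])^-1 *: Q); split.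
- by rewrite (leq_trans (size_scale_leq _ _)).
- move=> j; rewrite hornerZ; case: eqP => [<-|/eqP ij].
    by rewrite Qi mulVf // mulf_neq0.
  have := xs_root j; rewrite QE hornerM hornerXsubC => /eqP.
  rewrite mulf_eq0 subr_eq0 (inj_eq xs_inj) (eq_sym j) (negbTE ij) orbF => /eqP ->.
  by rewrite mulr0.
have IQE : I Q = 2 / L.[xs i] by rewrite -IQ mulrC mulKf.
rewrite pintZ IQE /gllw natrM.
have fE (A B C : R) : A != 0 -> B != 0 -> C != 0 ->
    (A * B * C)^-1 * (2 / C) = 2 / (A * B) / C ^+ 2.
  by move=> A0 B0 C0; field; rewrite A0 B0 C0.
by rewrite fE // pnatr_eq0.
Qed.

(** Divide by [W], which vanishes at the nodes. The quotient has size at most [N - 1], so its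
    product with [W] integrates to 0 by parts and orthogonality of [L]; the remainder equals its
    Lagrange interpolant. *)
Lemma gll_exact p : (size p <= N.*2)%N -> \sum_i p.[xs i] * gllw i = I p.
Proof.
move=> sp; have [l hl] := lagrange_basis.
set W := w * L^`(); have sW : size W = N.+2.
  have d0 : L^`() != 0 by rewrite -size_poly_gt0 polyorder.size_deriv size_legp ltnW.
  rewrite /W mulrC size_Mmonic ?monic_wpoly // polyorder.size_deriv size_legp.
  by rewrite size_wpoly addn3.
have W0 : W != 0 by rewrite -size_poly_gt0 sW.
set q := p %/ W; set r := p %% W.
have sr : (size r <= N.+1)%N by rewrite -ltnS -sW ltn_modp.
have pE : p = q * W + r by apply: divp_eq.
have pr i : p.[xs i] = r.[xs i] by rewrite pE hornerD hornerM xs_root mulr0 add0r.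
have IqW : I (q * W) = 0.
  have -> : q * W = L^`() * (w * q) by rewrite /W; ring.
  rewrite pint_parts !(hornerM w) wpoly_a wpoly_b !mul0r !mulr0 subrr sub0r.
  rewrite legp_orth ?oppr0 //; apply: size_deriv_leq.
  apply: (leq_trans (size_polyMleq _ _)); rewrite size_wpoly /= size_divp // sW.
  by clear - sp N2; move: (size p) sp => sp' sp; rewrite /=; lia.
have rE : r = \sum_i r.[xs i] *: l i.
  apply/subr0_eq/eqP/negPn/negP => e0; set e := _ - _ in e0.
  have se : (size e <= N.+1)%N.
    rewrite (leq_trans (size_polyD _ _)) // size_polyN geq_max sr.
    apply: (leq_trans (size_sum _ _ _)); apply/bigmax_leqP => i _.
    by rewrite (leq_trans (size_scale_leq _ _)) //; case: (hl i).
  have er i : root e (xs i).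
    apply/rootP; rewrite hornerD hornerN horner_sum (bigD1 i) //= big1.
      by rewrite addr0 hornerZ; case: (hl i) => _ -> _; rewrite eqxx mulr1 subrr.
    by move=> j /negbTE ji; rewrite hornerZ; case: (hl j) => _ -> _; rewrite ji mulr0.
  suff : (size [seq xs i | i <- enum 'I_N.+1] < size e)%N.
    by rewrite size_map size_enum_ord ltnNge se.
  apply: max_poly_roots => //.
    apply/allP => y /mapP[i _ ->]; exact: er.
  by rewrite map_inj_uniq ?enum_uniq //; apply: xs_inj.
rewrite [in RHS]pE pintD IqW add0r rE raddf_sum; apply: eq_bigr => i _ /=.
by rewrite pintZ pr; case: (hl i) => _ _ ->.
Qed.

End Quadrature.

End Legendre.

(** * The Chebyshev-Markov-Stieltjes inequalities and the quadrature error *)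

Section MarkovStieltjes.
Context {R : rcfType} (a b : R) (N : nat) (x om : nat -> R).
Implicit Types (q F G : {poly R}) (z t : R) (i j p : nat).
Hypotheses (N0 : (0 < N)%N) (x0 : x 0 = a) (xN : x N = b).
Hypothesis x_lt : forall i j, (i < j <= N)%N -> x i < x j.
Hypothesis om_exact : forall q, (size q <= N.*2)%N ->
  \sum_(0 <= i < N.+1) q.[x i] * om i = pint a b q.

Let c k := \sum_(0 <= i < k) om i.

Let x_le i j : (i <= j <= N)%N -> x i <= x j.
Proof.
move=> /andP[]; rewrite leq_eqVlt => /predU1P[->//|ij jN].
by apply/ltW/x_lt; rewrite ij.
Qed.

Let cN : c N.+1 = b - a.
Proof.
have := @om_exact 1; rewrite size_poly1 double_gt0 => /(_ N0).
rewrite -[1]/(1%:P) pintC mul1r => <-; apply: eq_bigr => i _.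
by rewrite hornerC mul1r.
Qed.

(* The Peano kernel of the rule on [x p, x p.+1]. *)
Let Kp p : {poly R} := 'X - (a + c p.+1)%:P.

(** Integration by parts on each cell and summation over the cells turn the left side into the
    quadrature error of an antiderivative of [q], which is still integrated exactly. *)
Lemma peano_kernel_orth q : (size q < N.*2)%N ->
  \sum_(0 <= p < N) pint (x p) (x p.+1) (q * Kp p) = 0.
Proof.
move=> sq; set Q := antideriv q.
have sQ : (size Q <= N.*2)%N by rewrite (leq_trans (size_antideriv _)).
suff H M : (M <= N)%N -> \sum_(0 <= p < M) pint (x p) (x p.+1) (q * Kp p) =
    Q.[x M] * (x M - a - c M) + \sum_(0 <= i < M) Q.[x i] * om i - pint a (x M) Q.
  rewrite H // xN; have := om_exact sQ; rewrite big_nat_recr //= xN => <-.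
  by have := cN; rewrite /c big_nat_recr //= => <-; ring.
elim: M => [|M IH] MN.
  by rewrite !big_geq // x0 /c ?big_geq // pintE; ring.
rewrite big_nat_recr //= IH ?(ltnW MN) // [in RHS]big_nat_recr //=.
have qE : q = Q^`() by rewrite deriv_antideriv.
rewrite [X in pint _ _ (X * _)]qE pint_parts.
have -> : (Kp M)^`() = 1 by rewrite derivXsubC.
rewrite mulr1 !hornerXsubC (pint_split a (x M) (x M.+1)).
by rewrite /c !(big_nat_recr M) //=; ring.
Qed.

(* The sign change of the kernel on [x p, x p.+1]. If some [s p] were an interior
   node, removing the corresponding double factor from [sfac * xfac] would leave a
   polynomial of degree 2N - 3, orthogonal to the kernel although its product with
   the kernel is nonnegative. *)
Let s p := Num.max (x p) (Num.min (x p.+1) (a + c p.+1)).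

Let s_ge p : x p <= s p. Proof. by rewrite /s le_max lexx. Qed.

Let s_le p : (p < N)%N -> s p <= x p.+1.
Proof. by move=> pN; rewrite /s ge_max ge_min lexx x_le // leqnSn. Qed.

Let Kp_sign p z : (p < N)%N -> z \in `]x p, x p.+1[ -> 0 <= (z - s p) * (Kp p).[z].
Proof.
move=> pN; rewrite in_itv /= hornerXsubC => /andP[z1 z2].
rewrite /s; case: (leP (x p.+1) (a + c p.+1)) => h1.
  by rewrite max_r ?(ltW (lt_trans z1 z2)) // mulr_le0 // subr_le0 ltW // (lt_le_trans z2).
case: (leP (x p) (a + c p.+1)) => h2; first by rewrite -expr2 sqr_ge0.
by rewrite mulr_ge0 // subr_ge0 ltW // (lt_trans h2).
Qed.

Let sfac : {poly R} := \prod_(0 <= i < N) ('X - (s i)%:P).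
Let xfac : {poly R} := \prod_(1 <= i < N) ('X - (x i)%:P).

(** For [z] in cell [p], factors with earlier roots are nonnegative, those with later roots come in
    pairs of nonpositive factors from [sfac] and [xfac], and the factor with root [s p] has the sign
    of the kernel. *)
Let fac_sign p z : (p < N)%N -> z \in `]x p, x p.+1[ ->
  0 <= sfac.[z] * xfac.[z] * (Kp p).[z].
Proof.
move=> pN zp; have := Kp_sign pN zp; move: zp; rewrite in_itv /= => /andP[z1 z2] K0.
rewrite /sfac /xfac !horner_prod (big_cat_nat (n := p)) //=; last exact: ltnW.
rewrite (@big_ltn _ _ _ p N) // hornerXsubC.
rewrite (big_cat_nat (m := 1) (n := p.+1)) //=.
set A := \prod_(0 <= i < p) _; set B := \prod_(p.+1 <= i < N) _.
set C := \prod_(1 <= i < p.+1) _; set D := \prod_(p.+1 <= i < N) _.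
have A0 : 0 <= A.
  rewrite /A big_nat_cond; apply: prodr_ge0 => i; rewrite andbT => /andP[_ ip].
  rewrite hornerXsubC subr_ge0 (le_trans (s_le _)) ?(ltn_trans ip) //.
  by apply/ltW/(le_lt_trans _ z1)/x_le; rewrite ip ltnW.
have C0 : 0 <= C.
  rewrite /C big_nat_cond; apply: prodr_ge0 => i; rewrite andbT => /andP[_ ip].
  by rewrite hornerXsubC subr_ge0; apply/ltW/(le_lt_trans _ z1)/x_le; rewrite -ltnS ip ltnW.
have BD0 : 0 <= B * D.
  rewrite /B /D -big_split /= big_nat_cond; apply: prodr_ge0 => i; rewrite andbT => /andP[pi iN].
  rewrite !hornerXsubC mulr_le0 // subr_le0.
    by apply/ltW/(lt_le_trans z2)/(le_trans _ (s_ge _))/x_le; rewrite pi ltnW.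
  by apply/ltW/(lt_le_trans z2)/x_le; rewrite pi ltnW.
have -> : A * ((z - s p) * B) * (C * D) * (Kp p).[z] =
  A * C * (B * D) * ((z - s p) * (Kp p).[z]) by ring.
by apply: mulr_ge0 => //; apply: mulr_ge0 => //; apply: mulr_ge0.
Qed.

Let ms_contra j p : (0 < j < N)%N -> (p < N)%N -> s p = x j -> False.
Proof.
move=> /andP[j0 jN] pN sp.
set d : {poly R} := 'X - (x j)%:P.
have [q qE] : exists q, sfac * xfac = q * d ^+ 2.
  exists (\prod_(0 <= i < N | i != p) ('X - (s i)%:P) *
          \prod_(1 <= i < N | i != j) ('X - (x i)%:P)).
  rewrite /sfac /xfac (bigD1_seq p) ?mem_index_iota ?iota_uniq //=.
  rewrite [X in _ * X](bigD1_seq j) ?mem_index_iota ?iota_uniq ?j0 //= sp -/d.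
  by ring.
have mon : sfac * xfac \is monic.
  by rewrite monicMl // /sfac /xfac monic_prod // => i _; apply: monicXsubC.
have q0 : q != 0.
  by apply/eqP => q0; move: mon; rewrite qE q0 mul0r monicE lead_coef0 eq_sym oner_eq0.
have sz : size (sfac * xfac) = N.*2.
  rewrite size_Mmonic ?monic_neq0 // /sfac /xfac ?monic_prod // => [|i _|i _]; last 2 first.
  - exact: monicXsubC.
  - exact: monicXsubC.
  rewrite !size_prod_XsubC !size_iota subn0 addnS /= addSn addnBA // addnn subn1.
  by rewrite prednK // double_gt0.
have sq : (size q < N.*2)%N.
  rewrite -sz qE size_Mmonic ?monic_exp ?monicXsubC // size_exp_XsubC.
  by rewrite addnS /= addn2 ltnS leqnSn.
have sgn i z : (i < N)%N -> z \in `]x i, x i.+1[ -> 0 <= (q * Kp i).[z].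
  move=> iN zi; have := fac_sign iN zi; rewrite -hornerM qE !(hornerM q) horner_exp.
  have zj : 0 < d.[z] ^+ 2.
    rewrite exprn_even_gt0 //= hornerXsubC subr_eq0; apply/eqP => zj.
    move: zi; rewrite in_itv /= zj => /andP[h1 h2].
    have [ji|ij] := leqP j i.
      by have := @x_le j i; rewrite ji (ltnW iN) leNgt h1 => /(_ isT).
    by have := @x_le i.+1 j; rewrite ij (ltnW jN) leNgt h2 => /(_ isT).
  by rewrite mulrAC pmulr_lge0.
have pos i : (i < N)%N -> 0 <= pint (x i) (x i.+1) (q * Kp i).
  move=> iN; apply: pint_ge0_oo; first by apply: x_le; rewrite leqnSn.
  by move=> z; apply: sgn.
have := peano_kernel_orth sq; rewrite big_ltn // => e0.
have p0 : pint (x 0) (x 1) (q * Kp 0) = 0.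
  apply/eqP; rewrite eq_le pos // andbT -e0 lerDl big_nat_cond.
  by apply: sumr_ge0 => i; rewrite andbT => /andP[_ iN]; apply: pos.
have /eqP : q * Kp 0 = 0.
  by apply: (@pint_eq0 _ (x 0) (x 1)) => // [|z]; [apply: x_lt; rewrite N0 | apply: sgn].
by rewrite mulf_eq0 (negbTE q0) polyXsubC_eq0.
Qed.

Hypothesis om_ge0 : forall i, 0 <= om i.

(** If an interior node left its interval, the clamping in [s] would return this node:
    [s j.-1 = x j] on one side, [s j = x j] on the other. At the endpoints nonnegative weights
    suffice. *)
Lemma markov_stieltjes j : (j <= N)%N -> a + c j <= x j <= a + c j.+1.
Proof.
move=> jN; have [->|j0] := posnP j.
  have c0 : c 0 = 0 by rewrite /c big_geq.
  have c1 : c 1 = om 0 by rewrite /c big_nat1.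
  by rewrite x0 c0 c1 addr0 lexx lerDl om_ge0.
have [jE|jN'] := eqVneq j N.
  rewrite jE xN cN; have := cN; rewrite /c big_nat_recr //= => e.
  by have omN := om_ge0 N; apply/andP; split; lra.
have {}jN : (j < N)%N by rewrite ltn_neqAle jN'.
apply/andP; split; rewrite leNgt; apply/negP => h.
  have j1N : (j.-1 < N)%N by rewrite (leq_ltn_trans (leq_pred _)).
  apply: (@ms_contra j j.-1); rewrite ?j0 ?jN //.
  rewrite /s prednK // min_l ?(ltW h) // max_r // x_le // leq_pred.
  exact: ltnW.
apply: (@ms_contra j j); rewrite ?j0 ?jN // /s max_l // ge_min (ltW h) orbT //.
Qed.

Variable Om : R.
Hypothesis om_le : forall i, om i <= Om.

(* By Markov-Stieltjes each node lies in the cell cut out by the cumulated weights,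
   whose length is its weight. *)
Lemma quadrature_error F G :
  (forall z, z \in `[a, b] -> `|F^`().[z]| <= G.[z]) ->
  `|pint a b F - \sum_(0 <= i < N.+1) F.[x i] * om i| <= Om * pint a b G.
Proof.
move=> FG; pose y i := a + c i.
have y0 : y 0 = a by rewrite /y /c big_geq ?addr0.
have yN : y N.+1 = b by rewrite /y cN addrC subrK.
have yS i : y i.+1 = y i + om i by rewrite /y /c big_nat_recr //= addrA.
have y_le i : y i <= y i.+1 by rewrite yS lerDl.
have y_mono i j : (i <= j)%N -> y i <= y j.
  by move=> ij; apply: (@homo_leq _ y <=%R) ij => //; apply: le_trans.
have y_ge i : a <= y i by rewrite -y0 y_mono.
have y_leb i : (i <= N.+1)%N -> y i <= b by move=> iN; rewrite -yN y_mono.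
have sumP M P : \sum_(0 <= i < M) pint (y i) (y i.+1) P = pint a (y M) P.
  elim: M => [|M IH]; first by rewrite big_geq // y0 pintE subrr.
  by rewrite big_nat_recr //= IH -pint_split.
rewrite -yN -!sumP -sumrB mulr_sumr.
apply: (le_trans (ler_norm_sum _ _ _)).
rewrite big_nat_cond [leRHS]big_nat_cond; apply: ler_sum => i; rewrite andbT => /andP[_ iN].
have /andP[xi1 xi2] := markov_stieltjes iN; rewrite -/(y i) -/(y i.+1) in xi1 xi2.
have G0 z : z \in `[y i, y i.+1] -> `|F^`().[z]| <= G.[z].
  rewrite in_itv /= => /andP[h1 h2]; apply: FG; rewrite in_itv /=.
  by rewrite (le_trans (y_ge i)) // (le_trans h2) // y_leb.
have I0 : 0 <= pint (y i) (y i.+1) G.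
  apply: pint_ge0 => // z /G0; apply: le_trans; exact: normr_ge0.
have sub u v : y i <= u -> u <= v -> v <= y i.+1 ->
    `|F.[v] - F.[u]| <= pint (y i) (y i.+1) G.
  move=> yu uv vy.
  have inI z : z \in `[u, v] -> z \in `[y i, y i.+1].
    by rewrite !in_itv /= => /andP[h1 h2]; rewrite (le_trans yu) // (le_trans h2).
  have J1 : 0 <= pint (y i) u G.
    apply: pint_ge0 => // z; rewrite in_itv /= => /andP[h1 h2].
    apply: le_trans (G0 z _); first exact: normr_ge0.
    by rewrite in_itv /= h1 (le_trans h2) // (le_trans uv).
  have J2 : 0 <= pint v (y i.+1) G.
    apply: pint_ge0 => // z; rewrite in_itv /= => /andP[h1 h2].
    apply: le_trans (G0 z _); first exact: normr_ge0.
    by rewrite in_itv /= h2 andbT (le_trans yu) // (le_trans uv).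
  apply: (@le_trans _ _ (pint u v G)); last first.
    by rewrite (pint_split (y i) u (y i.+1)) (pint_split u v (y i.+1)); lra.
  rewrite -pint_deriv ler_norml -pintN; apply/andP; split; apply: le_pint => // z /inI/G0.
    by rewrite ler_norml hornerN => /andP[].
  by rewrite ler_norml => /andP[].
have -> : F.[x i] * om i = pint (y i) (y i.+1) (F.[x i])%:P.
  by rewrite pintC yS addrC addKr.
rewrite -pintB.
have pt z : z \in `[y i, y i.+1] ->
    `|(F - (F.[x i])%:P).[z]| <= pint (y i) (y i.+1) G.
  rewrite in_itv /= hornerD hornerN hornerC => /andP[h1 h2].
  by have [xz|/ltW zx] := leP (x i) z; [|rewrite distrC]; apply: sub.
apply: (@le_trans _ _ (om i * pint (y i) (y i.+1) G)); last by rewrite ler_wpM2r.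
have -> : om i * pint (y i) (y i.+1) G = pint (y i) (y i.+1) (pint (y i) (y i.+1) G)%:P.
  by rewrite pintC yS (addrC (y i)) addrK mulrC.
rewrite ler_norml -pintN; apply/andP; split; apply: le_pint => // z /pt.
  by rewrite ler_norml hornerN !hornerC => /andP[].
by rewrite ler_norml hornerC => /andP[].
Qed.

Let ab : a <= b. Proof. by rewrite -x0 -xN x_le // leqnn. Qed.

Let Om0 : 0 <= Om. Proof. exact: le_trans (om_ge0 0) (om_le 0). Qed.

(** Young's inequality with parameter [t] supplies the polynomial majorant of [|(F G)'|] that
    [quadrature_error] asks for. The discriminant argument optimises over [t]. *)
Lemma quadrature_error_mul F G :
  (pint a b (F * G) - \sum_(0 <= i < N.+1) (F * G).[x i] * om i) ^+ 2 <=
  Om ^+ 2 * (pint a b (F * F) + pint a b (F^`() * F^`())) *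
  (pint a b (G * G) + pint a b (G^`() * G^`())).
Proof.
set A := pint a b (F * F) + _; set B := pint a b (G * G) + _; set E := _ - _.
have A0 : 0 <= A by rewrite addr_ge0 ?pint_sqr_ge0.
have B0 : 0 <= B by rewrite addr_ge0 ?pint_sqr_ge0.
have main t : 0 < t -> 2 * `|E| <= Om * (t * A + t^-1 * B).
  move=> t0; have ti : 0 < t^-1 by rewrite invr_gt0.
  have := @quadrature_error (F * G) (2^-1 *: (t *: (F * F + F^`() * F^`())
     + t^-1 *: (G * G + G^`() * G^`()))).
  rewrite -/E pintZ pintD !pintZ !pintD -/A -/B => h.
  have {}h : `|E| <= Om * (2^-1 * (t * A + t^-1 * B)).
    apply: h => z _; rewrite derivM hornerD !hornerZ hornerD !hornerZ !hornerD !hornerM.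
    set f := F.[z]; set f' := F^`().[z]; set g := G.[z]; set g' := G^`().[z].
    have q1 (p q : R) : 0 <= 2^-1 * (t * (p * p) + t^-1 * (q * q)) - p * q.
      have -> : 2^-1 * (t * (p * p) + t^-1 * (q * q)) - p * q = 2^-1 * t^-1 * (t * p - q) ^+ 2.
        by field; rewrite gt_eqF.
      by rewrite mulr_ge0 ?sqr_ge0 // mulr_ge0 ?invr_ge0 ?ltW.
    rewrite ler_norml; apply/andP; split.
      by have := q1 (- f') g; have := q1 (- f) g'; lra.
    by have := q1 f' g; have := q1 f g'; lra.
  by rewrite mulrCA in h; lra.
rewrite -real_normK ?num_real // -sqrrN.
have -> : Om ^+ 2 * A * B = (Om * B) * (Om * A) by ring.
apply: quad_ge0_disc; first by rewrite mulr_ge0.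
move=> t; have [t0|t0] := leP t 0.
  have e1 : 0 <= Om * B by rewrite mulr_ge0.
  have e2 : 0 <= t ^+ 2 * (Om * A) by apply: mulr_ge0 (sqr_ge0 t) _; rewrite mulr_ge0.
  have e3 : 0 <= - t * `|E| by rewrite mulr_ge0 // oppr_ge0.
  by lra.
have := main _ t0; rewrite -(ler_pM2l t0) => h.
have e : t * (Om * (t * A + t^-1 * B)) = Om * B + t ^+ 2 * (Om * A) by field; rewrite gt_eqF.
by rewrite e in h; lra.
Qed.

(** [t] stays free: [1 / (N - 1)] balances a function and a derivative of different approximation
    order, while 1 serves for plain stability. *)
Lemma quadrature_sqr_le F t : 0 < t ->
  \sum_(0 <= i < N.+1) (F * F).[x i] * om i <=
  pint a b (F * F) + Om * (t * pint a b (F^`() * F^`()) + t^-1 * pint a b (F * F)).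
Proof.
move=> t0; have ti : 0 < t^-1 by rewrite invr_gt0.
have := @quadrature_error (F * F) (t *: (F^`() * F^`()) + t^-1 *: (F * F)).
rewrite pintD !pintZ => h; have {}h := h _; suff: forall z, z \in `[a, b] ->
  `|(F * F)^`().[z]| <= (t *: (F^`() * F^`()) + t^-1 *: (F * F)).[z].
  by move/h; rewrite ler_norml => /andP[+ _]; lra.
move=> z _; rewrite derivM !hornerD !hornerZ !hornerM.
set f := F.[z]; set f' := F^`().[z].
have q1 (p q : R) : 0 <= t * (p * p) + t^-1 * (q * q) - 2 * (p * q).
  have -> : t * (p * p) + t^-1 * (q * q) - 2 * (p * q) = t^-1 * (t * p - q) ^+ 2.
    by field; rewrite gt_eqF.
  by rewrite mulr_ge0 ?sqr_ge0 // ltW.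
rewrite ler_norml; apply/andP; split; [have := q1 (- f') f | have := q1 f' f]; lra.
Qed.

End MarkovStieltjes.

(** * Square-integrable functions on (0, S) *)

Section L2.
Context {R : realType} (S : R).
Hypothesis S0 : 0 < S.
Implicit Types (u v g h : R -> R) (p q : {poly R}) (c t : R).

Local Notation mu := (@lebesgue_measure R).
Local Notation J := (`]0, S[%classic : set R).
Local Notation L2 := (in_L2 S).
Local Notation "<< u , v >>" := (inner S u v).

Lemma mJ : measurable J. Proof. exact: measurable_itv. Qed.

Lemma L2_integrable_mul u v : L2 u -> L2 v ->
  mu.-integrable J (EFin \o (fun x => u x * v x)).
Proof.
move=> [mu_ iu] [mv iv].
apply: (@le_integrable _ _ _ mu J mJ _ (fun x => (u x ^+ 2)%:E + (v x ^+ 2)%:E)%E).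
- by apply/measurable_EFinP; apply: measurable_funM.
- move=> x _ /=; rewrite lee_fin [leRHS]ger0_norm ?addr_ge0 ?sqr_ge0 //.
  by rewrite ler_norml; apply/andP; split; nra.
- exact: integrableD.
Qed.

Lemma L2D u v : L2 u -> L2 v -> L2 (fun x => u x + v x).
Proof.
move=> hu hv; have h := L2_integrable_mul hu hv; have [mu_ iu] := hu; have [mv iv] := hv.
split; first exact: measurable_funD.
rewrite (_ : (fun x => _) = (fun x => ((u x ^+ 2)%:E + ((v x ^+ 2)%:E + 2%:E * (u x * v x)%:E)))%E).
  by apply: integrableD => //; apply: integrableD => //; apply: integrableZl.
by apply/funext => x; rewrite -EFinM -!EFinD; congr (_%:E); ring.
Qed.

Lemma L2Z c u : L2 u -> L2 (fun x => c * u x).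
Proof.
move=> [mu_ iu]; split; first exact: measurable_funM.
rewrite (_ : (fun x => _) = (fun x => (c ^+ 2)%:E * (u x ^+ 2)%:E))%E.
  exact: integrableZl.
by apply/funext => x; rewrite -EFinM exprMn.
Qed.

Lemma L2B u v : L2 u -> L2 v -> L2 (fun x => u x - v x).
Proof.
move=> hu hv; have := L2D hu (L2Z (-1) hv).
by rewrite (_ : (fun x => _) = (fun x => u x - v x)) //; apply/funext => x; rewrite mulN1r.
Qed.

Lemma continuous_L2 u : {within `[0, S], continuous u} -> L2 u.
Proof.
move=> cu; have iu (w : R -> R) : {within `[0, S], continuous w} -> mu.-integrable J (EFin \o w).
  move=> cw; apply: (@integrableS _ _ _ mu `[0, S]%classic) => //.
    by apply: subset_itvW; rewrite lexx.
  by apply: continuous_compact_integrable => //; exact: segment_compact.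
split.
  by have /integrableP[/measurable_EFinP] := iu _ cu.
apply: (iu (fun x => u x ^+ 2)) => x.
by apply: (@continuousM _ (subspace `[0, S]%classic) u u) => //; apply: cu.
Qed.

Lemma poly_L2 p : L2 (horner p).
Proof. by apply: continuous_L2; apply: continuous_subspaceT; apply: continuous_horner. Qed.

Lemma innerC u v : <<u, v>> = <<v, u>>.
Proof. by rewrite /inner; under eq_Rintegral do rewrite mulrC. Qed.

Lemma innerDl u v g : L2 u -> L2 v -> L2 g -> <<(fun x => u x + v x), g>> = <<u, g>> + <<v, g>>.
Proof.
move=> hu hv hg; rewrite /inner.
rewrite -(@RintegralD _ _ _ mu J _ _ mJ (L2_integrable_mul hu hg) (L2_integrable_mul hv hg)).
by apply: eq_Rintegral => x _; rewrite mulrDl.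
Qed.

Lemma innerZl c u g : L2 u -> L2 g -> <<(fun x => c * u x), g>> = c * <<u, g>>.
Proof.
move=> hu hg; rewrite /inner -(@RintegralZl _ _ _ mu J _ _ mJ (L2_integrable_mul hu hg)).
by apply: eq_Rintegral => x _; rewrite mulrA.
Qed.

Lemma innerBl u v g : L2 u -> L2 v -> L2 g -> <<(fun x => u x - v x), g>> = <<u, g>> - <<v, g>>.
Proof.
move=> hu hv hg; rewrite -[- <<v, g>>]mulN1r -innerZl // -innerDl //; last exact: L2Z.
by congr inner; apply/funext => x; rewrite mulN1r.
Qed.

Lemma innerBr u v g : L2 u -> L2 v -> L2 g -> <<g, (fun x => u x - v x)>> = <<g, u>> - <<g, v>>.
Proof. by move=> *; rewrite innerC innerBl // !(innerC _ g). Qed.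

Lemma innerDr u v g : L2 u -> L2 v -> L2 g -> <<g, (fun x => u x + v x)>> = <<g, u>> + <<g, v>>.
Proof. by move=> *; rewrite innerC innerDl // !(innerC _ g). Qed.

Lemma innerZr c u g : L2 u -> L2 g -> <<g, (fun x => c * u x)>> = c * <<g, u>>.
Proof. by move=> *; rewrite innerC innerZl // (innerC _ g). Qed.

Lemma inner_ge0 u : 0 <= <<u, u>>.
Proof. by apply: Rintegral_ge0 => x _; rewrite -expr2 sqr_ge0. Qed.

Lemma inner_CS u v : L2 u -> L2 v -> <<u, v>> ^+ 2 <= <<u, u>> * <<v, v>>.
Proof.
move=> hu hv; apply: quad_ge0_disc; first exact: inner_ge0.
move=> t; have := inner_ge0 (fun x => u x + t * v x).
have htv := L2Z t hv; have huv := L2D hu htv.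
rewrite innerDl // !innerDr // innerZl // !innerZr // innerZl // (innerC v u).
by rewrite (_ : _ + _ = <<u, u>> + 2 * t * <<u, v>> + t ^+ 2 * <<v, v>>) //; ring.
Qed.

Lemma inner_FTC u (F : R -> R) : {within `[0, S], continuous u} ->
  (forall x, x \in `[0, S] -> derivable F x 1) -> {in `[0, S], (F^`())%classic =1 u} ->
  \int[mu]_(x in J) u x = F S - F 0.
Proof.
move=> cu dF Fu.
have iS : mu.-integrable `[0, S] (EFin \o u).
  by apply: continuous_compact_integrable => //; exact: segment_compact.
have iu : mu.-integrable `[0, S[ (EFin \o u).
  apply: (integrableS _ _ _ iS) => // x /=.
  by rewrite !in_itv /= => /andP[-> /ltW->].
have iu' : mu.-integrable `]0, S[ (EFin \o u).
  by apply: (integrableS _ _ _ iS) => //; apply: subset_itvW; rewrite lexx.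
rewrite Rintegral_itv_obnd_cbnd // Rintegral_itv_bndo_bndc //.
have dc x : x \in `[0, S] -> {for x, continuous F}.
  by move=> xS; apply/differentiable_continuous/derivable1_diffP/dF.
have xI x : x \in `]0, S[ -> x \in `[0, S].
  by rewrite !in_itv /= => /andP[/ltW-> /ltW->].
rewrite /Rintegral (@continuous_FTC2 _ _ F 0 S) //.
- split; first by move=> x xS; apply/dF/xI.
  + by apply: cvg_at_right_filter; apply: dc; rewrite in_itv /= lexx ltW.
  + by apply: cvg_at_left_filter; apply: dc; rewrite in_itv /= lexx ltW.
- by move=> x xS; apply/Fu/xI.
Qed.

Lemma inner_poly p q : <<horner p, horner q>> = pint 0 S (p * q).
Proof.
rewrite pintE /inner.
under eq_Rintegral do rewrite -hornerM.
apply: inner_FTC.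
- by apply: continuous_subspaceT; apply: continuous_horner.
- by move=> x _; apply: derivable_horner.
- by move=> x _; rewrite -derivE deriv_antideriv.
Qed.

Lemma eq_inner u u' v : {in `]0, S[, u =1 u'} -> <<u, v>> = <<u', v>>.
Proof.
by move=> e; apply: eq_Rintegral => x; rewrite inE /= => xS; rewrite e.
Qed.

Lemma norm0E u : norm0 S u ^+ 2 = <<u, u>>.
Proof. by rewrite sqr_sqrtr // inner_ge0. Qed.

Lemma inner_le u v : L2 u -> L2 v -> `|<<u, v>>| <= norm0 S u * norm0 S v.
Proof.
move=> hu hv; rewrite -sqrtr_sqr /norm0 -sqrtrM ?inner_ge0 // ler_wsqrtr //.
exact: inner_CS.
Qed.

Lemma norm0D u v : L2 u -> L2 v -> norm0 S (fun x => u x + v x) <= norm0 S u + norm0 S v.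
Proof.
move=> hu hv; have huv := L2D hu hv.
have a0 : 0 <= norm0 S u by apply: sqrtr_ge0.
have b0 : 0 <= norm0 S v by apply: sqrtr_ge0.
rewrite -(@ler_pXn2r _ 2) ?nnegrE ?addr_ge0 ?sqrtr_ge0 // norm0E.
rewrite innerDl // !innerDr // (innerC v u).
have /ler_normlP[_ h] := inner_le hu hv.
by rewrite sqrrD !norm0E; lra.
Qed.

End L2.

(** * Density of polynomials in L2 *)

Section Bernstein.
Context {R : realType}.
Implicit Types (phi psi : nat -> R) (y c : R) (n : nat).

(* The Bernstein polynomial with nodal values [phi 0, ..., phi n]. *)
Fixpoint bernstein n phi : {poly R} :=
  if n is n'.+1 then (1 - 'X) * bernstein n' phi + 'X * bernstein n' (fun k => phi k.+1)
  else (phi 0)%:P.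

Lemma bernsteinS n phi y : (bernstein n.+1 phi).[y] =
  (1 - y) * (bernstein n phi).[y] + y * (bernstein n (fun k => phi k.+1)).[y].
Proof. by rewrite /= hornerD !hornerM hornerD hornerN !hornerE. Qed.

Lemma le_bernstein n phi psi y : 0 <= y <= 1 -> (forall k, (k <= n)%N -> phi k <= psi k) ->
  (bernstein n phi).[y] <= (bernstein n psi).[y].
Proof.
move=> /andP[y0 y1]; elim: n phi psi => [|n IH] phi psi le.
  by rewrite /= !hornerC; apply: le.
rewrite !bernsteinS lerD // ler_wpM2l ?subr_ge0 //; apply: IH => k kn; apply: le => //.
exact: leqW.
Qed.

Lemma bernstein_affine n phi y c t : (bernstein n (fun k => c * phi k + t)).[y] =
  c * (bernstein n phi).[y] + t.
Proof.
elim: n phi => [|n IH] phi; first by rewrite /= !hornerC.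
by rewrite !bernsteinS (IH phi) (IH (fun k => phi k.+1)); ring.
Qed.

(** Variance plus squared bias of a binomial distribution. The induction needs all [c], since
    shifting the nodal index replaces [c] by [c - 1]. *)
Lemma bernstein_moment2 n y c : (bernstein n (fun k => (k%:R - c) ^+ 2)).[y] =
  n%:R * y * (1 - y) + (n%:R * y - c) ^+ 2.
Proof.
elim: n c => [|n IH] c; first by rewrite /= hornerC; ring.
rewrite bernsteinS IH.
rewrite (_ : (fun k => _) = (fun k : nat => (k%:R - (c - 1)) ^+ 2)); last first.
  by apply/funext => k; rewrite -natr1; ring.
by rewrite IH -natr1; ring.
Qed.

(** The Bernstein operator is positive, so it preserves the quadratic majorant, whose image is known
    from the second moment. *)
Lemma bernstein_approx n phi y b e M : (0 < n)%N -> 0 <= y <= 1 -> 0 <= M ->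
  (forall k, (k <= n)%N -> `|phi k - b| <= e + M * (k%:R / n%:R - y) ^+ 2) ->
  `|(bernstein n phi).[y] - b| <= e + M / n%:R.
Proof.
move=> n0 y01 M0 H; have nR : 0 < n%:R :> R by rewrite ltr0n.
have nR0 : n%:R != 0 :> R by rewrite gt_eqF.
have mom : (bernstein n (fun k => (M / n%:R ^+ 2) * (k%:R - n%:R * y) ^+ 2 + e)).[y] <= e + M / n%:R.
  rewrite bernstein_affine bernstein_moment2 subrr expr0n addr0 addrC lerD2l.
  have -> : M / n%:R ^+ 2 * (n%:R * y * (1 - y)) = M / n%:R * (y * (1 - y)) by field.
  have a0 : 0 <= M / n%:R by rewrite divr_ge0 // ltW.
  by rewrite ler_piMr //; case/andP: y01 => ? ?; nra.
have E k : (M / n%:R ^+ 2) * (k%:R - n%:R * y) ^+ 2 + e = e + M * (k%:R / n%:R - y) ^+ 2.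
  by field.
have up : (bernstein n (fun k => 1 * phi k + - b)).[y] <= e + M / n%:R.
  apply: le_trans mom; apply: le_bernstein => // k /H.
  by rewrite E mul1r ler_norml => /andP[].
have lo : (bernstein n (fun k => - 1 * phi k + b)).[y] <= e + M / n%:R.
  apply: le_trans mom; apply: le_bernstein => // k /H.
  by rewrite E ler_norml => /andP[+ _]; lra.
by rewrite !bernstein_affine in up lo; rewrite ler_norml; apply/andP; split; lra.
Qed.

End Bernstein.

Section Density.
Context {R : realType} (S : R).
Hypothesis S0 : 0 < S.
Implicit Types (u v g h : R -> R) (p : {poly R}) (e : R).

Local Notation mu := (@lebesgue_measure R).
Local Notation J := (`]0, S[%classic : set R).
Local Notation L2 := (in_L2 S).
Local Notation "<< u , v >>" := (inner S u v).

(** Uniform continuity in the form that [bernstein_approx] consumes: close points differ by at most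
    [e], and for distant points the quadratic term exceeds the trivial bound [2 * B]. *)
Lemma quasi_lipschitz h (B e : R) : continuous h -> (forall x, `|h x| <= B) -> 0 < e ->
  exists2 M, 0 <= M & forall x z, x \in `[0, S] -> z \in `[0, S] ->
    `|h x - h z| <= e + M * (x - z) ^+ 2.
Proof.
move=> ch hB e0.
have /compact_near_coveringP cov := @segment_compact R 0 S.
have [] := cov R (pinfty_nbhs R) (fun M x => forall z, `|h x - h z| <= e + M * (x - z) ^+ 2) _.
  move=> x xS; have e2 : 0 < e / 2 by lra.
  have /cvgrPdist_lt/(_ _ e2) [d /= d0 hd] := ch x.
  have d2 : 0 < d / 2 by rewrite divr_gt0.
  exists (ball x (d / 2), [set M | 2 * B / (d / 2) ^+ 2 < M]).
    split => /=; first exact: nbhsx_ballx.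
    by exists (2 * B / (d / 2) ^+ 2); split; rewrite ?num_real.
  move=> [y M] [/= xy hM] z.
  have B0 : 0 <= B by apply: le_trans (hB 0).
  have M0 : 0 <= M.
    by apply/ltW/(le_lt_trans _ hM); rewrite divr_ge0 ?sqr_ge0 // mulr_ge0.
  have [yz|yz] := ltP `|y - z| (d / 2).
    have hx : `|h x - h y| < e / 2 by apply: hd; rewrite /ball /=; apply: lt_trans xy _; lra.
    have hz : `|h x - h z| < e / 2.
      apply: hd => /=; rewrite (_ : x - z = (x - y) + (y - z)); last by ring.
      by apply: le_lt_trans (ler_normD _ _) _; rewrite /ball /= in xy; lra.
    have h1 : `|h y - h z| <= e.
      rewrite (_ : h y - h z = (h x - h z) - (h x - h y)); last by ring.
      by apply: le_trans (ler_normB _ _) _; lra.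
    by apply: le_trans h1 _; rewrite lerDl mulr_ge0 ?sqr_ge0.
  have h1 : `|h y - h z| <= 2 * B.
    by apply: le_trans (ler_normB _ _) _; have := hB y; have := hB z; lra.
  have h2 : (d / 2) ^+ 2 <= (y - z) ^+ 2.
    by rewrite -(real_normK (num_real (y - z))) ler_pXn2r ?nnegrE // ltW.
  have h3 : 2 * B <= M * (d / 2) ^+ 2.
    by move/ltW : hM; rewrite ler_pdivrMr // exprn_gt0.
  have h4 : M * (d / 2) ^+ 2 <= M * (y - z) ^+ 2 by rewrite ler_wpM2l.
  by lra.
move=> M0 [_ HM]; exists (Num.max M0 0 + 1).
  by rewrite addr_ge0 // le_max lexx orbT.
move=> x z xS zS; apply: HM => //; rewrite (le_lt_trans (_ : _ <= Num.max M0 0)) ?le_max ?lexx //.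
by rewrite ltrDl.
Qed.

Lemma weierstrass h (B e : R) : continuous h -> (forall x, `|h x| <= B) -> 0 < e ->
  exists p, forall x, x \in `[0, S] -> `|h x - p.[x]| <= e.
Proof.
move=> ch hB e0; have e2 : 0 < e / 2 by lra.
have [M M0 hM] := quasi_lipschitz ch hB e2.
have SR : S != 0 by rewrite gt_eqF.
have [n n0 hn] : exists2 n, (0 < n)%N & M * S ^+ 2 / n%:R <= e / 2.
  exists (Num.bound (M * S ^+ 2 / (e / 2))).+1 => //.
  have a0 : 0 <= M * S ^+ 2 / (e / 2).
    by apply: divr_ge0; [apply: mulr_ge0 => //; apply: sqr_ge0 | apply: ltW].
  set K := Num.bound _; have KK : M * S ^+ 2 / (e / 2) <= K.+1%:R.
    by apply: (le_trans (ltW (archi_boundP a0))); rewrite ler_nat.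
  by rewrite ler_pdivrMr ?ltr0n //; move: KK; rewrite ler_pdivrMr //; lra.
have nR : 0 < n%:R :> R by rewrite ltr0n.
exists (bernstein n (fun k => h (S * k%:R / n%:R)) \Po (S^-1 *: 'X)) => x.
rewrite in_itv /= => /andP[x0 xS]; rewrite distrC horner_comp hornerZ hornerX.
have y01 : 0 <= S^-1 * x <= 1.
  apply/andP; split; first by rewrite mulr_ge0 // invr_ge0 ltW.
  by rewrite mulrC ler_pdivrMr // mul1r.
apply: (@le_trans _ _ (e / 2 + M * S ^+ 2 / n%:R)); last by lra.
apply: bernstein_approx => //; first by apply: mulr_ge0 => //; apply: sqr_ge0.
move=> k kn; have := hM (S * k%:R / n%:R) x.
have -> : (S * k%:R / n%:R - x) ^+ 2 = S ^+ 2 * (k%:R / n%:R - S^-1 * x) ^+ 2.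
  have nR0 : n%:R != 0 :> R by rewrite gt_eqF.
  by field; rewrite SR nR0.
rewrite mulrA; apply; last by rewrite in_itv /= x0.
rewrite in_itv /=; apply/andP; split.
  by rewrite divr_ge0 // ?mulr_ge0 // ltW.
by rewrite ler_pdivrMr // ler_pM2l // ler_nat.
Qed.

(** Truncation to the interval from [-n] to [n]; with absolute values its continuity and Lipschitz
    bound are immediate. *)
Definition clamp (n : R) x : R := (`|x + n| - `|x - n|) / 2.

Lemma clamp_lip n x y : `|clamp n x - clamp n y| <= `|x - y|.
Proof.
have h1 := ler_dist_dist (x + n) (y + n); have h2 := ler_dist_dist (x - n) (y - n).
rewrite (_ : x + n - (y + n) = x - y) in h1; last by ring.
rewrite (_ : x - n - (y - n) = x - y) in h2; last by ring.
have -> : clamp n x - clamp n y =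
  ((`|x + n| - `|y + n|) - (`|x - n| - `|y - n|)) / 2 by rewrite /clamp; field.
rewrite normrM [`|2^-1|]ger0_norm ?invr_ge0 // ler_pdivrMr //.
by apply: le_trans (ler_normB _ _) _; lra.
Qed.

Lemma clamp_sub n x : 0 <= n -> `|x - clamp n x| <= `|x|.
Proof.
move=> n0; rewrite /clamp.
case: (ger0P (x + n)) => h1; case: (ger0P (x - n)) => h2; case: (ger0P x) => h3;
  rewrite ler_norml; apply/andP; split; lra.
Qed.

Lemma clamp_bound n x : 0 <= n -> `|clamp n x| <= n.
Proof.
move=> n0; rewrite /clamp.
case: (ger0P (x + n)) => h1; case: (ger0P (x - n)) => h2; rewrite ler_norml; apply/andP; split; lra.
Qed.

Lemma clamp_id n x : `|x| <= n -> clamp n x = x.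
Proof.
rewrite ler_norml => /andP[h1 h2]; rewrite /clamp ger0_norm ?ler0_norm; lra.
Qed.

Lemma continuous_clamp n : continuous (clamp n).
Proof.
move=> x; apply: cvgM; last exact: cvg_cst.
by apply: cvgB; apply: cvg_norm; [apply: cvgD|apply: cvgB]; by [apply: cvg_id|apply: cvg_cst].
Qed.

Lemma L2_bounded u (B : R) : measurable_fun J u -> (forall x, `|u x| <= B) -> L2 u.
Proof.
move=> mu_ uB; split => //.
apply: measurable_bounded_integrable => //.
- have := @lebesgue_measure_itv R `]0, S[; rewrite /= lte_fin S0 => e.
  by apply: (@le_lt_trans _ _ (S%:E - 0%:E)%E); [rewrite -e|rewrite -EFinB ltry].
- exact: measurable_funX.
exists (B ^+ 2); split; first exact: num_real.
move=> M BM x _ /=; apply/ltW/(le_lt_trans _ BM).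
rewrite ger0_norm ?sqr_ge0 // -(real_normK (num_real (u x))) ler_pXn2r ?nnegrE //.
exact: le_trans (uB x).
Qed.

Lemma truncation_L2 g e : L2 g -> 0 < e -> exists2 n : R, 0 < n &
  <<(fun x => g x - clamp n (g x)), (fun x => g x - clamp n (g x))>> < e.
Proof.
move=> [mg ig] e0.
pose F n x := ((g x - clamp n.+1%:R (g x)) ^+ 2)%:E.
have [] := @dominated_convergence _ _ _ mu J (measurable_itv _) F (cst 0%E) (fun x => (g x ^+ 2)%:E).
- move=> n; apply/measurable_EFinP; apply: measurable_funX; apply: measurable_funB => //.
  apply: measurableT_comp => //; apply: continuous_measurable_fun; exact: continuous_clamp.
- exact: measurable_cst.
- apply: aeW => x _; apply: cvg_near_cst; near=> n.
  rewrite /F clamp_id ?subrr ?expr0n //.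
  apply: (@le_trans _ _ n%:R); last by rewrite ler_nat.
  by near: n; apply: nbhs_infty_ger.
- exact: ig.
- apply: aeW => x n _; rewrite /F lee_fin ger0_norm ?sqr_ge0 //.
  rewrite -(real_normK (num_real (g x))) -(real_normK (num_real (_ - _))).
  by rewrite ler_pXn2r ?nnegrE // clamp_sub.
move=> _ _; rewrite integral_cst //= mul0e => /fine_cvgP[_ /cvgrPdist_lt/(_ _ e0)] [N _ /(_ N (leqnn N))].
rewrite /= sub0r normrN => hN; exists N.+1%:R; first by rewrite ltr0n.
apply: le_lt_trans hN; rewrite /inner /Rintegral.
apply: le_trans (ler_norm _); rewrite le_eqVlt; apply/orP; left; apply/eqP.
by congr (fine _); apply: eq_integral => x _; rewrite /F expr2.
Unshelve. all: end_near.
Qed.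

Lemma inner_bound u (B : R) : L2 u -> (forall x, x \in `]0, S[ -> `|u x| <= B) ->
  <<u, u>> <= B ^+ 2 * S.
Proof.
move=> hu uB; have h1 := poly_L2 S B%:P.
have -> : B ^+ 2 * S = <<horner B%:P, horner B%:P>>.
  by rewrite inner_poly // -polyCM pintC subr0 expr2.
apply: (@le_Rintegral _ _ _ mu J _ _ (measurable_itv _)); [exact: L2_integrable_mul..|].
move=> x xS; rewrite !hornerC -!expr2 -(real_normK (num_real (u x))).
have uxB : `|u x| <= B by apply: uB.
by rewrite ler_pXn2r ?nnegrE // (le_trans _ uxB).
Qed.

(** Converts closeness in L1, which approximation by continuous functions provides, into closeness
    in L2 for bounded functions. *)
Lemma inner_sub_le u v (B : R) : 0 <= B -> L2 u -> L2 v -> (forall x, `|u x| <= B) ->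
  (forall x, `|v x| <= B) ->
  <<(fun x => u x - v x), (fun x => u x - v x)>> <=
  2 * B * fine (\int[mu]_(x in J) `|(u x - v x)%:E|).
Proof.
move=> B0 hu hv uB vB.
have hd := L2B hu hv.
have h1 : L2 (cst 1) by apply: (L2_bounded (B := 1)) => // x; rewrite normr1.
have i1 : mu.-integrable J (EFin \o (fun x => u x - v x)).
  have := L2_integrable_mul hd h1; congr (_.-integrable _ _).
  by apply/funext => x /=; rewrite mulr1.
have i2 : mu.-integrable J (EFin \o (fun x => `|u x - v x|)).
  by have := integrable_abse i1.
have -> : fine (\int[mu]_(x in J) `|(u x - v x)%:E|) = \int[mu]_(x in J) `|u x - v x| by [].
rewrite -(@RintegralZl _ _ _ mu J _ _ (measurable_itv _) i2).
apply: (@le_Rintegral _ _ _ mu J _ _ (measurable_itv _)).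
- exact: L2_integrable_mul.
- by have := @integrableZl _ _ _ mu J (measurable_itv _) (2 * B) _ i2.
move=> x _; rewrite -expr2 -(real_normK (num_real (_ - _))) expr2 ler_wpM2r //.
by apply: le_trans (ler_normB _ _) _; have := uB x; have := vB x; lra.
Qed.

(** Three errors of size [e / 3]: truncation of [g], a bounded continuous approximation of the
    truncation, and Weierstrass. *)
Lemma L2_dense g e : L2 g -> 0 < e ->
  exists p, norm0 S (fun x => g x - p.[x]) < e.
Proof.
move=> hg e0; have e3 : 0 < e / 3 by lra.
have e9 : 0 < (e / 3) ^+ 2 by rewrite exprn_gt0.
have [n n0 hn] := truncation_L2 hg e9.
pose gn x := clamp n (g x).
have gnB x : `|gn x| <= n by rewrite clamp_bound // ltW.
have mgn : measurable_fun J gn.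
  apply: measurableT_comp => //; last by case: hg.
  by apply: continuous_measurable_fun; apply: continuous_clamp.
have hgn : L2 gn by apply: (L2_bounded mgn gnB).
have ign : mu.-integrable J (EFin \o gn).
  have h1 : L2 (cst 1) by apply: (L2_bounded (B := 1)) => // x; rewrite normr1.
  have := L2_integrable_mul hgn h1; congr (_.-integrable _ _).
  by apply/funext => x /=; rewrite mulr1.
have Jfin : (mu J < +oo)%E.
  have := @lebesgue_measure_itv R `]0, S[; rewrite /= lte_fin S0 => E.
  by apply: (@le_lt_trans _ _ (S%:E - 0%:E)%E); [rewrite -E|rewrite -EFinB ltry].
have [hk [ch ih]] := approximation_continuous_integrable (measurable_itv _) Jfin ign.
have d0 : 0 < (e / 3) ^+ 2 / (2 * n) by rewrite divr_gt0 // mulr_gt0.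
move=> /fine_cvgP[_ /cvgrPdist_lt/(_ _ d0)] [k _ /(_ k (leqnn k))].
rewrite /= sub0r normrN => hkk.
(* Clamping again restores the bound [n]. As [clamp n] is 1-Lipschitz and fixes [gn], the L1
   distance does not grow. *)
pose h x := clamp n (hk k x).
have hB x : `|h x| <= n by rewrite clamp_bound // ltW.
have cth : continuous h.
  by move=> x; apply: (@continuous_comp _ _ _ (hk k) (clamp n)); [apply: ch|apply: continuous_clamp].
have hh : L2 h.
  apply: (L2_bounded (B := n)) => //.
  by apply: measurable_funTS; apply: continuous_measurable_fun.
have [p hp] : exists p, forall x, x \in `[0, S] -> `|h x - p.[x]| <= (e / 3) / (2 * Num.sqrt S).
  by apply: (weierstrass cth hB); rewrite divr_gt0 // mulr_gt0 ?sqrtr_gt0.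
exists p.
have hL := poly_L2 S p.
have sqrt_lt x : x < (e / 3) ^+ 2 -> Num.sqrt x < e / 3.
  by move=> hx; rewrite -[ltRHS](ger0_norm (ltW e3)) -sqrtr_sqr ltr_sqrt.
have t1 : norm0 S (fun x => g x - gn x) < e / 3 by apply: sqrt_lt.
have t2 : norm0 S (fun x => gn x - h x) < e / 3.
  apply: sqrt_lt; apply: le_lt_trans (inner_sub_le (ltW n0) hgn hh gnB hB) _.
  rewrite mulrC -ltr_pdivlMr ?mulr_gt0 //; apply: le_lt_trans hkk.
  apply: le_trans (ler_norm _).
  apply: (@le_Rintegral _ _ _ mu J _ _ (measurable_itv _)).
  - have i1 : mu.-integrable J (EFin \o (fun x => gn x - h x)).
      have := L2_integrable_mul (L2B hgn hh) (poly_L2 S 1); congr (_.-integrable _ _).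
      by apply/funext => x /=; rewrite hornerC mulr1.
    by have := integrable_abse i1.
  - have i1 : mu.-integrable J (EFin \o (fun x => gn x - hk k x)).
      by have := @integrableB _ _ _ mu J (measurable_itv _) _ _ ign (ih k).
    by have := integrable_abse i1.
  by move=> x _ /=; rewrite -{1}(clamp_id (gnB x)) clamp_lip.
have t3 : norm0 S (fun x => h x - p.[x]) < e / 3.
  apply: sqrt_lt; apply: le_lt_trans (inner_bound (L2B hh hL) _) _.
    by move=> x xS; apply: hp; move: xS; rewrite !in_itv /= => /andP[/ltW-> /ltW->].
  have sE := sqr_sqrtr (ltW S0).
  have s0 : Num.sqrt S != 0 by rewrite gt_eqF // sqrtr_gt0.
  have -> : (e / 3 / (2 * Num.sqrt S)) ^+ 2 * S = (e / 3) ^+ 2 / 4.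
    by rewrite -[X in _ * X = _]sE; field.
  by lra.
have -> : (fun x => g x - p.[x]) = (fun x => (g x - gn x) + ((gn x - h x) + (h x - p.[x]))).
  by apply/funext => x; ring.
have l1 := L2B hg hgn; have l2 := L2B hgn hh; have l3 := L2B hh hL.
have := norm0D l1 (L2D l2 l3); have := norm0D l2 l3; lra.
Qed.

End Density.

(** * Smooth cutoffs and weak derivatives *)

Section Flat.
Context {R : realType}.
Implicit Types (P : {poly R}) (t : R).

(** [P(1/t) exp(-1/t)] continued by 0. Letting [P] vary closes the family under differentiation, so
    smoothness needs a single computation. *)
Definition flat P t : R := if 0 < t then P.[t^-1] * expR (- t^-1) else 0.

(** With [y = 1/t] and [dy/dt = - y^2], the derivative of [P(y) exp(-y)] is
    [y^2 (P - P')(y) exp(-y)]. *)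
Definition dflat P : {poly R} := 'X^2 * (P - P^`()).

Lemma flat_pos P t : 0 < t -> flat P t = P.[t^-1] * expR (- t^-1).
Proof. by rewrite /flat => ->. Qed.

Lemma flat_npos P t : t <= 0 -> flat P t = 0.
Proof. by rewrite /flat ltNge => ->. Qed.

Lemma expr_le_expR n (y : R) : 0 < y -> y ^+ n.+1 <= (n.+1)`!%:R * expR y.
Proof.
move=> y0; have f0 : 0 < (n.+1)`!%:R :> R by rewrite ltr0n fact_gt0.
rewrite mulrC -ler_pdivrMr //; apply: le_trans (expR_ge1Dxn n (ltW y0)).
by rewrite lerDr.
Qed.

(** With [y = 1/t], each [y^i exp(-y)] is at most [(i + 2)! / y^2]. Quadratic decay makes the
    difference quotients at 0 tend to 0. *)
Lemma flat_bound P : exists2 C, 0 <= C & forall t, 0 < t -> `|flat P t| <= C * t ^+ 2.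
Proof.
exists (\sum_(i < size P) `|P`_i| * (i.+2)`!%:R).
  by apply: sumr_ge0 => i _; rewrite mulr_ge0.
move=> t t0; rewrite flat_pos // horner_coef mulr_suml.
apply: (le_trans (ler_norm_sum _ _ _)); rewrite mulr_suml; apply: ler_sum => i _.
have y0 : 0 < t^-1 by rewrite invr_gt0.
have := expr_le_expR i.+1 y0; set y := t^-1 in y0 * => h.
have -> : t ^+ 2 = (y ^+ 2)^-1 by rewrite /y exprVn invrK.
rewrite !normrM -!mulrA ler_wpM2l // (ger0_norm (exprn_ge0 _ (ltW y0))).
rewrite (ger0_norm (expR_ge0 _)) expRN.
have e0 := expR_gt0 y; have y2 : 0 < y ^+ 2 by rewrite exprn_gt0.
rewrite ler_pdivrMr // mulrAC ler_pdivlMr // -exprD addn2.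
exact: h.
Qed.

Lemma is_derive_flat P t : is_derive t 1 (flat P) (flat (dflat P) t).
Proof.
have [t0|t0|t0] := ltgtP t 0.
- rewrite (flat_npos (dflat P) (ltW t0)).
  have e : {near t, cst 0 =1 flat P}.
    near=> z; rewrite /= flat_npos // ltW //; near: z.
    by apply: lt_nbhsl.
  apply: DeriveDef.
    by apply: near_eq_derivable e _; apply: derivable_cst.
  by rewrite -(near_eq_derive _ e) derive_cst.
- rewrite (flat_pos (dflat P) t0).
  have e : {near t, (fun z => P.[z^-1] * expR (- z^-1)) =1 flat P}.
    near=> z; rewrite /= flat_pos //; near: z.
    by apply: lt_nbhsr.
  have dv : is_derive t 1 (fun z : R => z^-1) (- t ^- 2).
    have := @is_deriveV R id t 1 1 _ _; rewrite /= => h.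
    apply: (is_derive_eq (h (lt0r_neq0 t0) (is_derive_id _ _))).
    by rewrite /GRing.scale /= mulr1.
  have d : is_derive t 1 (fun z => P.[z^-1] * expR (- z^-1)) ((dflat P).[t^-1] * expR (- t^-1)).
    have d1 : is_derive t 1 (fun z : R => P.[z^-1]) (P^`().[t^-1] * (- t ^- 2)).
      by apply: (@is_derive1_comp _ (horner P) (fun z => z^-1)).
    have d2 : is_derive t 1 (fun z : R => expR (- z^-1)) (expR (- t^-1) * (- - t ^- 2)).
      by apply: (@is_derive1_comp _ expR (fun z => - z^-1)).
    apply: is_derive_eq; rewrite /dflat hornerM hornerXn hornerD hornerN exprVn.
    by rewrite /GRing.scale /=; ring.
  apply: DeriveDef.
    by apply: near_eq_derivable e _.
  by rewrite -(near_eq_derive _ e) derive_val.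
rewrite t0 flat_npos //.
have [C C0 hC] := flat_bound P.
have C1 : 0 < C + 1 by lra.
have lim0 : h^-1 *: ((flat P \o shift 0) (h *: 1) - flat P 0) @[h --> 0^'] --> (0 : R).
  apply/cvgrPdist_le => e e0; rewrite /= (flat_npos P (lexx 0)).
  near=> h; rewrite sub0r normrN subr0 addr0 /GRing.scale /= mulr1.
  have h0 : h != 0 by near: h; apply: nbhs_dnbhs_neq.
  have [hp|hn] := ltP 0 h; last by rewrite flat_npos // mulr0 normr0 ltW.
  rewrite normrM normfV (gtr0_norm hp) mulrC ler_pdivrMr //.
  apply: (le_trans (hC _ hp)); rewrite expr2 mulrA ler_wpM2r ?(ltW hp) //.
  have : h <= e / (C + 1).
    rewrite -(gtr0_norm hp); near: h.
    by apply: dnbhs0_le; apply: divr_gt0.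
  by rewrite ler_pdivlMr //; have := hp; nra.
by apply: DeriveDef; [apply: cvgP lim0 | apply: cvg_lim lim0].
Unshelve. all: end_near.
Qed.

Lemma flat1_bound t : 0 <= flat 1 t <= 1.
Proof.
have [t0|t0] := ltP 0 t; last by rewrite flat_npos // lexx ler01.
rewrite flat_pos // hornerC mul1r expR_ge0 expR_le1 oppr_le0 invr_ge0.
exact: ltW.
Qed.

(** [flat 'X^2] is the derivative of [flat 1]. For [t = x / d - 1] the factor [t + 1] is [x / d], so
    [x] times the derivative of the cutoff is bounded uniformly in [d]. *)
Lemma flatX2_bound t : 0 <= (t + 1) * flat ('X^2) t <= 8.
Proof.
have [t0|t0] := ltP 0 t; last by rewrite flat_npos // mulr0 lexx ler0n.
have y0 : 0 < t^-1 by rewrite invr_gt0.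
rewrite flat_pos // hornerXn; have e0 := expR_gt0 (t^-1).
have h1 := expr_le_expR 0 y0; have h2 := expr_le_expR 1 y0.
rewrite expRN; set y := t^-1 in y0 e0 h1 h2 *; set E := expR y in e0 h1 h2 *.
have -> : (t + 1) * (y ^+ 2 / E) = (y + y ^+ 2) / E.
  have ty : t * y = 1 by rewrite /y divff // gt_eqF.
  have -> : (t + 1) * (y ^+ 2 / E) = (t * y * y + y ^+ 2) / E by ring.
  by rewrite ty mul1r.
rewrite divr_ge0 ?ler_pdivrMr ?addr_ge0 ?sqr_ge0 ?(ltW y0) ?(ltW e0) //=.
by rewrite expr1 in h1; move: h1 h2; rewrite (_ : 1`! = 1)%N // (_ : 2`! = 2)%N //; lra.
Qed.

End Flat.

Section Cutoff.
Context {R : realType} (S : R).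
Hypothesis S0 : 0 < S.
Implicit Types (P Q : {poly R}) (x d : R).

Local Notation cut := ({poly R} * {poly R} * {poly R})%type.

(* Each triple encodes a product whose derivative is a sum of such products, encoded
   by [dcutoff]; hence all of them are smooth. *)
Definition cutoff d (a : cut) x : R :=
  a.1.1.[x] * flat a.1.2 (x / d - 1) * flat a.2 ((S - x) / d - 1).

Definition dcutoff d (a : cut) : seq cut :=
  [:: (a.1.1^`(), a.1.2, a.2); (d^-1 *: a.1.1, dflat a.1.2, a.2);
      (- d^-1 *: a.1.1, a.1.2, dflat a.2)].

Lemma is_derive_cutoff d a x :
  is_derive x 1 (cutoff d a) (\sum_(b <- dcutoff d a) cutoff d b x).
Proof.
have d1 : is_derive x 1 (fun z => flat a.1.2 (z / d - 1)) (flat (dflat a.1.2) (x / d - 1) * d^-1).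
  apply: (@is_derive1_comp _ (flat a.1.2) (fun z => z / d - 1)).
    exact: is_derive_flat.
  by apply: is_derive_eq; rewrite /GRing.scale /=; ring.
have d2 : is_derive x 1 (fun z => flat a.2 ((S - z) / d - 1)) (flat (dflat a.2) ((S - x) / d - 1) * (- d^-1)).
  apply: (@is_derive1_comp _ (flat a.2) (fun z => (S - z) / d - 1)).
    exact: is_derive_flat.
  by apply: is_derive_eq; rewrite /GRing.scale /=; ring.
apply: is_derive_eq.
rewrite /dcutoff !big_cons big_nil /cutoff /= !hornerZ /GRing.scale /=; ring.
Qed.

Definition cutoffs d (s : seq cut) x : R := \sum_(a <- s) cutoff d a x.

Lemma is_derive_cutoffs d s x :
  is_derive x 1 (cutoffs d s) (cutoffs d (flatten (map (dcutoff d) s)) x).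
Proof.
elim: s => [|a s IH].
  rewrite /cutoffs big_nil (_ : (fun y => _) = cst 0); first exact: is_derive_cst.
  by apply/funext => y; rewrite big_nil.
rewrite (_ : flatten _ = dcutoff d a ++ flatten (map (dcutoff d) s)) //.
rewrite /cutoffs big_cat (_ : (fun y => _) = cutoff d a \+ cutoffs d s); last first.
  by apply/funext => y; rewrite /cutoffs big_cons.
by apply: is_deriveD; apply: is_derive_cutoff.
Qed.

Lemma derive1_cutoffs d s :
  ((cutoffs d s)^`())%classic = cutoffs d (flatten (map (dcutoff d) s)).
Proof.
by apply/funext => x; rewrite derive1E; have h := is_derive_cutoffs d s x; rewrite derive_val.
Qed.

Lemma cutoffs_test d Q : 0 < d -> test_function S (cutoffs d [:: (Q, 1, 1)]).
Proof.
move=> d0; split.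
  move=> k x.
  suff [s ->] : exists s, derive1n k (cutoffs d [:: (Q, 1, 1)]) = cutoffs d s.
    by case: (is_derive_cutoffs d s x).
  elim: k => [|k [s IH]]; first by exists [:: (Q, 1, 1)].
  by exists (flatten (map (dcutoff d) s)); rewrite derive1nS IH derive1_cutoffs.
exists d, (S - d); split => //; first by rewrite ltrBlDr ltrDl.
move=> x; rewrite in_itv /= negb_and -!ltNge => xd.
rewrite /cutoffs big_seq1 /cutoff /=; case/orP: xd => xd.
  by rewrite [flat 1 (x / d - 1)]flat_npos ?mulr0 ?mul0r // subr_le0 ler_pdivrMr // mul1r ltW.
by rewrite [flat 1 ((S - x) / d - 1)]flat_npos ?mulr0 // subr_le0 ler_pdivrMr // mul1r; lra.
Qed.

Local Notation mu := (@lebesgue_measure R).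
Local Notation J := (`]0, S[%classic : set R).
Local Notation L2 := (in_L2 S).
Local Notation "<< u , v >>" := (inner S u v).
Implicit Types (h g u v psi : R -> R).

Lemma inner_cvg h (phi : nat -> R -> R) (psi : R -> R) (B : R) : L2 h ->
  (forall n, measurable_fun J (phi n)) ->
  (forall n x, x \in `]0, S[ -> `|phi n x| <= B) ->
  (forall x, x \in `]0, S[ -> phi n x @[n --> \oo] --> psi x) ->
  <<h, phi n>> @[n --> \oo] --> <<h, psi>>.
Proof.
move=> hh mphi phiB phic; have [mh _] := hh.
have ih : mu.-integrable J (EFin \o h).
  have := L2_integrable_mul hh (poly_L2 S 1); congr (_.-integrable _ _).
  by apply/funext => x /=; rewrite hornerC mulr1.
have [] := @dominated_convergence _ _ _ mu J (measurable_itv _)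
  (fun n x => (h x * phi n x)%:E) (fun x => (h x * psi x)%:E) (fun x => (B * `|h x|)%:E).
- by move=> n; apply/measurable_EFinP; apply: (measurable_funM mh); apply: mphi.
- apply/measurable_EFinP; apply: measurable_funM => //.
  by apply: (measurable_fun_cvg mphi) => x xJ; apply: phic.
- apply: aeW => x xJ; apply: cvg_EFin; first by near=> n.
  by apply: cvgM; [apply: cvg_cst|apply: phic].
- by have := @integrableZl _ _ _ mu J (measurable_itv _) B _ (integrable_abse ih).
- apply: aeW => x n xJ; rewrite lee_fin normrM mulrC ler_wpM2r //.
  exact: phiB.
move=> ipsi _; have fin := @integrable_fin_num _ _ _ mu J (measurable_itv _) _ ipsi.
by rewrite -(fineK fin) => /fine_cvgP[_]; apply.
Unshelve. all: end_near.
Qed.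

Lemma flat_limits x : 0 < x -> exists2 C, 0 <= C & forall d, 0 < d -> d <= x / 2 ->
  `|1 - flat 1 (x / d - 1)| <= C * d /\ `|0 - d^-1 * flat ('X^2) (x / d - 1)| <= C * d.
Proof.
move=> x0; exists (2 / x + 4 / x ^+ 2).
  by rewrite addr_ge0 // divr_ge0 // ?sqr_ge0 // ltW.
move=> d d0 dx; have xd : 0 < x - d by lra.
have t0 : 0 < x / d - 1 by rewrite subr_gt0 ltr_pdivlMr // mul1r; lra.
have tE : (x / d - 1)^-1 = d / (x - d).
  by field; rewrite !gt_eqF.
have y1 : d / (x - d) <= 2 / x * d.
  rewrite mulrAC ler_pdivlMr // mulrAC ler_pdivrMr //; nra.
have y0 : 0 <= d / (x - d) by rewrite divr_ge0 ?ltW.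
rewrite !flat_pos // hornerC mul1r hornerXn tE.
set y := d / (x - d) in tE y0 y1 *.
have e1 : expR (- y) <= 1 by rewrite expR_le1 oppr_le0.
have e2 := expR_ge1Dx (- y).
have e0 := expR_ge0 (- y).
have a0 : 0 <= 4 / x ^+ 2 * d by rewrite mulr_ge0 ?divr_ge0 ?sqr_ge0 // ltW.
split.
  by rewrite ger0_norm ?subr_ge0 //; lra.
have w0 : 0 <= d^-1 * (y ^+ 2 * expR (- y)).
  by apply: mulr_ge0; [rewrite invr_ge0 ltW | apply: mulr_ge0 => //; apply: sqr_ge0].
rewrite sub0r normrN (ger0_norm w0).
have y2 : d^-1 * y ^+ 2 <= 4 / x ^+ 2 * d.
  have : y ^+ 2 <= (2 / x * d) ^+ 2 by rewrite ler_pXn2r ?nnegrE // (le_trans y0).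
  have -> : (2 / x * d) ^+ 2 = d * (4 / x ^+ 2 * d) by field; rewrite gt_eqF.
  by rewrite -ler_pdivrMl.
have z0 : 0 <= d^-1 * y ^+ 2 by rewrite mulr_ge0 ?sqr_ge0 // invr_ge0 ltW.
have b0 : 0 <= 2 / x * d by rewrite mulr_ge0 ?divr_ge0 // ltW.
rewrite mulrA mulrDl; apply: (@le_trans _ _ (d^-1 * y ^+ 2)); last by lra.
by rewrite ler_piMr.
Qed.

Lemma cvg_bound_harmonic (a : nat -> R) (l C r : R) : 0 <= C -> 0 < r ->
  (forall d n, d = n.+1%:R^-1 -> d <= r -> `|l - a n| <= C * d) -> a n @[n --> \oo] --> l.
Proof.
move=> C0 r0 H; apply/cvgrPdist_le => e e0.
have C1 : 0 < C + 1 by lra.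
have r1 : 0 < Num.min r (e / (C + 1)) by rewrite lt_min r0 divr_gt0.
near=> n.
have hn : n.+1%:R^-1 < Num.min r (e / (C + 1)).
  have h0 : 0 <= (n.+1%:R)^-1 :> R by rewrite invr_ge0.
  rewrite -(ger0_norm h0) -normrN -sub0r; near: n.
  by have /cvgrPdist_lt/(_ _ r1) := @cvg_harmonic R.
move: hn; rewrite lt_min => /andP[/ltW hr he].
apply: (le_trans (H _ n erefl hr)).
have h0 : 0 <= (n.+1%:R)^-1 :> R by rewrite invr_ge0.
by move: he h0; rewrite ltr_pdivlMr //; set w := _^-1; lra.
Unshelve. all: end_near.
Qed.

(** Test with [Q] times a cutoff at distance [d n] from the endpoints. The cutoff has slope of order
    [1 / d n] there, but [|Q|] is at most [K] times the distance to either endpoint, so all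
    integrands are dominated and dominated convergence applies on both sides. *)
Lemma weak_derivative_poly h g Q : L2 h -> L2 g ->
  (forall psi, test_function S psi -> <<h, (psi^`())%classic>> = - <<g, psi>>) ->
  Q.[0] = 0 -> Q.[S] = 0 -> <<h, horner Q^`()>> = - <<g, horner Q>>.
Proof.
move=> hh hg weak Q0 QS.
have [K K1 hK] := poly_lipshitz Q 0 S; have [K' K1' hK'] := poly_lipshitz Q^`() 0 S.
have I0 : 0 \in `[0, S] by rewrite in_itv /= lexx ltW.
have IS : S \in `[0, S] by rewrite in_itv /= lexx ltW.
have K0 : 0 <= K by apply: le_trans K1.
have K0' : 0 <= K' by apply: le_trans K1'.
have JI x : x \in `]0, S[ -> [/\ x \in `[0, S], 0 < x & x < S].
  by rewrite !in_itv /= => /andP[h1 h2]; rewrite !ltW.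
have Qb x : x \in `]0, S[ -> `|Q.[x]| <= K * x /\ `|Q.[x]| <= K * (S - x).
  move=> /JI[xI x0 xS]; split.
    by have := hK _ _ I0 xI; rewrite Q0 !subr0 (gtr0_norm x0).
  have := hK _ _ xI IS; rewrite QS sub0r normrN (@gtr0_norm _ (S - x)) //.
  by rewrite subr_gt0.
have Qb' x : x \in `]0, S[ -> `|Q^`().[x]| <= `|Q^`().[0]| + K' * S.
  move=> /JI[xI x0 xS]; have := hK' _ _ I0 xI; rewrite subr0 (gtr0_norm x0) => h1.
  have h2 : K' * x <= K' * S by rewrite ler_wpM2l // ltW.
  rewrite -[Q^`().[x]](subrK Q^`().[0]); apply: le_trans (ler_normD _ _) _; lra.
pose d n : R := n.+1%:R^-1; have d0 n : 0 < d n by rewrite invr_gt0.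
have df1 : dflat 1 = 'X^2 :> {poly R}.
  by rewrite /dflat -[1]/(1%:P) derivC subr0 mulr1.
pose f' n x := Q^`().[x] * flat 1 (x / d n - 1) * flat 1 ((S - x) / d n - 1) +
  (Q.[x] * (d n)^-1 * flat 'X^2 (x / d n - 1) * flat 1 ((S - x) / d n - 1) -
   Q.[x] * (d n)^-1 * flat 'X^2 ((S - x) / d n - 1) * flat 1 (x / d n - 1)).
have fE n x : cutoffs (d n) [:: (Q, 1, 1)] x =
    Q.[x] * flat 1 (x / d n - 1) * flat 1 ((S - x) / d n - 1).
  by rewrite /cutoffs big_seq1.
have f'E n : ((cutoffs (d n) [:: (Q, 1, 1)])^`())%classic = f' n.
  rewrite derive1_cutoffs; apply/funext => x.
  rewrite /cutoffs /= !big_cons big_nil /cutoff /= df1 !hornerZ /f'; ring.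
have lim x : x \in `]0, S[ ->
    [/\ flat 1 (x / d n - 1) @[n --> \oo] --> (1 : R),
        flat 1 ((S - x) / d n - 1) @[n --> \oo] --> (1 : R),
        (d n)^-1 * flat 'X^2 (x / d n - 1) @[n --> \oo] --> (0 : R) &
        (d n)^-1 * flat 'X^2 ((S - x) / d n - 1) @[n --> \oo] --> (0 : R)].
  move=> /JI[_ x0 xS]; have xS0 : 0 < S - x by rewrite subr_gt0.
  have [C C0 hC] := flat_limits x0; have [D D0 hD] := flat_limits xS0.
  split; [apply: (@cvg_bound_harmonic _ _ C (x / 2)) | apply: (@cvg_bound_harmonic _ _ D ((S - x) / 2)) |
    apply: (@cvg_bound_harmonic _ _ C (x / 2)) | apply: (@cvg_bound_harmonic _ _ D ((S - x) / 2))] => //;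
    rewrite ?divr_gt0 // => e n -> le;
    by [have [] := hC _ (d0 n) le | have [] := hD _ (d0 n) le].
have c1 : <<g, cutoffs (d n) [:: (Q, 1, 1)]>> @[n --> \oo] --> <<g, horner Q>>.
  apply: (@inner_cvg _ _ _ (K * S)) => //.
  - move=> n; apply: measurable_funTS; apply: continuous_measurable_fun => x.
    apply/differentiable_continuous/derivable1_diffP.
    by case: (is_derive_cutoffs (d n) [:: (Q, 1, 1)] x).
  - move=> n x xJ; rewrite fE; have [x1 _] := Qb x xJ; have [xI x0 xS] := JI x xJ.
    have /andP[r0 r1] := flat1_bound (x / d n - 1).
    have /andP[s0 s1] := flat1_bound ((S - x) / d n - 1).
    rewrite !normrM (ger0_norm r0) (ger0_norm s0) -mulrA.
    apply: (@le_trans _ _ `|Q.[x]|); first by rewrite ler_piMr // mulr_ile1.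
    by apply: (le_trans x1); rewrite ler_wpM2l // ltW.
  - move=> x /lim[l1 l2 _ _]; under eq_fun do rewrite fE.
    have c := cvgM (cvgM (cvg_cst Q.[x]) l1) l2.
    by rewrite !mulr1 in c; apply: c.
have c2 : <<h, f' n>> @[n --> \oo] --> <<h, horner Q^`()>>.
  apply: (@inner_cvg _ _ _ (`|Q^`().[0]| + K' * S + 16 * K)) => //.
  - move=> n; rewrite -f'E derive1_cutoffs.
    apply: measurable_funTS; apply: continuous_measurable_fun => x.
    apply/differentiable_continuous/derivable1_diffP.
    by case: (is_derive_cutoffs (d n) (flatten [seq dcutoff (d n) i | i <- [:: (Q, 1, 1)]]) x).
  - move=> n x xJ; have [x1 x2] := Qb x xJ; have [xI x0 xS] := JI x xJ; have x3 := Qb' x xJ.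
    have /andP[r0 r1] := flat1_bound (x / d n - 1).
    have /andP[s0 s1] := flat1_bound ((S - x) / d n - 1).
    have /andP[p0 p1] := flatX2_bound (x / d n - 1).
    have /andP[q0 q1] := flatX2_bound ((S - x) / d n - 1).
    have di : 0 < (d n)^-1 by rewrite invr_gt0.
    have main (z : R) t : 0 <= z -> `|Q.[x]| <= K * z -> 0 <= t <= 1 ->
        0 <= (z / d n - 1 + 1) * flat 'X^2 (z / d n - 1) <= 8 ->
        0 <= flat 'X^2 (z / d n - 1) ->
        `|Q.[x] * (d n)^-1 * flat 'X^2 (z / d n - 1) * t| <= 8 * K.
      move=> z0 Qz /andP[t0 t1] /andP[_ w1] w0; rewrite subrK in w1.
      rewrite !normrM (ger0_norm t0) (gtr0_norm di) (ger0_norm w0).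
      apply: (@le_trans _ _ (K * z * (d n)^-1 * flat 'X^2 (z / d n - 1))).
        rewrite -[leRHS]mulr1 ler_pM // ?mulr_ge0 ?(ltW di) //.
        by rewrite ler_wpM2r // ler_wpM2r // ltW.
      by rewrite -(mulrA K z) -(mulrA K) mulrC ler_wpM2r.
    have w0 z : 0 <= flat ('X^2 : {poly R}) z.
      rewrite /flat; case: ifP => // _; rewrite hornerXn mulr_ge0 ?expR_ge0 ?sqr_ge0 //.
    have m1 := main x _ (ltW x0) x1 (flat1_bound ((S - x) / d n - 1)) (flatX2_bound _) (w0 _).
    have m2 := main (S - x) _ _ x2 (flat1_bound (x / d n - 1)) (flatX2_bound _) (w0 _).
    have {}m2 := m2 (ltW (_ : 0 < S - x)); rewrite subr_gt0 in m2; have {}m2 := m2 xS.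
    have m0 : `|Q^`().[x] * flat 1 (x / d n - 1) * flat 1 ((S - x) / d n - 1)| <= `|Q^`().[0]| + K' * S.
      rewrite !normrM (ger0_norm r0) (ger0_norm s0) -mulrA; apply: le_trans x3.
      by rewrite ler_piMr // mulr_ile1.
    apply: (le_trans (ler_normD _ _)); have := ler_normB
      (Q.[x] * (d n)^-1 * flat 'X^2 (x / d n - 1) * flat 1 ((S - x) / d n - 1))
      (Q.[x] * (d n)^-1 * flat 'X^2 ((S - x) / d n - 1) * flat 1 (x / d n - 1)).
    lra.
  - move=> x /lim[l1 l2 l3 l4].
    rewrite (_ : Q^`().[x] = Q^`().[x] * 1 * 1 + (Q.[x] * 0 * 1 - Q.[x] * 0 * 1)); last by ring.
    rewrite /f'; under eq_fun do rewrite -!(mulrA Q.[x]).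
    apply: cvgD; first by apply: cvgM => //; apply: cvgM => //; apply: cvg_cst.
    rewrite -!(mulrA Q.[x]).
    by apply: cvgB; apply: cvgM; [exact: cvg_cst| apply: cvgM |exact: cvg_cst| apply: cvgM].
have c3 : <<h, f' n>> @[n --> \oo] --> - <<g, horner Q>>.
  rewrite (_ : (fun n => <<h, f' n>>) = (fun n => - <<g, cutoffs (d n) [:: (Q, 1, 1)]>>)).
    exact: cvgN.
  by apply/funext => n; rewrite -f'E weak //; apply: cutoffs_test.
by apply: cvg_unique c2 c3.
Qed.

End Cutoff.

(** * Approximation of chains of weak derivatives *)

Section Sobolev.
Context {R : realType} (S : R).
Hypothesis S0 : 0 < S.
Implicit Types (p q P Q : {poly R}) (x y e : R) (h g u v : R -> R) (psi : R -> R).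

Local Notation mu := (@lebesgue_measure R).
Local Notation J := (`]0, S[%classic : set R).
Local Notation L2 := (in_L2 S).
Local Notation "<< u , v >>" := (inner S u v).
Local Notation nrm := (norm0 S).
Local Notation I := (pint 0 S).

Lemma norm0_ge0 u : 0 <= nrm u. Proof. exact: sqrtr_ge0. Qed.

Lemma norm0_poly p : nrm (horner p) ^+ 2 = I (p * p).
Proof. by rewrite norm0E inner_poly. Qed.

Lemma norm0B u v : L2 u -> L2 v -> nrm (fun x => u x - v x) <= nrm u + nrm v.
Proof.
move=> hu hv; have := norm0D hu (L2Z (-1) hv).
rewrite (_ : (fun x => u x + -1 * v x) = (fun x => u x - v x)); last first.
  by apply/funext => x; rewrite mulN1r.
suff -> : nrm (fun x => -1 * v x) = nrm v by [].
by congr (Num.sqrt _); rewrite innerZl ?innerZr //; [rewrite mulrA mulrNN !mul1r|exact: L2Z].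
Qed.

Lemma norm0_sym u v : nrm (fun x => u x - v x) = nrm (fun x => v x - u x).
Proof.
congr (Num.sqrt _); rewrite /inner; apply: eq_Rintegral => x _.
by rewrite -mulrNN !opprB.
Qed.

Lemma norm0_tri u v w : L2 u -> L2 v -> L2 w ->
  nrm (fun x => u x - w x) <= nrm (fun x => u x - v x) + nrm (fun x => v x - w x).
Proof.
move=> hu hv hw; apply: le_trans (norm0D (L2B hu hv) (L2B hv hw)).
by rewrite le_eqVlt; apply/orP; left; apply/eqP; congr (nrm _); apply/funext => x; ring.
Qed.

Lemma norm0_polyB p q : nrm (fun x => p.[x] - q.[x]) = nrm (horner (p - q)).
Proof. by congr (nrm _); apply/funext => x; rewrite hornerD hornerN. Qed.

(** Letting [e] tend to 0 gives [a^2 <= b a]. In use, [a] is the norm of a function and [e] its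
    distance to a polynomial. *)
Lemma norm0_small (a b : R) : 0 <= a -> 0 <= b ->
  (forall e, 0 < e -> a ^+ 2 <= a * e + b * (a + e)) -> a <= b.
Proof.
move=> a0 b0 H; rewrite leNgt; apply/negP => ba.
have s0 : 0 < a + b by lra.
have e0 : 0 < a * (a - b) / (2 * (a + b)) by rewrite divr_gt0 ?mulr_gt0 //; lra.
have := H _ e0; set e := _ / _ in e0 *.
have : e * (2 * (a + b)) = a * (a - b) by rewrite divfK // gt_eqF // mulr_gt0.
nra.
Qed.

Lemma pint_affine_exp (l : {poly R}) (c : R) n : l^`() = c%:P ->
  c * (n.*2.+1)%:R * I (l ^+ n * l ^+ n) = l.[S] ^+ n.*2.+1 - l.[0] ^+ n.*2.+1.
Proof.
move=> dl; rewrite -!horner_exp -pint_deriv deriv_exp dl /= -exprD addnn.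
by rewrite raddfMn /= pintMl -mulr_natr; ring.
Qed.

(* Multiples of [(1 - X/S)^n] and [(X/S)^n] carry the boundary values of [q] and tend
   to 0 in L2. *)
Lemma orth_boundary_poly h q : L2 h ->
  (forall Q, Q.[0] = 0 -> Q.[S] = 0 -> <<h, horner Q>> = 0) -> <<h, horner q>> = 0.
Proof.
move=> hh H; have SR : S != 0 by rewrite gt_eqF.
pose l : {poly R} := S^-1 *: 'X; pose l' : {poly R} := 1 - S^-1 *: 'X.
have l0 : l.[0] = 0 by rewrite hornerZ hornerX mulr0.
have lS : l.[S] = 1 by rewrite hornerZ hornerX mulVf.
have l'0 : l'.[0] = 1 by rewrite hornerD hornerN l0 hornerC subr0.
have l'S : l'.[S] = 0 by rewrite hornerD hornerN lS hornerC subrr.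
have fE (A B : R) : A != 0 -> B != 0 -> 1 = A^-1 * B * (A / B) by move=> *; field; apply/andP.
have fE' (A B : R) : A != 0 -> B != 0 -> -1 = - A^-1 * B * (A / B) by move=> *; field; apply/andP.
have Il n : I (l ^+ n * l ^+ n) = S / (n.*2.+1)%:R.
  have := @pint_affine_exp l S^-1 n; rewrite l0 lS expr1n expr0n subr0 => E.
  apply: (mulfI (_ : S^-1 * (n.*2.+1)%:R != 0)); first by rewrite mulf_neq0 ?invr_eq0 ?pnatr_eq0.
  rewrite E; last by rewrite derivZ derivX alg_polyC.
  by apply: fE; rewrite ?pnatr_eq0.
have Il' n : I (l' ^+ n * l' ^+ n) = S / (n.*2.+1)%:R.
  have := @pint_affine_exp l' (- S^-1) n; rewrite l'0 l'S expr1n expr0n sub0r => E.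
  apply: (mulfI (_ : - S^-1 * (n.*2.+1)%:R != 0)).
    by rewrite mulf_neq0 ?oppr_eq0 ?invr_eq0 ?pnatr_eq0.
  rewrite E; last by rewrite derivB derivC derivZ derivX sub0r polyCN alg_polyC.
  by apply: fE'; rewrite ?pnatr_eq0.
apply/eqP/negPn/negP => A0; set A := <<h, horner q>> in A0.
set c := 2 * (q.[0] ^+ 2 + q.[S] ^+ 2) * (<<h, h>> * S).
have ub Q n : I (Q * Q) = S / n%:R -> <<h, horner Q>> ^+ 2 <= <<h, h>> * (S / n%:R).
  by move=> <-; rewrite -inner_poly //; apply: inner_CS => //; apply: poly_L2.
have key n : A ^+ 2 <= c / (n.+1.*2.+1)%:R.
  have := H (q - (q.[0] *: l' ^+ n.+1 + q.[S] *: l ^+ n.+1)).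
  rewrite !hornerD !hornerN !hornerD !hornerZ !horner_exp.
  rewrite l0 lS l'0 l'S !expr1n !expr0n !mulr0 !mulr1 addr0 add0r !subrr => /(_ erefl erefl).
  rewrite (_ : horner _ = fun x => q.[x] - (q.[0] * (l' ^+ n.+1).[x] + q.[S] * (l ^+ n.+1).[x])); last first.
    by apply/funext => x; rewrite hornerD hornerN hornerD !hornerZ.
  have L p : L2 (horner p) by apply: poly_L2.
  rewrite (innerBr (L _) (L2D (L2Z _ (L _)) (L2Z _ (L _))) hh).
  rewrite (innerDr (L2Z _ (L _)) (L2Z _ (L _)) hh) !innerZr // => /subr0_eq; rewrite -/A => ->.
  move: (ub _ _ (Il n.+1)) (ub _ _ (Il' n.+1)).
  set X := <<h, horner (l ^+ _)>>; set Y := <<h, horner (l' ^+ _)>>.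
  rewrite /c -!mulrA; set Z := _ * (S / _) => hX hY.
  have := sqr_ge0 (q.[0] * Y - q.[S] * X).
  have := ler_wpM2l (sqr_ge0 q.[S]) hX; have := ler_wpM2l (sqr_ge0 q.[0]) hY.
  by clear; nra.
have A20 : 0 < A ^+ 2 by rewrite exprn_even_gt0.
have c0 : 0 <= c / A ^+ 2.
  apply: divr_ge0; last exact: ltW.
  by rewrite !mulr_ge0 ?addr_ge0 ?sqr_ge0 ?inner_ge0 ?(ltW S0).
have := archi_boundP c0; set n := Num.bound _; rewrite ltr_pdivrMr // => hn.
have := key n; rewrite ler_pdivlMr ?ltr0n // => k1.
have : (n%:R : R) <= n.+1.*2.+1%:R by rewrite ler_nat; clear; lia.
rewrite -(ler_pM2l A20) => k2; lra.
Qed.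

Lemma L2_0 : L2 (fun=> 0).
Proof. by have := poly_L2 S 0; congr (in_L2 _ _); apply/funext => x; rewrite horner0. Qed.

Lemma inner0l g : <<(fun=> 0), g>> = 0.
Proof.
rewrite /inner (_ : (fun x => 0 * g x) = cst 0) ?Rintegral_cst ?mul0r //.
by apply/funext => x /=; rewrite mul0r.
Qed.

Lemma L2_orth_poly h : L2 h -> (forall q, <<h, horner q>> = 0) -> nrm h = 0.
Proof.
move=> hh H; apply/eqP; rewrite eq_le norm0_ge0 andbT.
apply: norm0_small => //; first exact: norm0_ge0.
move=> e e0; rewrite mul0r addr0 norm0E.
have [p hp] := L2_dense S0 hh e0.
have Lp := poly_L2 S p.
have -> : <<h, h>> = <<h, fun x => h x - p.[x]>> by rewrite (innerBr hh Lp hh) H subr0.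
apply: le_trans (ler_norm _) _; apply: le_trans (inner_le hh (L2B hh Lp)) _.
by rewrite ler_wpM2l ?norm0_ge0 // ltW.
Qed.

(** The hypothesis says that 0 has the weak derivative [h]. Thus [h] is orthogonal to polynomials
    vanishing at both endpoints, then to all polynomials, which are dense. *)
Lemma L2_orth_test h : L2 h -> (forall psi, test_function S psi -> <<h, psi>> = 0) ->
  nrm h = 0.
Proof.
move=> hh H; apply: L2_orth_poly => // q; apply: orth_boundary_poly => // Q Q0 QS.
apply/eqP; rewrite -oppr_eq0 -(weak_derivative_poly S0 L2_0 hh) ?inner0l // => psi /H ->.
by rewrite inner0l oppr0.
Qed.

(** The constant of integration gives [P] the same mean as [h]. The difference [w] is estimated by
    duality: subtracting the mean from a polynomial [q] leaves the derivative of some [Q] vanishing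
    at both endpoints, the weak derivative moves onto [w], and Poincare for [Q] yields the factor
    [S]. *)
Lemma antiderivative_approx h g p : L2 h -> L2 g ->
  (forall psi, test_function S psi -> <<h, (psi^`())%classic>> = - <<g, psi>>) ->
  exists P, P^`() = p /\ nrm (fun x => h x - P.[x]) <= S * nrm (fun x => g x - p.[x]).
Proof.
move=> hh hg weak; have L q : L2 (horner q) by apply: poly_L2.
have SR : S != 0 by rewrite gt_eqF.
pose c := S^-1 * (<<h, horner 1>> - I (antideriv p)).
pose P := antideriv p + c%:P; have dP : P^`() = p by rewrite derivD derivC addr0 deriv_antideriv.
have w1 : <<h, horner 1>> = <<horner P, horner 1>>.
  by rewrite inner_poly // mulr1 /P pintD pintC subr0 /c mulrC mulVKf // addrC subrK.
exists P; split => //; have hw := L2B hh (L P); set w := fun x => h x - P.[x] in hw *.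
have hgp := L2B hg (L p); set G := fun x => g x - p.[x] in hgp *.
have wQ Q : Q.[0] = 0 -> Q.[S] = 0 -> <<w, horner Q^`()>> = - <<G, horner Q>>.
  move=> Q0 QS; rewrite !innerBl // (weak_derivative_poly S0 hh hg) //.
  by rewrite !inner_poly // (mulrC P) pint_parts Q0 QS dP (mulrC Q) !mul0r; ring.
have wq q : `|<<w, horner q>>| <= S * nrm G * nrm (horner q).
  pose mq := I q / S; pose Q := antideriv (q - mq%:P) - (antideriv (q - mq%:P)).[0]%:P.
  have dQ : Q^`() = q - mq%:P by rewrite derivB derivC subr0 deriv_antideriv.
  have Q0 : Q.[0] = 0 by rewrite hornerD hornerN hornerC subrr.
  have QS : Q.[S] = 0.
    have := pint_deriv 0 S Q; rewrite Q0 subr0 => <-.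
    by rewrite dQ pintB pintC subr0 divfK ?subrr.
  have -> : <<w, horner q>> = - <<G, horner Q>>.
    rewrite -wQ // dQ (_ : horner (q - _) = fun x => q.[x] - mq * (1 : {poly R}).[x]).
      rewrite (innerBr (L _) (L2Z _ (L _)) hw) innerZr // !innerBl // w1 subrr mulr0.
      by rewrite subr0.
    by apply/funext => x; rewrite hornerD hornerN !hornerC mulr1.
  rewrite normrN (le_trans (inner_le hgp (L _))) // (mulrC S) -mulrA.
  rewrite ler_wpM2l ?norm0_ge0 //.
  rewrite -ler_sqr ?nnegrE ?mulr_ge0 ?norm0_ge0 ?(ltW S0) // exprMn !norm0_poly.
  have := poincare_int (ltW S0) Q0; rewrite subr0 dQ => /le_trans -> //.
  rewrite ler_wpM2l ?sqr_ge0 //.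
  have sqE (t : R) : (q - t%:P) * (q - t%:P) = q * q - t%:P * q - t%:P * q + (t * t)%:P.
    by rewrite polyCM; ring.
  rewrite sqE pintD !pintB pintMl pintC subr0 -[mq * mq * S]mulrA.
  have -> : mq * S = I q by rewrite divfK.
  have : 0 <= mq * I q by rewrite /mq mulrAC -expr2 divr_ge0 ?sqr_ge0 ?(ltW S0).
  by set t := mq * _; clear; lra.
apply: norm0_small; rewrite ?norm0_ge0 // ?mulr_ge0 ?norm0_ge0 ?(ltW S0) // => e e0.
have [q hq] := L2_dense S0 hw e0.
have hwq := L2B hw (L q).
have nq : nrm (horner q) <= nrm w + e.
  have := norm0B hw hwq; rewrite (_ : (fun x => _ - _) = horner q).
    by move=> /le_trans; apply; rewrite lerD2l ltW.
  by apply/funext => x; ring.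
have -> : nrm w ^+ 2 = <<w, fun x => w x - q.[x]>> + <<w, horner q>>.
  by rewrite norm0E innerBr // subrK.
apply: lerD.
  apply: le_trans (ler_norm _) _; apply: le_trans (inner_le hw hwq) _.
  by rewrite ler_wpM2l ?norm0_ge0 // ltW.
apply: le_trans (ler_norm _) _; apply: le_trans (wq q) _.
by rewrite ler_wpM2l // mulr_ge0 ?norm0_ge0 ?(ltW S0).
Qed.

Lemma chain_approx m (a : nat -> R -> R) e : 0 < e ->
  (forall k, (k <= m)%N -> L2 (a k)) ->
  (forall k psi, (k < m)%N -> test_function S psi ->
     <<a k, (psi^`())%classic>> = - <<a k.+1, psi>>) ->
  exists P, forall k, (k <= m)%N -> nrm (fun x => a k x - (P^`(k)).[x]) <= e.
Proof.
elim: m a e => [|m IH] a e e0 La wa.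
  have [P hP] := L2_dense S0 (La 0%N isT) e0.
  by exists P => k; rewrite leqn0 => /eqP ->; rewrite derivn0 ltW.
have S1 : 0 < 1 + S by rewrite addr_gt0.
have e1 : 0 < e / (1 + S) by rewrite divr_gt0.
have [p hp] := IH (fun k => a k.+1) _ e1 (fun k km => La k.+1 km) (fun k psi km => wa k.+1 psi km).
have h0 := La 0%N isT; have h1 := La 1%N isT.
have [P [dP hP]] := antiderivative_approx p h0 h1 (fun psi => wa 0%N psi isT).
have se : S * (e / (1 + S)) <= e /\ e / (1 + S) <= e.
  have : e / (1 + S) * (1 + S) = e by rewrite divfK // gt_eqF.
  move: e1 (S0); set t := e / _; clear; move: t => t t0 s0 <-.
  by have := mulr_gt0 t0 s0; split; lra.
exists P => -[_|k km].
  rewrite derivn0; apply: (le_trans hP); have := hp 0%N isT; rewrite derivn0 => /(ler_wpM2l (ltW S0)).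
  by move/le_trans; apply; case: se.
by rewrite derivSn dP; apply: le_trans (hp k km) _; case: se.
Qed.

(** Compare [p(x)] with [p(y)] by Cauchy-Schwarz and average over [y]. *)
Lemma poly_sup_bound p x : x \in `[0, S] ->
  p.[x] ^+ 2 <= 2 / S * I (p * p) + 2 * S * I (p^`() * p^`()).
Proof.
move=> xI; set A := I (p^`() * p^`()).
have A0 : 0 <= A by apply: pint_sqr_ge0; apply: ltW.
have xI' := xI; rewrite in_itv /= in xI'; have /andP[x0 xS] := xI'.
have key y : y \in `[0, S] -> p.[x] ^+ 2 <= 2 * p.[y] ^+ 2 + 2 * (S * A).
  rewrite in_itv /= => /andP[y0 yS].
  suff : (p.[x] - p.[y]) ^+ 2 <= S * A.
    by have := sqr_ge0 (p.[x] - 2 * p.[y]); set u := p.[x]; set v := p.[y]; nra.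
  have CS a b : 0 <= a -> a <= b -> b <= S -> (p.[b] - p.[a]) ^+ 2 <= S * A.
    move=> a0 ab bS; have := @pint_CS _ a b p^`() 1 ab; rewrite !mulr1 pint_deriv.
    move/le_trans; apply; rewrite -[1]/(1%:P) pintC mul1r mulrC.
    apply: ler_pM; rewrite ?subr_ge0 ?pint_sqr_ge0 //; first lra.
    rewrite /A (pint_split 0 a S) (pint_split a b S).
    have := pint_sqr_ge0 p^`() a0; have := pint_sqr_ge0 p^`() bS; lra.
  have [xy|/ltW yx] := lerP x y; last exact: CS.
  by rewrite -sqrrN opprB; apply: CS.
have : I (p.[x] ^+ 2 - 2 * (S * A))%:P <= I (2%:P * (p * p)).
  apply: le_pint; first exact: ltW.
  by move=> y /key; rewrite hornerC !hornerM hornerC; lra.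
rewrite pintC pintMl subr0 => h.
have SR : S != 0 by rewrite gt_eqF.
rewrite -(ler_pM2r S0) mulrDl -/A [X in X + _](_ : _ = 2 * I (p * p)); last by field.
by move: h; set u := I _; lra.
Qed.

Lemma poly_lip p e x y : (forall z, z \in `[0, S] -> `|(p^`()).[z]| <= e) ->
  x \in `[0, S] -> y \in `[0, S] -> `|p.[y] - p.[x]| <= e * `|y - x|.
Proof.
move=> pe; wlog xy : x y / x <= y.
  move=> W; case: (leP x y) => [xy|/ltW yx] xI yI; first exact: W.
  by rewrite distrC (distrC y); apply: W.
rewrite !in_itv /= => /andP[x0 xS] /andP[y0 yS].
rewrite -pint_deriv (ger0_norm (_ : 0 <= y - x)) ?subr_ge0 //.
have pe' z : z \in `[x, y] -> - e <= (p^`()).[z] <= e.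
  by rewrite in_itv /= => /andP[xz zy]; rewrite -ler_norml pe // in_itv /=; lra.
rewrite ler_norml -mulNr -!pintC; apply/andP; split; apply: le_pint => // z /pe' /andP[];
  by rewrite hornerC.
Qed.

Lemma inner_lower w (c a b : R) : L2 w -> 0 <= c -> 0 <= a -> a < b -> b <= S ->
  (forall x, x \in `]a, b[ -> c <= `|w x|) -> c ^+ 2 * (b - a) <= <<w, w>>.
Proof.
move=> hw c0 a0 ab bS wc.
have hI := L2_integrable_mul hw hw.
have fin := @integrable_fin_num _ _ _ mu J (measurable_itv _) _ hI.
have mww : measurable_fun J (fun x => (w x * w x)%:E) by have := @measurable_int _ _ _ mu J _ hI.
rewrite -lee_fin /inner /Rintegral fineK //.
have sub : `]a, b[%classic `<=` J.
  by move=> x /=; rewrite !in_itv /= => /andP[ax xb]; lra.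
apply: (@le_trans _ _ (\int[mu]_(x in `]a, b[) (w x * w x)%:E)%E); last first.
  apply: ge0_subset_integral => //.
  by move=> x _; rewrite lee_fin -expr2 sqr_ge0.
apply: (@le_trans _ _ (\int[mu]_(x in `]a, b[) (c ^+ 2)%:E)%E).
  rewrite integral_cst; last exact: measurable_itv.
  have := @lebesgue_measure_itv R `]a, b[; rewrite /= lte_fin ab => E.
  rewrite [X in (_ <= _ * X)%E](_ : _ = (b - a)%:E) -?EFinM //; exact: E.
apply: ge0_le_integral.
- exact: measurable_itv.
- by move=> x _; rewrite lee_fin sqr_ge0.
- exact: measurable_cst.
- by apply: measurable_funS mww => //; exact: measurable_itv.
move=> x xI; rewrite lee_fin -expr2 -(real_normK (num_real (w x))).
by rewrite ler_pXn2r ?nnegrE // ?(le_trans c0) // wc.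
Qed.

End Sobolev.

(** * Approximation of Sobolev functions by polynomials *)

Section Approximation.
Context {R : realType} (S : R).
Hypothesis S0 : 0 < S.
Implicit Types (q P Q : {poly R}) (x y e : R) (h g u v : R -> R) (psi : R -> R).

Local Notation L2 := (in_L2 S).
Local Notation "<< u , v >>" := (inner S u v).
Local Notation nrm := (norm0 S).
Local Notation I := (pint 0 S).
Local Notation wd := (weak_derivative S).

Lemma weak_derivativeP k v : (exists g, L2 g /\ is_weak_derivative S k v g) ->
  L2 (wd k v) /\ is_weak_derivative S k v (wd k v).
Proof. exact: xgetPex. Qed.

Lemma test_derive1 psi : test_function S psi -> test_function S (psi^`())%classic.
Proof.
move=> [dpsi [a [b [a0 bS psi0]]]]; split.
  by move=> k x; have := dpsi k.+1 x; rewrite derive1Sn.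
exists a, b; split => // x; rewrite in_itv /= negb_and -!ltNge => xab.
rewrite derive1E.
have -> : 'D_1 psi x = 'D_1 (cst 0 : R -> R) x; last by rewrite derive_cst.
apply: near_eq_derive; case/orP: xab => xab.
  have := lt_nbhsl xab; apply: filterS => y ya.
  by apply: psi0; rewrite in_itv /= negb_and -!ltNge ya.
have := lt_nbhsr xab; apply: filterS => y ya.
by apply: psi0; rewrite in_itv /= negb_and -!ltNge ya orbT.
Qed.

(** At order 0 this is [v] itself and not [weak_derivative S 0 v], an arbitrary representative
    without the point values of [v]. *)
Definition derivatives v k : R -> R := if k is 0%N then v else wd k v.

Lemma Hm_L2 m v : Hm S m v -> L2 v.
Proof. by case=> cv _; apply: continuous_L2. Qed.

Lemma derivatives_L2 m v k : Hm S m v -> (k <= m)%N -> L2 (derivatives v k).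
Proof.
case: k => [|k] Hv km; first exact: Hm_L2 Hv.
by case: Hv => _ /(_ _ km)/weak_derivativeP[].
Qed.

Lemma derivatives_weak m v k psi : Hm S m v -> (k < m)%N -> test_function S psi ->
  <<derivatives v k, (psi^`())%classic>> = - <<derivatives v k.+1, psi>>.
Proof.
move=> Hv km tpsi.
have W j : (j <= m)%N -> is_weak_derivative S j v (derivatives v j).
  case: j => [|j] jm; first by move=> psi' _; rewrite expr0 mul1r.
  by case: Hv => _ /(_ _ jm)/weak_derivativeP[].
have := W _ km _ tpsi; rewrite derive1Sn (W _ (ltnW km) _ (test_derive1 tpsi)).
by rewrite exprS mulN1r mulNr -mulrN => /mulfI -> //; rewrite signr_eq0.
Qed.

Lemma within_continuous_dist u x e : {within `[0, S], continuous u} -> x \in `[0, S] ->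
  0 < e -> exists2 r, 0 < r & forall y, y \in `[0, S] -> `|y - x| < r -> `|u y - u x| < e.
Proof.
move=> /subspace_continuousP cu xI e0.
have /cvgrPdist_lt/(_ _ e0) := cu x xI.
rewrite near_withinE => /nbhs_ballP[r /= r0 hr].
by exists r => // y yI yx; rewrite distrC; apply: hr => //=; rewrite /ball /= distrC.
Qed.

Lemma subinterval_near x r : x \in `[0, S] -> 0 < r ->
  exists a b, [/\ 0 <= a, a < b, b <= S & forall y, y \in `]a, b[ -> `|y - x| < r].
Proof.
rewrite in_itv /= => /andP[x0 xS] r0; have [xS'|Sx] := ltP x S.
  exists x, (Num.min (x + r) S); split => //; first by rewrite lt_min xS' ltrDl r0.
    by rewrite ge_min lexx orbT.
  move=> y; rewrite in_itv /= lt_min => /and3P[xy yr _].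
  by rewrite gtr0_norm ?subr_gt0 // ltrBlDl.
exists (Num.max 0 (x - r)), x; split => //; first by rewrite le_max lexx.
  by rewrite gt_max (lt_le_trans S0) // ltrBlDr ltrDl.
move=> y; rewrite in_itv /= gt_max => /andP[/andP[_ xry] yx].
by rewrite ltr0_norm ?subr_lt0 // opprB ltrBlDr addrC -ltrBlDr.
Qed.

(** If [|u x| > c], continuity keeps [|u - P|] above a fixed positive [g] on an interval that does
    not depend on [P], against the smallness in L2. *)
Lemma continuous_le_of_approx u (c : R) : {within `[0, S], continuous u} ->
  (forall e, 0 < e -> exists2 P, (forall x, x \in `[0, S] -> `|P.[x]| <= c) &
     nrm (fun x => u x - P.[x]) <= e) ->
  forall x, x \in `[0, S] -> `|u x| <= c.
Proof.
move=> cu H x xI; rewrite leNgt; apply/negP => cx.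
set g := (`|u x| - c) / 2; have g0 : 0 < g by rewrite divr_gt0 // subr_gt0.
have gE : `|u x| = c + 2 * g by rewrite mulrC divfK //; ring.
have [r r0 hr] := within_continuous_dist cu xI g0.
have [a [b [a0 ab bS abr]]] := subinterval_near xI r0.
have ba : 0 < b - a by rewrite subr_gt0.
have gba := mulr_gt0 g0 ba; have ba1 : 0 < b - a + 1 by rewrite addr_gt0.
(* With [e = g (b - a) / (b - a + 1)], [e^2 < g^2 (b - a)] whatever the length of the interval. *)
have e0 := divr_gt0 gba ba1.
have [P Pc] := H _ e0; set e := _ / _ in e0 *; set w := fun x => u x - P.[x] => we.
have hw : L2 w by apply: L2B; [exact: continuous_L2|exact: poly_L2].
have : g ^+ 2 * (b - a) <= <<w, w>>.
  apply: inner_lower => //; first exact: ltW.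
  move=> y yab; have yI : y \in `[0, S].
    by move: yab; rewrite !in_itv /= => /andP[ay yb]; rewrite (le_trans a0) ?(le_trans _ bS) // ltW.
  have := hr y yI (abr y yab); have := Pc y yI; rewrite /w.
  have := ler_normD P.[y] (u y - P.[y]); rewrite addrC subrK.
  have := ler_normB (u y) (u y - u x); rewrite subKr.
  lra.
rewrite -norm0E; apply/negP; rewrite -ltNge.
apply: (@le_lt_trans _ _ (e ^+ 2)); first by rewrite ler_pXn2r ?nnegrE ?norm0_ge0 // ltW.
rewrite /e; move: g0 ba; move: (b - a) => d; clear; move: g => g g0 d0.
have d1 : 0 < d + 1 by rewrite addr_gt0.
rewrite exprMn exprVn ltr_pdivrMr ?exprn_gt0 // exprMn.
have -> : g ^+ 2 * d * (d + 1) ^+ 2 = g ^+ 2 * d ^+ 2 + g ^+ 2 * (d * (d ^+ 2 + d + 1)) by ring.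
by rewrite ltrDl mulr_gt0 ?exprn_gt0 // mulr_gt0 // !addr_gt0 ?exprn_gt0.
Qed.

Lemma norm_le_sqr x c : 0 <= c -> x ^+ 2 <= c ^+ 2 -> `|x| <= c.
Proof. by move=> c0 h; rewrite -ler_sqr ?nnegrE // (real_normK (num_real _)). Qed.

(** Polynomials close to [v] in all derivatives are close to each other in C^1 by [poly_sup_bound];
    [continuous_le_of_approx] carries the bound on values over to [v]. The last clause ranges over
    all [Q] so that [Hm_approx] can let [Q] tend to [v] in difference quotients. *)
Lemma Hm_approx_sup m v e : Hm S m v -> (2 <= m)%N -> 0 < e ->
  exists P, [/\ forall k, (k <= m)%N -> nrm (fun x => derivatives v k x - (P^`(k)).[x]) <= e,
    forall x, x \in `[0, S] -> `|v x - P.[x]| <= e &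
    exists2 d, 0 < d & forall Q,
      (forall k, (k <= m)%N -> nrm (fun x => derivatives v k x - (Q^`(k)).[x]) <= d) ->
      forall x, x \in `[0, S] -> `|((Q - P)^`()).[x]| <= e].
Proof.
move=> Hv m2 e0; have hL k : (k <= m)%N -> L2 (derivatives v k) by apply: derivatives_L2.
have L q : L2 (horner q) by apply: poly_L2.
have ch d : 0 < d -> exists P, forall k, (k <= m)%N ->
    nrm (fun x => derivatives v k x - (P^`(k)).[x]) <= d.
  by move=> d0; apply: chain_approx => // k psi; apply: derivatives_weak.
pose c := 2 / S + 2 * S; have c0 : 0 <= c by rewrite addr_ge0 ?mulr_ge0 ?invr_ge0 ?(ltW S0).
have c1 : 0 < 2 * (c + 1) by lra.
have [d [d0 de1 de2]] : exists d, [/\ 0 < d, d <= e & 2 * (c + 1) * d <= e].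
  have c2 : 0 < 2 * (c + 1) + 1 by rewrite addr_gt0.
  exists (e / (2 * (c + 1) + 1)); have d0 := divr_gt0 e0 c2.
  have : e / (2 * (c + 1) + 1) * (2 * (c + 1) + 1) = e by rewrite divfK // gt_eqF.
  set t := e / _ in d0 *; set s := 2 * _ in c1 *; clearbody t s => <-.
  by have := mulr_gt0 d0 c1; split => //; lra.
have [P hP] := ch _ d0.
have near2 d' P' : 0 < d' -> d' <= d -> (forall k, (k <= m)%N ->
    nrm (fun x => derivatives v k x - (P'^`(k)).[x]) <= d') ->
    forall k x, (k <= 1)%N -> x \in `[0, S] -> `|((P' - P)^`(k)).[x]| <= e.
  move=> d'0 d'd hP' k x k1 xI.
  have key j : (j <= m)%N -> I ((P' - P)^`(j) * (P' - P)^`(j)) <= (2 * d) ^+ 2.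
    move=> jm; rewrite -norm0_poly // ler_sqr ?nnegrE ?norm0_ge0 //; last lra.
    rewrite derivnB -norm0_polyB.
    apply: le_trans (norm0_tri (L _) (hL j jm) (L _)) _.
    rewrite norm0_sym; have := hP j jm; have := hP' j jm; lra.
  have := poly_sup_bound S0 ((P' - P)^`(k)) xI; rewrite -derivnS => h.
  apply: le_trans de2.
  apply: norm_le_sqr; first by apply: mulr_ge0; exact: ltW.
  apply: (le_trans h).
  have k1' := key k (leq_trans k1 (ltnW m2)); have k2' := key k.+1 (leq_ltn_trans k1 m2).
  have := ler_wpM2l (_ : 0 <= 2 / S) k1'; rewrite divr_ge0 ?(ltW S0) // => /(_ isT).
  have := ler_wpM2l (_ : 0 <= 2 * S) k2'; rewrite mulr_ge0 ?(ltW S0) // => /(_ isT).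
  have : c * (2 * d) ^+ 2 <= (2 * (c + 1) * d) ^+ 2.
    rewrite !exprMn mulrA ler_wpM2r ?sqr_ge0 //; move: c0; move: (c); clear => c; nra.
  have -> : c * (2 * d) ^+ 2 = 2 / S * (2 * d) ^+ 2 + 2 * S * (2 * d) ^+ 2 by rewrite /c; ring.
  lra.
have cv : {within `[0, S], continuous v} by case: Hv.
have cvP q : {within `[0, S], continuous (fun x => v x - q.[x])}.
  move=> x; apply: cvgB; first exact: cv.
  by apply: continuous_subspaceT => y; apply: continuous_horner.
exists P; split.
- by move=> k km; apply: le_trans de1; apply: hP.
- apply: continuous_le_of_approx => // d1 d10.
  have d2 : 0 < Num.min d1 d by rewrite lt_min d10.
  have [P' hP'] := ch _ d2; exists (P' - P).
    by move=> x; apply: (near2 _ P' d2 _ hP' 0%N); rewrite ?ge_min ?lexx ?orbT.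
  have := hP' 0%N isT; rewrite derivn0 le_min => /andP[h _]; move: h.
  rewrite (_ : (fun x => v x - P.[x] - _) = fun x => v x - P'.[x]) //.
  by apply/funext => x; rewrite hornerD hornerN; ring.
by exists d => // Q hQ x; apply: (near2 d Q d0 (lexx d) hQ 1%N).
Qed.

Lemma Hm_approx m v e : Hm S m v -> (2 <= m)%N -> 0 < e ->
  exists P, [/\ forall k, (k <= m)%N -> nrm (fun x => derivatives v k x - (P^`(k)).[x]) <= e,
    forall x, x \in `[0, S] -> `|v x - P.[x]| <= e &
    forall x y, x \in `[0, S] -> y \in `[0, S] ->
      `|(v y - v x) - (P.[y] - P.[x])| <= e * `|y - x|].
Proof.
move=> Hv m2 e0; have [P [h1 h2 [d d0 near]]] := Hm_approx_sup Hv m2 e0.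
exists P; split => // x y xI yI; apply/ler_addgt0Pr => r r0.
have d1 : 0 < Num.min d (r / 2) by rewrite lt_min d0 divr_gt0.
have [Q [Qd Qs _]] := Hm_approx_sup Hv m2 d1.
have dQ k : (k <= m)%N -> nrm (fun x => derivatives v k x - (Q^`(k)).[x]) <= d.
  by move=> /Qd; rewrite le_min => /andP[].
have := poly_lip (near Q dQ) xI yI; rewrite !hornerD !hornerN.
have := Qs x xI; have := Qs y yI; rewrite !le_min => /andP[_ +] /andP[_ +].
by rewrite !ler_norml; lra.
Qed.

(* Approximation of a function together with its difference quotients, so that
   also the one-sided derivatives at the endpoints are controlled. *)
Definition C1_close e v P := forall x y, x \in `[0, S] -> y \in `[0, S] ->
  `|(v y - v x) - (P.[y] - P.[x])| <= e * `|y - x|.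

Lemma poly_quotient P x : exists2 K, 0 <= K & forall y, y \in `[0, S] -> y != x ->
  x \in `[0, S] -> `|(P.[y] - P.[x]) / (y - x) - (P^`()).[x]| <= K * `|y - x|.
Proof.
have /factor_theorem[Q hQ] : root (P - P.[x]%:P) x.
  by rewrite /root hornerD hornerN hornerC subrr.
have [K K1 hK] := poly_lipshitz Q 0 S.
exists K; first by apply: le_trans K1.
move=> y yI yx xI; have yx0 : y - x != 0 by rewrite subr_eq0.
have -> : P.[y] - P.[x] = Q.[y] * (y - x).
  by rewrite -[P.[x] in LHS](hornerC _ y) -hornerN -hornerD hQ !hornerE.
have -> : (P^`()).[x] = Q.[x].
  have := congr1 (fun q : {poly R} => (q^`()).[x]) hQ.
  rewrite /= derivB derivC subr0 derivM derivB derivC derivX subr0 !hornerE.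
  by rewrite subrr mulr0 add0r.
by rewrite mulfK //; apply: hK.
Qed.

Lemma within_dnbhsE x (A : set R) : x \in `[0, S] -> (within `[0, S] x^') A ->
  exists2 r, 0 < r & forall y, y \in `[0, S] -> y != x -> `|y - x| < r -> A y.
Proof.
move=> xI /nbhs_ballP[r /= r0 hr]; exists r => // y yI yx d.
by apply: hr => //; rewrite /ball /= distrC.
Qed.

Lemma within_dnbhs_ball x r : 0 < r ->
  (within `[0, S] x^') [set y | [/\ y \in `[0, S], y != x & `|y - x| < r]].
Proof.
by move=> r0; apply/nbhs_ballP; exists r => // y; rewrite /ball /= distrC => yr yx yI; split.
Qed.

Lemma within_dnbhs_proper x : x \in `[0, S] -> ProperFilter (within `[0, S] x^').
Proof.
move=> xI; apply: Build_ProperFilter.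
suff ex A : (within `[0, S] x^') A -> exists y, A y by move=> /ex[].
move=> /(within_dnbhsE xI)[r r0 hr].
have [a [b [a0 ab bS abr]]] := subinterval_near xI r0.
pose y c := a + (b - a) / c%:R.
have yI c : (1 < c)%N -> y c \in `]a, b[.
  move=> c1; have ba : 0 < b - a by rewrite subr_gt0.
  have c0 : 0 < c%:R^-1 :> R by rewrite invr_gt0 ltr0n (ltn_trans _ c1).
  have c2 : c%:R^-1 < 1 :> R by rewrite invf_lt1 ?ltr1n // ltr0n (ltn_trans _ c1).
  rewrite /y; move: c0 c2; move: (_^-1) => t t0 t1; rewrite in_itv /=.
  have := mulr_gt0 ba t0; have := mulr_gt0 ba (_ : 0 < 1 - t); rewrite subr_gt0 => /(_ t1).
  lra.
have sub z : z \in `]a, b[ -> z \in `[0, S].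
  by rewrite !in_itv /= => /andP[az zb]; rewrite (le_trans a0) ?(le_trans _ bS) // ltW.
have y23 : y 2%N != y 3%N.
  rewrite /y -subr_eq0 (_ : _ - _ = (b - a) / 6); last by field.
  by rewrite mulf_neq0 ?invr_eq0 ?pnatr_eq0 // subr_eq0 gt_eqF.
(* Two candidates are needed because one of them may be [x]. *)
have [e|n] := eqVneq (y 2%N) x.
  exists (y 3%N); apply: hr; [exact/sub/yI| |exact/abr/yI].
  by rewrite -e eq_sym.
by exists (y 2%N); apply: hr; [exact/sub/yI|exact: n|exact/abr/yI].
Qed.

(** Polynomials arbitrarily close to [v] make the difference quotients a Cauchy filter. The limit in
    [deriv_on] therefore exists and is not a default value. *)
Lemma deriv_on_approx v P e x : (forall d, 0 < d -> exists Q, C1_close d v Q) ->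
  C1_close e v P -> x \in `[0, S] -> `|deriv_on S v x - (P^`()).[x]| <= e.
Proof.
move=> hv vP xI; have PF := within_dnbhs_proper xI.
pose q y := (v y - v x) / (y - x).
have near c Q d : C1_close c v Q -> 0 < d ->
    (within `[0, S] x^') [set y | `|q y - (Q^`()).[x]| <= c + d].
  move=> vQ d0; have [K K0 hK] := poly_quotient Q x.
  have K1 : 0 < K + 1 by rewrite ltr_wpDl.
  apply: filterS (within_dnbhs_ball x (divr_gt0 d0 K1)) => y /= [yI yx yd].
  have yx0 : y - x != 0 by rewrite subr_eq0.
  have := hK y yI yx xI; have := vQ x y xI yI.
  have n0 : 0 < `|y - x| by rewrite normr_gt0.
  rewrite -(ler_pdivrMr _ _ n0) -normf_div mulrBl -/(q y); set t := (_ - _) / _.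
  have : K * `|y - x| <= d.
    move: yd; rewrite ltr_pdivlMr //; move: n0; set z := `|y - x|; nra.
  have := ler_normD (q y - t) (t - (Q^`()).[x]); rewrite addrA subrK; lra.
have cq : cvg (q y @[y --> within `[0, S] x^']).
  apply: cauchy_cvg; apply: cauchy_exP => d d0.
  have d3 : 0 < d / 3 by rewrite divr_gt0.
  have [Q vQ] := hv _ d3; exists ((Q^`()).[x]).
  apply: filterS (near _ _ _ vQ d3) => y /= h.
  by rewrite /ball /= distrC; apply: le_lt_trans h _; lra.
apply/ler_addgt0Pr => d d0; have d2 : 0 < d / 2 by rewrite divr_gt0.
have /cvgrPdist_lt/(_ _ d2) h := cq.
have [y [/= h1 h2]] := filter_ex (filterI h (near _ _ _ vP d2)).
rewrite /deriv_on; have := ler_normD (lim (q y @[y --> within `[0, S] x^']) - q y) (q y - (P^`()).[x]).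
rewrite addrA subrK; lra.
Qed.

Lemma C1_close_poly P e : 0 <= e -> C1_close e (horner P) P.
Proof. by move=> e0 x y _ _; rewrite subrr normr0 mulr_ge0. Qed.

Lemma deriv_on_poly P x : x \in `[0, S] -> deriv_on S (horner P) x = (P^`()).[x].
Proof.
move=> xI; apply/eqP; rewrite -subr_eq0 -normr_le0.
apply: (@deriv_on_approx _ P) => // [d d0|]; last exact: C1_close_poly.
by exists P; apply: C1_close_poly; exact: ltW.
Qed.

Lemma derivable_continuous psi : (forall x, derivable psi x 1) -> continuous psi.
Proof. by move=> df x; apply/differentiable_continuous/derivable1_diffP/df. Qed.

Lemma test_L2 psi : test_function S psi -> L2 psi.
Proof.
move=> [dpsi _]; apply: continuous_L2; apply: continuous_subspaceT.
by apply: derivable_continuous => x; apply: (dpsi 0%N).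
Qed.

Lemma poly_weak_derivative P psi : test_function S psi ->
  <<horner P, (psi^`())%classic>> = - <<horner P^`(), psi>>.
Proof.
move=> tpsi; have [dpsi [a [b [a0 bS psi0]]]] := tpsi.
have d0 x : derivable psi x 1 by apply: (dpsi 0%N).
have d1 x : derivable (psi^`())%classic x 1 by apply: (dpsi 1%N).
have cp q : continuous (horner q) by move=> x; apply: continuous_horner.
have z0 : psi 0 = 0 by apply: psi0; rewrite in_itv /= leNgt a0.
have zS : psi S = 0 by apply: psi0; rewrite in_itv /= andbC leNgt bS.
pose F x := P.[x] * psi x.
have dF x : is_derive x 1 F ((P^`()).[x] * psi x + P.[x] * (psi^`())%classic x).
  have dP := is_derive_poly P x; have dps : is_derive x 1 psi ((psi^`())%classic x).
    by rewrite derive1E; apply: DeriveDef.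
  by have := is_deriveM dP dps; congr is_derive; rewrite /GRing.scale /=; ring.
have L1 := test_L2 tpsi; have L2' := test_L2 (test_derive1 tpsi).
have := @inner_FTC _ S S0 (fun x => (P^`()).[x] * psi x + P.[x] * (psi^`())%classic x) F.
rewrite /F z0 zS !mulr0 subr0 => FTC.
apply/eqP; rewrite -addr_eq0 addrC /inner.
rewrite -(@RintegralD _ _ _ lebesgue_measure `]0, S[%classic _ _ (measurable_itv _)); first last.
- exact: L2_integrable_mul (poly_L2 S _) _.
- exact: L2_integrable_mul (poly_L2 S _) _.
apply/eqP/FTC.
- apply: continuous_subspaceT => x; apply: cvgD; apply: cvgM; by [apply: cp|apply: derivable_continuous].
- by move=> x _; case: (dF x).
- by move=> x _; rewrite derive1E; apply: (@derive_val _ _ _ _ _ _ _ (dF x)).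
Qed.

Lemma poly_H10 P : P.[0] = 0 -> P.[S] = 0 -> H10 S (horner P).
Proof.
move=> P0 PS; split => //; split; first by apply: continuous_subspaceT; apply: continuous_horner.
move=> [|[|//]] _; first by exists (horner P); split; [exact: poly_L2|move=> psi _; rewrite mul1r].
exists (horner P^`()); split; first exact: poly_L2.
by move=> psi tpsi; rewrite expr1 mulN1r; apply: poly_weak_derivative.
Qed.

(** [wd 1] is a chosen representative; it differs from the classical derivative by a function of
    norm 0, which inner products do not see. *)
Lemma inner_weak_derivative_poly P g : H10 S (horner P) -> L2 g ->
  <<g, wd 1 (horner P)>> = <<g, horner P^`()>>.
Proof.
move=> [HP _ _] hg; have hw := derivatives_L2 HP (leqnn 1).
have hp := poly_L2 S P^`(); have hd := L2B hw hp.
apply/eqP; rewrite -subr_eq0 -innerBr // -normr_le0 (le_trans (inner_le hg hd)) //.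
rewrite (L2_orth_test S0 hd) ?mulr0 // => psi tpsi.
have hpsi := test_L2 tpsi.
rewrite innerBl // -[X in _ - X]opprK -(poly_weak_derivative P tpsi).
by rewrite (derivatives_weak HP (leqnn 1) tpsi) opprK subrr.
Qed.

End Approximation.

(** * Shifted Gauss-Lobatto nodes *)

Section GaussLobatto.
Context {R : realType} (S : R) (N : nat).
Hypotheses (S0 : 0 < S) (N2 : (2 <= N)%N).
Implicit Types (p q F G : {poly R}) (x : R) (i j : 'I_N.+1).
Implicit Types (phi psi : R -> R).

Local Notation I := (pint 0 S).
Local Notation X := (xi_hat S).
Local Notation W := (omega_hat S).
Local Notation w := (wpoly (-1 : R) 1).

Lemma wpolyN11 : w = 'X^2 - 1.
Proof. by rewrite /wpoly polyCN; ring. Qed.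

Lemma legendreE : legendre N = legp N :> {poly R}.
Proof. by rewrite /legendre /legp /rodrigues wpolyN11. Qed.

(** A strictly sorted list is determined by its members, so the tuple chosen in the definition is
    the list of [gll_nodes_exist]. *)
Lemma gll_nodesP : [/\ sorted <%R (gll_nodes N : seq R),
  nth 0 (gll_nodes N) 0 = -1 :> R, nth 0 (gll_nodes N) N = 1 :> R &
  forall x, (x \in (gll_nodes N : seq R)) = root (w * (legp N)^`()) x].
Proof.
have [s [ss so s0 sN sr]] := @gll_nodes_exist R N N2.
have rE x : root ((1 - 'X^2) * (legendre N)^`()) x = root (w * (legp N)^`()) x.
  by rewrite (_ : 1 - 'X^2 = - w) ?mulNr ?rootN ?legendreE // wpolyN11 opprB.
have := @xgetPex _ [tuple of nseq N.+1 0] [set s : N.+1.-tuple R |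
    sorted <%R s /\ forall x, (x \in (s : seq R)) = root ((1 - 'X^2) * (legendre N)^`()) x].
rewrite -/(gll_nodes N) => -[|so' sr'].
  have /eqP st := ss; exists (Tuple st); split => //= x.
  by rewrite rE -sr.
have <- : s = gll_nodes N by apply: lt_sorted_eq => // x; rewrite sr sr' rE.
by split.
Qed.

Lemma xi_nth i : xi i = nth 0 (gll_nodes N) i :> R.
Proof. exact: tnth_nth. Qed.

Lemma xi_lt i j : (i < j)%N -> xi i < xi j :> R.
Proof.
case: gll_nodesP => so _ _ _ ij; rewrite !xi_nth.
by have := sorted_ltn_nth lt_trans 0 so; apply => //; rewrite inE size_tuple.
Qed.

Lemma xi_root i : (w * (legp N)^`()).[xi i] = 0.
Proof.
case: gll_nodesP => _ _ _ r; apply/eqP; rewrite -/(root _ _) -r.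
exact: mem_tnth.
Qed.

Lemma omegaE i : omega i = gllw (@xi R N) i.
Proof. by rewrite /omega /gllw legendreE. Qed.

Lemma xi_hat_lt i j : (i < j)%N -> X i < X j.
Proof. by move=> ij; rewrite /xi_hat ltr_pM2l ?divr_gt0 // ltrD2r xi_lt. Qed.

Lemma xi_hat0 i : i = 0%N :> nat -> X i = 0.
Proof.
by case: gll_nodesP => _ e0 _ _ ei; rewrite /xi_hat xi_nth ei e0 addNr mulr0.
Qed.

Lemma xi_hatN i : i = N :> nat -> X i = S.
Proof. by case: gll_nodesP => _ _ e0 _ ei; rewrite /xi_hat xi_nth ei e0; field. Qed.

Lemma xi_hat_itv i : X i \in `[0, S].
Proof.
have x0 := @xi_hat0 ord0 erefl; have xN := @xi_hatN ord_max erefl.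
rewrite in_itv /=; apply/andP; split.
  have [->|i0] := eqVneq i ord0; first by rewrite x0.
  by rewrite -x0 ltW // xi_hat_lt //= lt0n.
have [->|i0] := eqVneq i ord_max; first by rewrite xN.
by rewrite -[leRHS]xN ltW // xi_hat_lt //= ltn_neqAle i0 -ltnS ltn_ord.
Qed.

Lemma omega_hat_ge0 i : 0 <= W i.
Proof.
by apply: mulr_ge0; rewrite ?omegaE ?gllw_ge0 // divr_ge0 // ltW.
Qed.

Lemma omega_hat_le i : W i <= 2 * S / N.+1%:R.
Proof.
have -> : 2 * S / N.+1%:R = S / 2 * (4 / N.+1%:R).
  by rewrite !mulrA; congr (_ / _); field.
by rewrite /omega_hat ler_pM2l ?divr_gt0 // omegaE; apply: gllw_le => // k; apply: xi_root.
Qed.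

Lemma omega_hat_exact p : (size p <= N.*2)%N -> \sum_(i < N.+1) p.[X i] * W i = I p.
Proof.
move=> sp; pose l : {poly R} := (S / 2)%:P * ('X + 1%:P).
have S2 : S / 2 != 0 by rewrite gt_eqF // divr_gt0.
have lE x : l.[x] = S / 2 * (x + 1) by rewrite hornerM !hornerE.
have dl : l^`() = (S / 2)%:P by rewrite derivM derivC mul0r add0r derivD derivX derivC addr0 mulr1.
have sl : size l = 2 by rewrite size_Cmul // size_XaddC.
have := @gll_exact R N N2 (@xi R N) xi_lt xi_root (p \Po l).
rewrite size_comp_poly2 // => /(_ sp) E.
have := pint_deriv (-1) 1 (antideriv p \Po l).
rewrite deriv_comp deriv_antideriv dl mulrC pintMl -E !horner_comp !lE => H.
rewrite pintE mulr_sumr in H *; rewrite addNr mulr0 in H.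
rewrite (_ : S / 2 * (1 + 1) = S) in H; last by field.
rewrite -H; apply: eq_bigr => i _.
by rewrite horner_comp lE -omegaE mulrCA.
Qed.

Lemma innerN_exact p q : (size (p * q)%R <= N.*2)%N ->
  innerN S N (horner p) (horner q) = I (p * q).
Proof.
by move=> /omega_hat_exact <-; apply: eq_bigr => i _; rewrite hornerM.
Qed.

Lemma innerN_eq phi phi' psi psi' :
  (forall x, x \in `[0, S] -> phi x = phi' x) -> (forall x, x \in `[0, S] -> psi x = psi' x) ->
  innerN S N phi psi = innerN S N phi' psi'.
Proof. by move=> h h'; apply: eq_bigr => i _; rewrite h ?h' //; apply: xi_hat_itv. Qed.

Lemma interpolantP phi : (size (interpolant S N phi) <= N.+1)%N /\
  forall i, (interpolant S N phi).[X i] = phi (X i).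
Proof.
apply: (@xgetPex _ 0 [set q : {poly R} | (size q <= N.+1)%N /\ forall i, q.[X i] = phi (X i)]).
have [l hl] := @lagrange_basis R N N2 (@xi R N) xi_lt xi_root.
pose h : {poly R} := (2 / S) *: 'X - 1%:P.
have hX i : h.[X i] = xi i.
  rewrite /h hornerD hornerN hornerZ hornerX hornerC /xi_hat; move: (xi i) => z.
  by field; rewrite gt_eqF.
have sh : size h = 2.
  rewrite size_polyDl size_scale ?size_polyX ?size_polyN ?size_polyC ?mulf_neq0 ?invr_eq0 ?(gt_eqF S0) //.
  by rewrite oner_eq0.
exists ((\sum_i phi (X i) *: l i) \Po h); split.
  rewrite size_comp_poly2 //; apply: (leq_trans (size_sum _ _ _)).
  apply/bigmax_leqP => i _; apply: leq_trans (size_scale_leq _ _) _; by case: (hl i).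
move=> i; rewrite horner_comp hX horner_sum (bigD1 i) //= big1 ?addr0.
  by case: (hl i) => _ e _; rewrite hornerZ e eqxx mulr1.
by move=> j ji; case: (hl j) => _ e _; rewrite hornerZ e (negPf ji) mulr0.
Qed.

(** Nodes indexed by natural numbers, as the Markov-Stieltjes section expects. Beyond [N], [inord]
    returns a default index, so the bounds on the weights hold for every [k]. *)
Let x k := X (inord k : 'I_N.+1).
Let om k := W (inord k : 'I_N.+1).

Let sumE (F : R -> R) : \sum_(i < N.+1) F (X i) * W i = \sum_(0 <= k < N.+1) F (x k) * om k.
Proof. by rewrite big_mkord; apply: eq_bigr => i _; rewrite /x /om inord_val. Qed.

Let x0 : x 0 = 0. Proof. by apply: xi_hat0; rewrite inordK. Qed.
Let xN : x N = S. Proof. by apply: xi_hatN; rewrite inordK. Qed.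
Let x_lt (i j : nat) : (i < j <= N)%N -> x i < x j.
Proof.
move=> /andP[ij jN]; apply: xi_hat_lt; rewrite !inordK ?ltnS //.
exact: leq_trans (ltnW ij) jN.
Qed.
Let om_exact q : (size q <= N.*2)%N -> \sum_(0 <= k < N.+1) q.[x k] * om k = I q.
Proof. by move=> /omega_hat_exact <-; rewrite sumE. Qed.
Let om_ge0 k : 0 <= om k. Proof. exact: omega_hat_ge0. Qed.
Let om_le k : om k <= 2 * S / N.+1%:R. Proof. exact: omega_hat_le. Qed.

Lemma innerN_error_mul F G :
  (I (F * G) - innerN S N (horner F) (horner G)) ^+ 2 <=
  (2 * S / N.+1%:R) ^+ 2 * (I (F * F) + I (F^`() * F^`())) * (I (G * G) + I (G^`() * G^`())).
Proof.
have -> : innerN S N (horner F) (horner G) = \sum_(0 <= k < N.+1) (F * G).[x k] * om k.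
  by rewrite -sumE; apply: eq_bigr => i _; rewrite hornerM.
exact: (quadrature_error_mul (ltnW N2) x0 xN x_lt om_exact om_ge0 om_le).
Qed.

Lemma innerN_sqr_le F (t : R) : 0 < t -> innerN S N (horner F) (horner F) <=
  I (F * F) + 2 * S / N.+1%:R * (t * I (F^`() * F^`()) + t^-1 * I (F * F)).
Proof.
have -> : innerN S N (horner F) (horner F) = \sum_(0 <= k < N.+1) (F * F).[x k] * om k.
  by rewrite -sumE; apply: eq_bigr => i _; rewrite hornerM.
exact: (quadrature_sqr_le (ltnW N2) x0 xN x_lt om_exact om_ge0 om_le).
Qed.

Lemma innerN_ge0 phi : 0 <= innerN S N phi phi.
Proof. by apply: sumr_ge0 => i _; rewrite -expr2 mulr_ge0 ?sqr_ge0 ?omega_hat_ge0. Qed.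

Lemma innerN_CS phi psi :
  innerN S N phi psi ^+ 2 <= innerN S N phi phi * innerN S N psi psi.
Proof.
apply: quad_ge0_disc; first exact: innerN_ge0.
move=> t; have := innerN_ge0 (fun x => phi x + t * psi x); congr (_ <= _).
rewrite /innerN !mulr_sumr -!big_split /=; apply: eq_bigr => i _; ring.
Qed.

Lemma sum_omega_hat : \sum_(i < N.+1) W i = S.
Proof.
have := omega_hat_exact (p := 1%:P); rewrite pintC mul1r subr0 => E.
rewrite -[RHS]E.
  by apply: eq_bigr => i _; rewrite hornerC mul1r.
by rewrite (leq_trans (size_polyC_leq1 _)) // double_gt0 ltnW.
Qed.

Lemma innerN_bound phi (c : R) : (forall x, x \in `[0, S] -> `|phi x| <= c) ->
  innerN S N phi phi <= c ^+ 2 * S.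
Proof.
move=> h; rewrite -{2}sum_omega_hat mulr_sumr; apply: ler_sum => i _.
have hi := h _ (xi_hat_itv i); have c0 : 0 <= c by apply: le_trans hi.
rewrite ler_wpM2r ?omega_hat_ge0 // -expr2 -(real_normK (num_real (phi _))).
by rewrite ler_sqr ?nnegrE.
Qed.

Lemma innerN_sqr_tri phi psi : innerN S N phi phi <=
  2 * innerN S N (fun x => phi x - psi x) (fun x => phi x - psi x) + 2 * innerN S N psi psi.
Proof.
rewrite /innerN !mulr_sumr -big_split /=; apply: ler_sum => i _.
have := omega_hat_ge0 i; move: (phi _) (psi _) (omega_hat S i) => p q z z0.
by have := mulr_ge0 (sqr_ge0 (p - q - q)) z0; lra.
Qed.

End GaussLobatto.

(** * The coefficients of the scheme *)

Section Coefs.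
Context {R : realType} (T : R) (n : nat) (d alpha : nat -> R).
Hypothesis T0 : 0 < T.
Hypothesis d_ge0 : forall i, (1 <= i <= n)%N -> 0 <= d i.
Hypothesis d_neq0 : exists2 i, (1 <= i <= n)%N & d i <> 0.
Hypothesis alpha_gt0 : 0 < alpha 1%N.
Hypothesis alpha_le : forall i, (1 <= i < n)%N -> alpha i <= alpha i.+1.
Hypothesis alpha_lt1 : alpha n < 1.

Local Notation rate := (fun i => alpha i / (1 - alpha i)).
Implicit Types (i j k : nat) (h : R).

Lemma alpha_mono i j : (1 <= i <= j)%N -> (j <= n)%N -> alpha i <= alpha j.
Proof.
move=> /andP[i1]; elim: j => [|j IH]; first by rewrite leqn0 => /eqP ->.
rewrite leq_eqVlt => /predU1P[->//|ij] jn.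
apply: le_trans (IH ij (ltnW jn)) _; apply: alpha_le.
by rewrite (leq_trans i1).
Qed.

Lemma alpha_itv i : (1 <= i <= n)%N -> 0 < alpha i < 1.
Proof.
move=> /andP[i1 ni]; rewrite (lt_le_trans alpha_gt0) ?alpha_mono //= ?i1 //.
by rewrite (le_lt_trans _ alpha_lt1) // alpha_mono // i1.
Qed.

Lemma rate_itv i : (1 <= i <= n)%N -> 0 < rate i <= rate n.
Proof.
move=> /[dup] hi /andP[i1 ni]; have /andP[a0 a1] := alpha_itv hi.
have b : alpha i <= alpha n by apply: alpha_mono => //; rewrite i1.
rewrite divr_gt0 ?subr_gt0 //= ler_pM ?invr_ge0 ?subr_ge0 ?(ltW a0) ?(ltW a1) //.
by rewrite lef_pV2 ?posrE ?subr_gt0 // lerD2l lerN2.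
Qed.

Lemma one_sub_expR_bounds (x : R) : 0 <= x -> x * expR (- x) <= 1 - expR (- x) <= x.
Proof.
move=> x0; have h1 := expR_ge1Dx x; have h2 := expR_ge1Dx (- x).
have e0 := expR_gt0 (- x); have := expRxMexpNx_1 x; move: e0 h1 h2.
set a := expR x; set b := expR (- x) => *; apply/andP; split; nra.
Qed.

Section Step.
Variables (NT : nat).
Hypothesis NT1 : (1 <= NT)%N.
Local Notation h := (tstep T NT).

Lemma tstep_gt0 : 0 < h. Proof. by rewrite divr_gt0 // ltr0n. Qed.

Lemma tstep_le k : (k <= NT)%N -> k%:R * h <= T.
Proof.
by move=> kN; rewrite /tstep mulrCA ger_pMr // ler_pdivrMr ?ltr0n // mul1r ler_nat.
Qed.

Let w i := d i / (alpha i * h) * (1 - expR (- (rate i * h))).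

Lemma w_ge0 i : (1 <= i <= n)%N -> 0 <= w i.
Proof.
move=> hi; have /andP[a0 a1] := alpha_itv hi; have h0 := tstep_gt0.
have /andP[r0 _] := rate_itv hi.
apply: mulr_ge0; first by rewrite divr_ge0 ?d_ge0 // mulr_ge0 ?ltW.
by rewrite subr_ge0 -[leRHS]expR0 ler_expR oppr_le0 mulr_ge0 // ltW.
Qed.

(** [(1 - exp(- r h)) / h] lies between [r exp(- r T)] and [r] for every step [h <= T]; this keeps
    [kappa] away from 0 and infinity uniformly in [NT]. *)
Lemma w_bounds i : (1 <= i <= n)%N ->
  d i / (1 - alpha i) * expR (- (rate i * T)) <= w i <= d i / (1 - alpha i).
Proof.
move=> hi; have /andP[a0 a1] := alpha_itv hi; have h0 := tstep_gt0.
have /andP[r0 _] := rate_itv hi; have d0 := d_ge0 hi.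
have a10 : 0 < 1 - alpha i by rewrite subr_gt0.
have rh : 0 <= rate i * h by rewrite mulr_ge0 // ltW.
have ah : 0 < alpha i * h by rewrite mulr_gt0.
have c0 : 0 <= d i / (alpha i * h) by rewrite divr_ge0 // ltW.
have /andP[/(ler_wpM2l c0) l1 /(ler_wpM2l c0) l2] := one_sub_expR_bounds rh.
have E : d i / (alpha i * h) * (rate i * h) = d i / (1 - alpha i).
  by field; rewrite !gt_eqF // mulr_gt0.
rewrite /w; apply/andP; split; last by rewrite -E.
apply: le_trans l1; rewrite mulrA E ler_wpM2l ?divr_ge0 ?(ltW a10) //.
rewrite ler_expR lerN2 ler_pM2l //.
by have := tstep_le NT1; rewrite mul1r.
Qed.

Lemma etaE j k : (1 <= j <= k)%N ->
  Defs.eta h n d alpha j k = \sum_(1 <= i < n.+1) w i * expR (- (rate i * ((k - j)%:R * h))).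
Proof.
move=> /andP[j1 jk]; apply: eq_big_nat => i; rewrite ltnS => hi.
rewrite /w -[RHS]mulrA; congr (_ * _).
rewrite mulrBl mul1r -expRD /bcoef /sigma natrB //.
have e : (j.-1)%:R = j%:R - 1 :> R by rewrite -subn1 natrB.
by rewrite e; congr (expR _ - expR _); ring.
Qed.

Lemma eta_diag k : (1 <= k)%N -> Defs.eta h n d alpha k k = Defs.eta h n d alpha 1 1.
Proof. by move=> k1; rewrite !etaE ?k1 ?leqnn // !subnn. Qed.

Lemma eta_mono j j' k : (1 <= j <= j')%N -> (j' <= k)%N ->
  Defs.eta h n d alpha j k <= Defs.eta h n d alpha j' k.
Proof.
move=> /andP[j1 jj'] jk; rewrite !etaE ?j1 ?(leq_trans j1) ?(leq_trans jj') //=.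
rewrite big_nat_cond [leRHS]big_nat_cond; apply: ler_sum => i; rewrite andbT ltnS => hi.
have /andP[r0 _] := rate_itv hi.
rewrite ler_wpM2l ?w_ge0 // ler_expR lerN2 ler_pM2l // ler_pM2r ?tstep_gt0 // ler_nat.
exact: leq_sub2l.
Qed.

Lemma eta_decay k : (1 <= k <= NT)%N ->
  expR (- (rate n * T)) * Defs.eta h n d alpha 1 1 <= Defs.eta h n d alpha 1 k.
Proof.
move=> /andP[k1 kN]; rewrite !etaE ?k1 //.
rewrite mulr_sumr big_nat_cond [leRHS]big_nat_cond; apply: ler_sum => i; rewrite andbT ltnS => hi.
have /andP[r0 rn] := rate_itv hi; rewrite subnn mul0r mulr0 oppr0 expR0 mulr1 mulrC.
rewrite ler_wpM2l ?w_ge0 // ler_expR lerN2 ler_pM ?(ltW r0) ?mulr_ge0 ?(ltW tstep_gt0) //.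
  by rewrite ltW.
by apply: tstep_le; rewrite subn1 (leq_trans (leq_pred _)).
Qed.

End Step.

(** The constants are chosen before [NT]. The sum telescopes to [zeta k k = 1]. *)
Lemma coefficients_bounds : exists k0 k1 z : R, [/\ 0 < k0, 0 < k1, 0 < z &
  forall NT, (1 <= NT)%N -> let zt := zeta (tstep T NT) n d alpha in
  k0 <= kappa (tstep T NT) n d alpha <= k1 /\
  forall k, (1 <= k <= NT)%N -> [/\ z <= zt 1%N k,
    forall j, (1 <= j < k)%N -> 0 <= zt j.+1 k - zt j k &
    \sum_(1 <= j < k) (zt j.+1 k - zt j k) + zt 1%N k = 1]].
Proof.
have [i hi /eqP di] := d_neq0.
have /andP[a0 a1] := alpha_itv hi.
have dpos : 0 < d i by rewrite lt_def di d_ge0.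
set e0 := d i / (1 - alpha i) * expR (- (rate i * T)).
have e00 : 0 < e0 by rewrite !mulr_gt0 ?invr_gt0 ?subr_gt0 ?expR_gt0.
set e1 := \sum_(1 <= j < n.+1) d j / (1 - alpha j).
have eb NT : (1 <= NT)%N -> e0 <= Defs.eta (tstep T NT) n d alpha 1 1 <= e1.
  move=> NT1; rewrite etaE // subnn; apply/andP; split.
    rewrite (bigD1_seq i) ?mem_index_iota ?iota_uniq //=.
    rewrite mul0r mulr0 oppr0 expR0 mulr1.
    have /andP[wi _] := w_bounds NT1 hi; apply: (le_trans wi); rewrite lerDl.
    rewrite big_seq_cond; apply: sumr_ge0 => j; rewrite mem_index_iota ltnS => /andP[hj _].
    by rewrite mulr0 oppr0 expR0 mulr1 w_ge0.
  rewrite /e1 big_nat_cond [leRHS]big_nat_cond; apply: ler_sum => j; rewrite andbT ltnS => hj.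
  by rewrite mul0r mulr0 oppr0 expR0 mulr1; case/andP: (w_bounds NT1 hj).
have e10 : 0 < e1 by have /andP[x y] := eb 1%N isT; apply: lt_le_trans (le_trans x y).
exists e1^-1, e0^-1, (expR (- (rate n * T))); split; rewrite ?invr_gt0 ?expR_gt0 //.
move=> NT NT1 zt; have /andP[b0 b1] := eb NT NT1.
have h0 : 0 < Defs.eta (tstep T NT) n d alpha 1 1 by apply: lt_le_trans b0.
split; first by rewrite /kappa !lef_pV2 ?posrE // b0 b1.
move=> k /[dup] hk /andP[k1 kN]; split.
- by rewrite /zt /zeta eta_diag // ler_pdivlMr // eta_decay.
- move=> j /andP[j1 jk]; rewrite subr_ge0 /zt /zeta eta_diag // ler_pM2r ?invr_gt0 //.
  by apply: eta_mono; rewrite ?j1 //=.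
rewrite telescope_sumr // subrK /zt /zeta divff // eta_diag // gt_eqF //.
Qed.

End Coefs.

(** * Approximation with quadrature norms *)

Section CollocationApproximation.
Context {R : realType} (S : R) (m : nat).
Hypotheses (S0 : 0 < S) (m2 : (2 <= m)%N).
Implicit Types (p q P Q w : {poly R}) (x y e : R) (u v f : R -> R) (N k : nat).

Local Notation L2 := (in_L2 S).
Local Notation "<< u , v >>" := (inner S u v).
Local Notation nrm := (norm0 S).
Local Notation I := (pint 0 S).
Local Notation wd := (weak_derivative S).
Local Notation dv := (derivatives S).

Lemma derivn_add p i j : p^`(i)^`(j) = p^`(i + j).
Proof. by elim: j => [|j IH]; rewrite ?addn0 // addnS !derivnS IH. Qed.

Lemma normm_ge0 v : 0 <= normm S m v. Proof. exact: sqrtr_ge0. Qed.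

Lemma norm0_le_normm v k : (k <= m)%N -> nrm (wd k v) <= normm S m v.
Proof.
move=> km; rewrite -ler_sqr ?nnegrE ?norm0_ge0 ?normm_ge0 //.
rewrite [in leRHS]/normm [in leRHS]sqr_sqrtr.
  rewrite (bigD1_seq k) ?mem_index_iota ?iota_uniq //= lerDl.
  by apply: sumr_ge0 => *; apply: sqr_ge0.
by apply: sumr_ge0 => *; apply: sqr_ge0.
Qed.

(** [h2_approx] with [n = m - 2] for a polynomial [P] within [e] of [v]: the norms of its
    derivatives are at most [normm S m v + e], which is the numerator of [Z]. *)
Lemma smooth_approx : exists2 D, 0 <= D & forall v N e P, Hm S m v -> (2 <= N)%N -> 0 < e ->
  (forall k, (k <= m)%N -> nrm (fun x => dv v k x - (P^`(k)).[x]) <= e) ->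
  exists q, [/\ (size q <= N)%N, q.[0] = P.[0], q.[S] = P.[S] &
    let r := P - q in let Z := (normm S m v + e) / N.-1%:R ^+ m.-1 in
    [/\ I (r * r) <= D * Z ^+ 2, I (r^`() * r^`()) <= D * Z ^+ 2 &
        I (r^`(2) * r^`(2)) <= D * (N.-1%:R * Z) ^+ 2]].
Proof.
have [C C0 hC] := h2_approx S0 (m - 2).
exists (C * (m - 2).+1%:R); first by rewrite mulr_ge0.
move=> v N e P Hv N2 e0 hP; have [q [sq q0 qS /= [h2 h1 h0]]] := hC N P N2.
exists q; split => //; set r := P - q in h0 h1 h2 *; set Z := _ / _ => /=.
set Y := normm S m v + e in Z *.
have Y0 : 0 <= Y by rewrite addr_ge0 ?normm_ge0 // ltW.
have HY : hsq 0 S (m - 2) P^`(2) <= (m - 2).+1%:R * Y ^+ 2.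
  have -> : (m - 2).+1%:R * Y ^+ 2 = \sum_(0 <= k < (m - 2).+1) Y ^+ 2.
    by rewrite sumr_const_nat subn0 mulr_natl.
  rewrite /hsq big_nat_cond [leRHS]big_nat_cond; apply: ler_sum => k /andP[/andP[_ km] _].
  have km' : (2 + k <= m)%N by move: km m2; clear; lia.
  rewrite derivn_add -norm0_poly // ler_sqr ?nnegrE ?norm0_ge0 //.
  have hd : L2 (dv v (2 + k)) by apply: derivatives_L2 Hv km'.
  have := norm0B hd (L2B hd (poly_L2 S (P^`(2 + k)))).
  rewrite (_ : (fun x => _ - _) = horner P^`(2 + k)); last by apply/funext => x; ring.
  move=> /le_trans; apply; apply: lerD; last exact: hP.
  exact: norm0_le_normm.
have M0 : 0 < N.-1%:R :> R by rewrite ltr0n; case: (N) N2 => [|[]].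
set M := N.-1%:R in M0 h0 h1 h2 Z *.
have CH : C * hsq 0 S (m - 2) P^`(2) <= C * (m - 2).+1%:R * Y ^+ 2 by rewrite -mulrA ler_wpM2l.
have mE : m.-1 = (m - 2).+1 by move: m2; clear; lia.
have div k t : M ^+ (2 * k) * t <= C * hsq 0 S (m - 2) P^`(2) ->
    t <= C * (m - 2).+1%:R * (Y / M ^+ k) ^+ 2.
  move=> h; have h' := le_trans h CH.
  by rewrite exprMn exprVn -exprM mulrA ler_pdivlMr ?exprn_gt0 // mulrC (mulnC k).
split; [rewrite /Z mE; exact: div..|].
have -> : M * Z = Y / M ^+ (m - 2) by rewrite /Z mE exprS; field; rewrite !gt_eqF ?exprn_gt0.
exact: div.
Qed.

Lemma poly_norm_bound p (c : R) : 0 <= c -> (forall x, x \in `[0, S] -> `|p.[x]| <= c) ->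
  nrm (horner p) <= c * Num.sqrt S.
Proof.
move=> c0 h; have s0 : 0 <= Num.sqrt S by apply: sqrtr_ge0.
rewrite -ler_sqr ?nnegrE ?norm0_ge0 ?mulr_ge0 // norm0E exprMn sqr_sqrtr ?(ltW S0) //.
apply: inner_bound => //; first exact: poly_L2.
by move=> x; rewrite in_itv /= => /andP[x0 xS]; apply: h; rewrite in_itv /= !ltW.
Qed.

(** Subtract the affine interpolant [l] of [P] at the endpoints. As [v] vanishes there, [l] has
    endpoint values at most [d] and slope at most [2 d / S], whence the constant [c]. *)
Lemma Hm_approx0 v e : Hm S m v -> v 0 = 0 -> v S = 0 -> 0 < e ->
  exists P, [/\ P.[0] = 0, P.[S] = 0,
    forall k, (k <= m)%N -> nrm (fun x => dv v k x - (P^`(k)).[x]) <= e,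
    forall x, x \in `[0, S] -> `|v x - P.[x]| <= e & C1_close S e v P].
Proof.
move=> Hv v0 vS e0; set s := Num.sqrt S; have s0 : 0 <= s by apply: sqrtr_ge0.
have t0 : 0 < S^-1 by rewrite invr_gt0.
pose c := 3 + 2 * S^-1; have c0 : 0 < c by rewrite addr_gt0 // mulr_gt0.
have cs0 : 0 <= c * s by rewrite mulr_ge0 // ltW.
have [d [d0 d1 d2]] : exists d, [/\ 0 < d, d + c * d <= e & d + c * d * s <= e].
  have K0 : 0 < 1 + c + c * s by rewrite ltr_wpDr // addr_gt0.
  exists (e / (1 + c + c * s)); have d0 := divr_gt0 e0 K0.
  have : e / (1 + c + c * s) * (1 + c + c * s) = e by rewrite divfK // gt_eqF.
  set d := e / _ in d0 *; clearbody d => <-.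
  have := mulr_ge0 (ltW d0) cs0; have := mulr_gt0 d0 c0.
  by split => //; lra.
have [P [h1 h2 h3]] := Hm_approx S0 Hv m2 d0.
have I0 : 0 \in `[0, S] by rewrite in_itv /= lexx ltW.
have IS : S \in `[0, S] by rewrite in_itv /= lexx ltW.
have P0 : `|P.[0]| <= d by have := h2 0 I0; rewrite v0 sub0r normrN.
have PS : `|P.[S]| <= d by have := h2 S IS; rewrite vS sub0r normrN.
set b := (P.[S] - P.[0]) * S^-1.
have bd : `|b| <= 2 * S^-1 * d.
  rewrite normrM (gtr0_norm t0) mulrAC ler_wpM2r ?(ltW t0) //.
  by apply: le_trans (ler_normB _ _) _; lra.
pose l : {poly R} := P.[0]%:P + b *: 'X.
have lE x : l.[x] = P.[0] + b * x by rewrite hornerD hornerC hornerZ hornerX.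
have dl : l^`() = b%:P by rewrite derivD derivC derivZ derivX add0r alg_polyC.
have dc : 2 * S^-1 * d <= c * d by rewrite ler_wpM2r ?(ltW d0) // lerDr.
have cd0 : 0 <= c * d by rewrite mulr_ge0 ?ltW.
have lb k x : x \in `[0, S] -> `|(l^`(k)).[x]| <= c * d.
  case: k => [|[|k]].
  - rewrite derivn0 lE in_itv /= => /andP[x0 xS].
    apply: le_trans (ler_normD _ _) _; rewrite normrM (ger0_norm x0).
    have : `|b| * x <= 2 * d.
      apply: (@le_trans _ _ (2 * S^-1 * d * S)); first by rewrite ler_pM.
      by rewrite mulrAC divfK // gt_eqF.
    have : 0 <= 2 * S^-1 * d by rewrite !mulr_ge0 ?(ltW t0) ?(ltW d0).
    rewrite /c mulrDl; lra.
  - by move=> _; rewrite derivn1 dl hornerC; apply: le_trans dc.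
  - move=> _; rewrite derivSn dl derivSn derivC derivnC.
    by case: ifP => _; rewrite hornerC normr0.
have lip x y : l.[y] - l.[x] = b * (y - x) by rewrite !lE; ring.
exists (P - l); split.
- by rewrite hornerD hornerN lE; ring.
- by rewrite hornerD hornerN lE /b divfK ?gt_eqF //; ring.
- move=> k km; apply: le_trans d2.
  have hd : L2 (dv v k) by apply: derivatives_L2 Hv km.
  have := norm0D (L2B hd (poly_L2 S P^`(k))) (poly_L2 S l^`(k)).
  rewrite (_ : (fun x => _ + _) = fun x => dv v k x - ((P - l)^`(k)).[x]).
    move=> /le_trans; apply; apply: lerD; first exact: h1.
    exact: (poly_norm_bound cd0 (lb k)).
  by apply/funext => x; rewrite derivnB hornerD hornerN; ring.
- move=> x xI; apply: le_trans d1.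
  rewrite hornerD hornerN opprB addrCA addrC.
  apply: le_trans (ler_normD _ _) _; apply: lerD; first exact: h2.
  by have := lb 0%N x xI; rewrite derivn0.
move=> x y xI yI; rewrite !hornerD !hornerN.
rewrite (_ : _ - _ = (v y - v x - (P.[y] - P.[x])) + (l.[y] - l.[x])); last by ring.
apply: le_trans (ler_normD _ _) _.
apply: le_trans (ler_wpM2r (normr_ge0 _) d1); rewrite mulrDl; apply: lerD; first exact: h3.
by rewrite lip normrM ler_wpM2r //; apply: le_trans dc.
Qed.

Section Degree.
Variable N : nat.
Hypothesis N2 : (2 <= N)%N.
Local Notation qN := (innerN S N).

Lemma innerN_add_le (phi psi : R -> R) e :
  (forall x, x \in `[0, S] -> `|phi x - psi x| <= e) ->
  qN phi phi <= 2 * (e ^+ 2 * S) + 2 * qN psi psi.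
Proof.
move=> h; have := innerN_bound S0 N2 (phi := fun x => phi x - psi x) h.
by have := innerN_sqr_tri N S0 phi psi; lra.
Qed.

Lemma sqr_bound_parameters : let Om := 2 * S / N.+1%:R in let M : R := N.-1%:R in
  Om * M^-1 <= 2 * S * M ^- 2 /\ Om * M <= 2 * S.
Proof.
move=> Om M; have M0 : 0 < M by rewrite ltr0n; case: (N) N2 => [|[]].
have MN : M <= N.+1%:R by rewrite ler_nat; clear; lia.
have S2 : 0 <= 2 * S by rewrite mulr_ge0 // ltW.
have N0 : 0 < N.+1%:R :> R by rewrite ltr0n.
split; last by rewrite /Om -[leLHS]mulrA ger_pMr ?mulr_gt0 // ler_pdivrMl // mulr1.
rewrite /Om -[leLHS]mulrA ler_wpM2l //.
by rewrite expr2 invfM ler_pM ?invr_ge0 ?(ltW N0) ?(ltW M0) // lef_pV2 ?posrE.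
Qed.

(** In [quadrature_sqr_le] take [t = 1 / (N - 1)]: the bound for [F'] is larger by [N - 1], the
    weights gain [1 / N], and all terms have the size of [D * Z^2]. *)
Lemma innerN_poly_le F Z D : 0 <= Z -> 0 <= D -> I (F * F) <= D * Z ^+ 2 ->
  I (F^`() * F^`()) <= D * (N.-1%:R * Z) ^+ 2 ->
  qN (horner F) (horner F) <= (1 + 4 * S) * (D * Z ^+ 2).
Proof.
move=> Z0 D0 h0 h1; have M0 : 0 < N.-1%:R :> R by rewrite ltr0n; case: (N) N2 => [|[]].
have Mi0 : 0 < N.-1%:R^-1 :> R by rewrite invr_gt0.
apply: le_trans (innerN_sqr_le S0 N2 F Mi0) _; rewrite invrK.
have [] := sqr_bound_parameters; set Om := 2 * S / _; set M := N.-1%:R in M0 Mi0 h1 *.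
move=> o1 o2; have S2 : 0 <= 2 * S by rewrite mulr_ge0 // ltW.
have i0 : 0 <= I (F * F) by apply: pint_sqr_ge0; exact: ltW.
have i1 : 0 <= I (F^`() * F^`()) by apply: pint_sqr_ge0; exact: ltW.
have k0 : Om * M * I (F * F) <= 2 * S * (D * Z ^+ 2).
  by apply: (le_trans (ler_wpM2r i0 o2)); rewrite ler_wpM2l.
have k1 : Om * M^-1 * I (F^`() * F^`()) <= 2 * S * (D * Z ^+ 2).
  apply: (le_trans (ler_wpM2r i1 o1)); rewrite -[leLHS]mulrA ler_wpM2l //.
  rewrite ler_pdivrMl ?exprn_gt0 //; apply: (le_trans h1).
  by rewrite exprMn mulrCA.
by rewrite mulrDr !mulrA in k0 k1 *; lra.
Qed.

End Degree.

Lemma Hm_deriv_on v w P e x : Hm S m v -> C1_close S e v P -> x \in `[0, S] ->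
  `|deriv_on S (fun y => v y - w.[y]) x - ((P - w)^`()).[x]| <= e.
Proof.
move=> Hv hP; have close Q c : C1_close S c v Q -> C1_close S c (fun y => v y - w.[y]) (Q - w).
  move=> hQ y z yI zI; have := hQ y z yI zI; congr (`|_| <= _).
  by rewrite !hornerD !hornerN; ring.
apply: deriv_on_approx => //; last exact: close.
by move=> c c0; have [Q [_ _ hQ]] := Hm_approx S0 Hv m2 c0; exists (Q - w); apply: close.
Qed.

Lemma collocation_approx : exists2 C, 0 <= C & forall v N e,
  Hm S m v -> v 0 = 0 -> v S = 0 -> (2 <= N)%N -> 0 < e ->
  exists q, let X := normm S m v / N.-1%:R ^+ m.-1 + e in
    [/\ (size q <= N)%N, q.[0] = 0, q.[S] = 0 &
    [/\ nrm (fun x => v x - q.[x]) <= C * X,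
        nrm (fun x => wd 1 v x - (q^`()).[x]) <= C * X,
        innerN S N (fun x => v x - q.[x]) (fun x => v x - q.[x]) <= (C * X) ^+ 2 &
        forall w, let g := fun x => deriv_on S (fun y => v y - w.[y]) x - ((q - w)^`()).[x] in
          innerN S N g g <= (C * X) ^+ 2]].
Proof.
have [D D0 hD] := smooth_approx.
pose G := 2 * S + 2 * ((1 + 4 * S) * D).
have S4 : 0 <= 1 + 4 * S by rewrite addr_ge0 // mulr_ge0 // ltW.
have G0 : 0 <= G by rewrite addr_ge0 // mulr_ge0 // ?(ltW S0) // mulr_ge0.
have sD0 : 0 <= Num.sqrt D by apply: sqrtr_ge0.
have sG0 : 0 <= Num.sqrt G by apply: sqrtr_ge0.
exists (1 + Num.sqrt D + Num.sqrt G); first by rewrite !addr_ge0.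
set C := _ + _ + _; move=> v N e Hv v0 vS N2 e0.
have [P [P0 PS h1 h2 h3]] := Hm_approx0 Hv v0 vS e0.
have [q [sq q0 qS /=]] := hD v N e P Hv N2 e0 h1.
set Z := _ / _; set X := _ + e; move=> -[r0 r1 r2]; exists q; rewrite q0 qS; split => //.
have M0 : 1 <= N.-1%:R :> R by rewrite ler1n; case: (N) N2 => [|[]].
have Mi : N.-1%:R ^- m.-1 <= 1 :> R.
  by rewrite invf_le1 ?exprn_gt0 ?(lt_le_trans _ M0) // exprn_ege1.
have Mi0 : 0 <= N.-1%:R ^- m.-1 :> R by rewrite invr_ge0 exprn_ge0 // (le_trans _ M0).
have Z0 : 0 <= Z by rewrite mulr_ge0 // addr_ge0 ?normm_ge0 // ltW.
have ZX : Z <= X by rewrite /Z /X mulrDl lerD2l ger_pMr.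
have X0 : 0 <= X by apply: le_trans ZX.
have eX : e <= X by rewrite /X lerDr mulr_ge0 // normm_ge0.
have Z2 : D * Z ^+ 2 <= D * X ^+ 2 by rewrite ler_wpM2l // ler_sqr ?nnegrE.
have sX : 1 * X + Num.sqrt D * X <= C * X by rewrite -mulrDl ler_wpM2r // lerDl.
have GX : 2 * (e ^+ 2 * S) + 2 * ((1 + 4 * S) * (D * Z ^+ 2)) <= (C * X) ^+ 2.
  apply: (@le_trans _ _ (G * X ^+ 2)).
    rewrite /G [leRHS]mulrDl; apply: lerD.
      by rewrite [e ^+ 2 * S]mulrC mulrA ler_wpM2l ?mulr_ge0 ?(ltW S0) // ler_sqr ?nnegrE // ltW.
    by rewrite -!mulrA ler_wpM2l // ler_wpM2l.
  rewrite exprMn ler_wpM2r ?sqr_ge0 // -[leLHS](sqr_sqrtr G0) ler_sqr ?nnegrE //.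
    by rewrite lerDr addr_ge0.
  by rewrite !addr_ge0.
have L p : L2 (horner p) by apply: poly_L2.
have nb p : I (p * p) <= D * Z ^+ 2 -> nrm (horner p) <= Num.sqrt D * X.
  move=> h; rewrite -ler_sqr ?nnegrE ?norm0_ge0 ?mulr_ge0 // norm0_poly // exprMn sqr_sqrtr //.
  exact: le_trans Z2.
have sB (a b : {poly R}) : (fun x => a.[x] - b.[x]) = horner (a - b).
  by apply/funext => x; rewrite hornerD hornerN.
split.
- apply: le_trans (norm0_tri (Hm_L2 Hv) (L P) (L q)) _; apply: le_trans sX.
  rewrite mul1r; apply: lerD; last by rewrite sB nb.
  by have := h1 0%N isT; rewrite derivn0 => /le_trans; apply.
- apply: le_trans (norm0_tri (derivatives_L2 Hv (ltnW m2)) (L P^`()) (L q^`())) _.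
  apply: le_trans sX; rewrite mul1r; apply: lerD; last by rewrite sB -derivB nb.
  by have := h1 1%N (ltnW m2); rewrite derivn1 => /le_trans; apply.
- apply: le_trans GX; apply: le_trans (innerN_add_le N2 (psi := horner (P - q)) (e := e) _) _.
    by move=> x xI; rewrite hornerD hornerN opprB addrA subrK; apply: h2.
  rewrite lerD2l ler_wpM2l // innerN_poly_le //; apply: (le_trans r1).
  have MZ : Z <= N.-1%:R * Z by apply: ler_peMl.
  by rewrite ler_wpM2l // ler_sqr ?nnegrE // (le_trans Z0).
move=> w; apply: le_trans GX.
apply: le_trans (innerN_add_le N2 (psi := horner (P - q)^`()) (e := e) _) _.
  move=> x xI; rewrite -[X in `|X|]addrA -opprD -hornerD -derivD.
  rewrite (_ : q - w + (P - q) = P - w); last by ring.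
  exact: Hm_deriv_on.
by rewrite lerD2l ler_wpM2l // innerN_poly_le.
Qed.

Lemma le_of_small (a b c : R) : 0 <= c -> (forall e, 0 < e -> a <= b + e * c) -> a <= b.
Proof.
move=> c0 h; apply/ler_addgt0Pr => e e0; have c1 : 0 < c + 1 by rewrite ltr_wpDl.
apply: le_trans (h _ (divr_gt0 e0 c1)) _; rewrite lerD2l -mulrA ger_pMr //.
by rewrite ler_pdivrMl // mulr1 lerDl.
Qed.

Lemma innerN_CS_norm N phi psi (a b : R) : (2 <= N)%N -> 0 <= a -> 0 <= b ->
  innerN S N phi phi <= a ^+ 2 -> innerN S N psi psi <= b ^+ 2 ->
  `|innerN S N phi psi| <= a * b.
Proof.
move=> N2 a0 b0 ha hb; apply: norm_le_sqr; first exact: mulr_ge0.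
by rewrite exprMn; apply: (le_trans (innerN_CS N S0 phi psi)); rewrite ler_pM ?innerN_ge0.
Qed.

Lemma innerN_stable N w : (2 <= N)%N -> w.[0] = 0 ->
  innerN S N (horner w) (horner w) <= (S ^+ 2 + 2 * S * (1 + S ^+ 2)) * nrm (horner w^`()) ^+ 2.
Proof.
move=> N2 w0; have := innerN_sqr_le S0 N2 w ltr01; rewrite invr1 !mul1r.
have := poincare_int (ltW S0) w0; rewrite subr0 norm0_poly //.
have i1 : 0 <= I (w^`() * w^`()) by apply: pint_sqr_ge0; exact: ltW.
have i0 : 0 <= I (w * w) by apply: pint_sqr_ge0; exact: ltW.
have N1 : 1 <= N.+1%:R :> R by rewrite ler1n.
have : 2 * S / N.+1%:R <= 2 * S.
  by rewrite ler_pdivrMr ?ltr0n // ler_peMr // mulr_ge0 // ltW.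
have : 0 <= 2 * S / N.+1%:R by rewrite divr_ge0 // mulr_ge0 // ltW.
move: (I (w * w)) (I (w^`() * w^`())) i0 i1 (2 * S / _) => a b a0 b0 t t0 tS ab.
move=> /le_trans; apply.
have b1 : 0 <= b + a by rewrite addr_ge0.
have := ler_wpM2r b1 tS; have S2 : 0 <= 2 * S by rewrite mulr_ge0 // ltW.
have := ler_wpM2l S2 ab; lra.
Qed.

(* The weights are O(1/N), which turns the order [(N - 1)^(1 - m)] of the approximation
   in H^1 into [N^(- m)]. *)
Lemma collocation_load : exists2 C, 0 <= C & forall f N w, Hm S m f -> (2 <= N)%N ->
  (size w <= N.+1)%N -> w.[0] = 0 ->
  `|<<f, horner w>> - innerN S N f (horner w)| <=
  C * (normm S m f / N%:R ^+ m) * nrm (horner w^`()).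
Proof.
have [D D0 hD] := smooth_approx.
pose K1 := S ^+ 2 + 1; pose K2 := S ^+ 2 + 2 * S * (1 + S ^+ 2).
have S0' := ltW S0; have S2 : 0 <= S ^+ 2 by apply: sqr_ge0.
have K10 : 0 <= K1 by rewrite addr_ge0.
have K20 : 0 <= K2 by rewrite addr_ge0 // mulr_ge0 ?addr_ge0 // mulr_ge0.
pose s := Num.sqrt (2 * D * K1); have s0 : 0 <= s by apply: sqrtr_ge0.
pose C := 2 * S * 2 ^+ m.-1 * s; have C0 : 0 <= C by rewrite !mulr_ge0 ?exprn_ge0.
exists C => // f N w Hf N2 sw w0; set V := nrm (horner w^`()).
have V0 : 0 <= V by apply: norm0_ge0.
have L p : L2 (horner p) by apply: poly_L2.
pose c := (S + Num.sqrt S * Num.sqrt K2 + C) * V.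
have c0 : 0 <= c by rewrite mulr_ge0 // !addr_ge0 // mulr_ge0 ?sqrtr_ge0.
apply: (le_of_small c0) => e e0.
have [P [h1 h2 _]] := Hm_approx S0 Hf m2 e0.
have [q [sq _ _ /=]] := hD f N e P Hf N2 e0 h1; set r := P - q; set Z := _ / _ => -[r0 r1 _].
have wV : I (w * w) <= (S * V) ^+ 2.
  by have := poincare_int S0' w0; rewrite subr0 exprMn norm0_poly.
have nw : nrm (horner w) <= S * V.
  by rewrite -ler_sqr ?nnegrE ?norm0_ge0 ?mulr_ge0 // norm0_poly.
have hf := Hm_L2 Hf.
(* [q * w] has size at most [2N] and is integrated exactly, so only [f - P] and the remainder [r]
   contribute. *)
have -> : <<f, horner w>> - innerN S N f (horner w) =
  <<(fun x => f x - P.[x]), horner w>> + (I (r * w) - innerN S N (horner r) (horner w))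
  + innerN S N (fun x => P.[x] - f x) (horner w).
  rewrite innerBl // inner_poly // /r mulrBl pintB -(innerN_exact S0 N2 (p := q)).
    rewrite (_ : innerN S N (horner (P - q)) _ =
      innerN S N (horner P) (horner w) - innerN S N (horner q) (horner w)).
      rewrite (_ : innerN S N (fun x => P.[x] - f x) _ =
        innerN S N (horner P) (horner w) - innerN S N f (horner w)); first by ring.
      by rewrite /innerN -sumrB; apply: eq_bigr => i _; ring.
    by rewrite /innerN -sumrB; apply: eq_bigr => i _; rewrite hornerD hornerN; ring.
  apply: (leq_trans (size_polyMleq _ _)); move: sq sw; clear.
  move: (size q) (size w) => a b; lia.
have t1 : `|<<(fun x => f x - P.[x]), horner w>>| <= e * S * V.
  apply: le_trans (inner_le (L2B hf (L P)) (L w)) _; rewrite -mulrA.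
  apply: ler_pM; rewrite ?norm0_ge0 //.
  by have := h1 0%N isT; rewrite derivn0.
have t3 : `|innerN S N (fun x => P.[x] - f x) (horner w)| <=
    (e * Num.sqrt S) * (Num.sqrt K2 * V).
  apply: innerN_CS_norm => //; rewrite ?mulr_ge0 ?sqrtr_ge0 ?(ltW e0) //.
    rewrite exprMn sqr_sqrtr //; apply: innerN_bound => // x xI.
    by rewrite distrC; apply: h2.
  by rewrite exprMn sqr_sqrtr //; apply: innerN_stable.
have Z0 : 0 <= Z by rewrite mulr_ge0 ?invr_ge0 ?exprn_ge0 ?ler0n // addr_ge0 ?normm_ge0 // ltW.
have Om0 : 0 <= 2 * S / N.+1%:R by rewrite divr_ge0 ?mulr_ge0 ?ler0n.
have t2 : `|I (r * w) - innerN S N (horner r) (horner w)| <= 2 * S / N.+1%:R * (s * Z) * V.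
  apply: norm_le_sqr; first by do 2![apply: mulr_ge0 => //]; apply: mulr_ge0.
  apply: le_trans (innerN_error_mul S0 N2 r w) _.
  have E (o z v : R) : (o * (s * z) * v) ^+ 2 = o ^+ 2 * ((2 * (D * z ^+ 2)) * (K1 * v ^+ 2)).
    by rewrite !exprMn sqr_sqrtr ?mulr_ge0 //; ring.
  rewrite E -[leLHS]mulrA ler_wpM2l ?sqr_ge0 //.
  have pp p : 0 <= I (p * p) by apply: pint_sqr_ge0.
  apply: ler_pM; rewrite ?addr_ge0 //; first lra.
  by rewrite mulrDl mul1r -exprMn lerD // /V norm0_poly.
have N0 : 0 < N%:R :> R by rewrite ltr0n ltnW.
have OZ : 2 * S / N.+1%:R * Z <= 2 * S * 2 ^+ m.-1 * (normm S m f / N%:R ^+ m + e).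
  have Y0 : 0 <= normm S m f + e by rewrite addr_ge0 ?normm_ge0 // ltW.
  have N1 : N%:R ^- m <= 1 :> R.
    by rewrite invf_le1 ?exprn_gt0 // exprn_ege1 // ler1n ltnW.
  apply: (@le_trans _ _ (2 * S * 2 ^+ m.-1 * ((normm S m f + e) / N%:R ^+ m))); last first.
    rewrite ler_wpM2l ?mulr_ge0 ?exprn_ge0 // mulrDl lerD2l ger_pMr //.
  rewrite /Z -!mulrA ler_wpM2l // ler_wpM2l // [leLHS]mulrCA [leRHS]mulrCA ler_wpM2l //.
  have -> : N%:R ^+ m = N%:R * N%:R ^+ m.-1 :> R by rewrite -exprS prednK // ltnW.
  rewrite invfM mulrCA; apply: ler_pM; rewrite ?invr_ge0 ?exprn_ge0 ?ler0n //.
    by rewrite lef_pV2 ?posrE ?ltr0n // ?ler_nat // ltnW.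
  (* For [N >= 2], [N <= 2 (N - 1)]; this is the origin of the factor [2 ^+ m.-1]. *)
  have M0 : 0 < N.-1%:R :> R by rewrite ltr0n; case: (N) N2 => [|[]].
  rewrite -ler_pdivrMl ?exprn_gt0 // -invfM -exprMn lef_pV2 ?posrE ?exprn_gt0 ?mulr_gt0 //.
  apply: lerXn2r; rewrite ?nnegrE ?mulr_ge0 ?ler0n // -natrM ler_nat.
  by move: N2; clear; lia.
apply: le_trans (ler_normD _ _) _; apply: le_trans (lerD (ler_normD _ _) (lexx _)) _.
have OZs := ler_wpM2r V0 (ler_wpM2l s0 OZ).
have -> : C * (normm S m f / N%:R ^+ m) * V + e * c =
  e * S * V + s * (2 * S * 2 ^+ m.-1 * (normm S m f / N%:R ^+ m + e)) * V +
   (e * Num.sqrt S) * (Num.sqrt K2 * V) by rewrite /c /C; ring.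
apply: lerD t3; apply: lerD t1 _; apply: le_trans t2 _.
by apply: le_trans OZs; rewrite le_eqVlt; apply/orP; left; apply/eqP; ring.
Qed.

End CollocationApproximation.

(** * Energy estimate *)

Section Energy.
Context {R : realType} (S : R) (N : nat) (kap B : R).
Hypotheses (S0 : 0 < S) (N2 : (2 <= N)%N) (kap0 : 0 < kap).
Implicit Types (p q v : {poly R}) (u : nat -> R -> R) (psi : R -> R).

Local Notation L2 := (in_L2 S).
Local Notation "<< u , v >>" := (inner S u v).
Local Notation nrm := (norm0 S).
Local Notation wd := (weak_derivative S).
Local Notation qN := (innerN S N).
Local Notation nN := (fun p => Num.sqrt (qN (horner p) (horner p))).

Lemma innerN_polyBl p q psi :
  qN (horner (p - q)) psi = qN (horner p) psi - qN (horner q) psi.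
Proof. by rewrite /innerN -sumrB; apply: eq_bigr => i _; rewrite hornerD hornerN; ring. Qed.

(** Test both schemes with [v = theta k]. Products of [q j] or [(q k)'] with [v] or [v'] are
    integrated exactly, so these terms pass from quadrature to integral. Every data error costs at
    most a multiple of the norm of [v'], which is at most [a / sqrt kap]; dividing by [a] gives a
    bound linear in the past values. *)
Lemma energy_step (k : nat) (c : nat -> R) u (g : R -> R) (q uN theta : nat -> {poly R}) :
  (forall j, theta j = q j - uN j) -> (forall j, (j < k)%N -> 0 <= c j) -> 0 <= B ->
  (forall j, (j <= k)%N -> L2 (u j)) -> L2 (wd 1 (u k)) ->
  (forall v, v.[0] = 0 -> v.[S] = 0 ->
    <<u k, horner v>> + kap * <<wd 1 (u k), horner v^`()>> =
    \sum_(0 <= j < k) c j * <<u j, horner v>> + kap * <<g, horner v>>) ->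
  (forall v, (size v <= N.+1)%N -> v.[0] = 0 -> v.[S] = 0 ->
    qN (horner (uN k)) (horner v) + kap * qN (horner (uN k)^`()) (horner v^`()) =
    \sum_(0 <= j < k) c j * qN (horner (uN j)) (horner v) + kap * qN g (horner v)) ->
  (forall j, (j <= k)%N -> (size (q j) <= N)%N) -> (q k).[0] = 0 -> (q k).[S] = 0 ->
  (size (uN k) <= N.+1)%N -> (uN k).[0] = 0 -> (uN k).[S] = 0 ->
  (forall j, (j <= k)%N -> nrm (fun x => u j x - (q j).[x]) <= B) ->
  nrm (fun x => wd 1 (u k) x - ((q k)^`()).[x]) <= B ->
  (forall v, (size v <= N.+1)%N -> v.[0] = 0 ->
    `|<<g, horner v>> - qN g (horner v)| <= B * nrm (horner v^`())) ->
  Num.sqrt (qN (horner (theta k)) (horner (theta k)) +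
            kap * qN (horner (theta k)^`()) (horner (theta k)^`())) <=
  \sum_(0 <= j < k) c j * nN (theta j) +
  (S * (1 + \sum_(0 <= j < k) c j) + 2 * kap) / Num.sqrt kap * B.
Proof.
move=> hth c0 B0 Lu Lw equ eqN sq qk0 qkS sN N0 NS hB hB1 hg.
set v := theta k; set A := qN _ _ + _; set a := Num.sqrt A.
have L p : L2 (horner p) by apply: poly_L2.
have v0 : v.[0] = 0 by rewrite /v hth hornerD hornerN qk0 N0 subrr.
have vS : v.[S] = 0 by rewrite /v hth hornerD hornerN qkS NS subrr.
have sv : (size v <= N.+1)%N.
  rewrite /v hth; apply: leq_trans (size_polyD _ _) _; rewrite size_polyN geq_max sN andbT.
  by rewrite (leq_trans (sq k (leqnn k))).
have sd p : (size p^`() <= (size p).-1)%N by rewrite polyorder.size_deriv.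
have ex p : (size p <= N)%N -> qN (horner p) (horner v) = <<horner p, horner v>>.
  move=> sp; rewrite innerN_exact ?inner_poly //.
  apply: (leq_trans (size_polyMleq _ _)); move: sp sv; clear.
  move: (size p) (size v) => i j; lia.
have ex' p : (size p <= N.+1)%N -> qN (horner p^`()) (horner v^`()) = <<horner p^`(), horner v^`()>>.
  move=> sp; rewrite innerN_exact ?inner_poly //.
  apply: (leq_trans (size_polyMleq _ _)); move: sp sv N2 (sd p) (sd v); clear.
  move: (size p) (size v) (size p^`()) (size v^`()) => i j i' j'; lia.
set V := nrm (horner v^`()); have V0 : 0 <= V by apply: norm0_ge0.
have nv : nrm (horner v) <= S * V.
  rewrite -ler_sqr ?nnegrE ?norm0_ge0 ?mulr_ge0 ?(ltW S0) // norm0_poly // exprMn /V norm0_poly //.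
  by have := poincare_int (ltW S0) v0; rewrite subr0.
have A0 : 0 <= A by rewrite addr_ge0 ?mulr_ge0 ?innerN_ge0 // ltW.
have aA : a ^+ 2 = A by rewrite sqr_sqrtr.
have a0 : 0 <= a by apply: sqrtr_ge0.
have sk0 : 0 < Num.sqrt kap by rewrite sqrtr_gt0.
have kk : Num.sqrt kap ^+ 2 = kap by rewrite sqr_sqrtr // ltW.
have Va : V <= a / Num.sqrt kap.
  rewrite ler_pdivlMr // -ler_sqr ?nnegrE ?mulr_ge0 ?(ltW sk0) // aA exprMn kk.
  by rewrite /V norm0E -(ex' v sv) mulrC /A lerDr innerN_ge0.
have na : nN v <= a by rewrite ler_sqrt // /A lerDl mulr_ge0 ?innerN_ge0 // ltW.
have eA : A = \sum_(0 <= j < k) c j * (<<(fun x => u j x - (q j).[x]), horner v>> + qN (horner (theta j)) (horner v))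
  + kap * (<<g, horner v>> - qN g (horner v))
  - <<(fun x => u k x - (q k).[x]), horner v>>
  - kap * <<(fun x => wd 1 (u k) x - ((q k)^`()).[x]), horner v^`()>>.
  have -> : A = (qN (horner (q k)) (horner v) + kap * qN (horner (q k)^`()) (horner v^`()))
     - (qN (horner (uN k)) (horner v) + kap * qN (horner (uN k)^`()) (horner v^`())).
    by rewrite /A {1 3}/v hth innerN_polyBl derivB innerN_polyBl; ring.
  rewrite eqN // ex ?sq // ex' ?(leq_trans (sq k (leqnn k))) //.
  rewrite (innerBl (Lu k (leqnn k)) (L _) (L v)) (innerBl Lw (L _) (L _)).
  rewrite (_ : \sum_(0 <= j < k) c j * (_ + _) =
    \sum_(0 <= j < k) c j * <<u j, horner v>> - \sum_(0 <= j < k) c j * qN (horner (uN j)) (horner v)).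
    have := equ v v0 vS; lra.
  rewrite -sumrB; apply: eq_big_nat => j /andP[_ jk].
  by rewrite (innerBl (Lu j (ltnW jk)) (L _) (L _)) -ex ?sq ?(ltnW jk) // hth innerN_polyBl; ring.
have t1 j : (j <= k)%N -> `|<<(fun x => u j x - (q j).[x]), horner v>>| <= B * (S * V).
  move=> jk; apply: le_trans (inner_le (L2B (Lu j jk) (L _)) (L _)) _.
  by apply: ler_pM; rewrite ?norm0_ge0 ?hB.
have t2 : `|<<(fun x => wd 1 (u k) x - ((q k)^`()).[x]), horner v^`()>>| <= B * V.
  by apply: le_trans (inner_le (L2B Lw (L _)) (L _)) _; rewrite ler_wpM2r.
have t3 j : `|qN (horner (theta j)) (horner v)| <= nN (theta j) * a.
  apply: le_trans (ler_wpM2l (sqrtr_ge0 _) na).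
  by apply: innerN_CS_norm => //; rewrite ?sqrtr_ge0 // sqr_sqrtr ?innerN_ge0.
set Sc := \sum_(0 <= j < k) c j; set Sn := \sum_(0 <= j < k) c j * Num.sqrt _.
have Sc0 : 0 <= Sc.
  by rewrite /Sc big_nat_cond; apply: sumr_ge0 => j; rewrite andbT => /andP[_ /c0].
have Sn0 : 0 <= Sn.
  rewrite /Sn big_nat_cond; apply: sumr_ge0 => j; rewrite andbT => /andP[_ /c0 ?].
  by rewrite mulr_ge0 // sqrtr_ge0.
have sum_le : \sum_(0 <= j < k) c j * (<<(fun x => u j x - (q j).[x]), horner v>> + qN (horner (theta j)) (horner v))
   <= Sc * (B * (S * V)) + Sn * a.
  rewrite /Sc /Sn !mulr_suml -big_split /= big_nat_cond [leRHS]big_nat_cond.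
  apply: ler_sum => j; rewrite andbT => /andP[_ jk].
  rewrite -mulrA -mulrDr ler_wpM2l ?c0 //; apply: lerD.
    by apply: le_trans (ler_norm _) (t1 j (ltnW jk)).
  by apply: le_trans (ler_norm _) (t3 j).
have key : a ^+ 2 <= a * (Sn + (S * (1 + Sc) + 2 * kap) / Num.sqrt kap * B).
  have K0 : 0 <= (S * (1 + Sc) + 2 * kap) * B.
    by rewrite mulr_ge0 // addr_ge0 // mulr_ge0 ?(ltW S0) ?(ltW kap0) // addr_ge0.
  have e1 : kap * (<<g, horner v>> - qN g (horner v)) <= kap * (B * V).
    by rewrite ler_wpM2l ?(ltW kap0) // (le_trans (ler_norm _)) // hg.
  have e2 : - <<(fun x => u k x - (q k).[x]), horner v>> <= B * (S * V).
    by apply: le_trans (ler_norm _) _; rewrite normrN t1.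
  have e3 : - (kap * <<(fun x => wd 1 (u k) x - ((q k)^`()).[x]), horner v^`()>>) <= kap * (B * V).
    rewrite -mulrN ler_wpM2l ?(ltW kap0) //.
    by apply: le_trans (ler_norm _) _; rewrite normrN t2.
  rewrite aA eA; apply: le_trans (lerD (lerD (lerD sum_le e1) e2) e3) _.
  have -> : a * (Sn + (S * (1 + Sc) + 2 * kap) / Num.sqrt kap * B) =
    Sn * a + (S * (1 + Sc) + 2 * kap) * B * (a / Num.sqrt kap) by ring.
  have -> : Sc * (B * (S * V)) + Sn * a + kap * (B * V) + B * (S * V) + kap * (B * V) =
    Sn * a + (S * (1 + Sc) + 2 * kap) * B * V by ring.
  by rewrite lerD2l ler_wpM2l.
have [->|an0] := eqVneq a 0.
  rewrite addr_ge0 // mulr_ge0 // divr_ge0 ?(ltW sk0) // addr_ge0 // mulr_ge0 ?(ltW S0) ?(ltW kap0) //.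
  by rewrite addr_ge0.
by rewrite expr2 ler_pM2l // lt_def an0 in key.
Qed.

End Energy.

(* At least the weight [z] falls on the initial value, so [D] does not accumulate with
   the number of steps. *)
Lemma discrete_gronwall {R : realType} (K : nat) (c : nat -> nat -> R) (b : nat -> R) (z C0 D : R) :
  0 < z -> 0 <= D -> 0 <= C0 ->
  (forall k j, (1 <= k <= K)%N -> (j < k)%N -> 0 <= c k j) ->
  (forall k, (1 <= k <= K)%N -> z <= c k 0%N /\ \sum_(0 <= j < k) c k j = 1) ->
  b 0%N <= C0 ->
  (forall k, (1 <= k <= K)%N -> b k <= \sum_(0 <= j < k) c k j * b j + D) ->
  forall k, (k <= K)%N -> b k <= C0 + D / z.
Proof.
move=> z0 D0 C00 c0 cz b0 step; have Dz : 0 <= D / z by rewrite divr_ge0 // ltW.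
move=> k; elim/ltn_ind: k => -[_ _|k IH kK]; first by apply: (le_trans b0); rewrite lerDl.
have hk : (1 <= k.+1 <= K)%N by rewrite kK.
have [ck s1] := cz _ hk; apply: le_trans (step _ hk) _.
have {}s1 : c k.+1 0%N + \sum_(1 <= j < k.+1) c k.+1 j = 1 by rewrite -big_ltn.
rewrite big_ltn //.
have : \sum_(1 <= j < k.+1) c k.+1 j * b j <= (\sum_(1 <= j < k.+1) c k.+1 j) * (C0 + D / z).
  rewrite mulr_suml big_nat_cond [leRHS]big_nat_cond; apply: ler_sum => j; rewrite andbT => /andP[j1 jk].
  by rewrite ler_wpM2l ?c0 // IH // (leq_trans (ltnW jk)).
have := ler_wpM2l (c0 _ 0%N hk isT) b0.
have : D <= c k.+1 0%N * (D / z) by rewrite mulrA ler_pdivlMr // mulrC ler_wpM2r.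
rewrite (_ : \sum_(1 <= j < k.+1) c k.+1 j = 1 - c k.+1 0%N); last by rewrite -s1 addrC addKr.
lra.
Qed.

(** * Assembly of the error estimate *)

Lemma eq_Hm {R : realType} (S : R) (m : nat) (u v : R -> R) :
  (forall x, x \in `[0, S] -> u x = v x) -> Hm S m u -> Hm S m v.
Proof.
move=> uv [cu hu]; split.
  apply: subspace_eq_continuous cu => x xI; apply: uv.
  by move: xI; rewrite inE.
move=> k /hu[g [hg wg]]; exists g; split => // psi tpsi.
rewrite -(wg psi tpsi); apply: eq_inner => x; rewrite in_itv /= => /andP[x0 xS].
by rewrite uv // in_itv /= !ltW.
Qed.

Lemma le_bigmax_mem {R : realType} (F : nat -> R) (r : seq nat) l : l \in r ->
  F l <= \big[Num.max/0]_(j <- r) F j.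
Proof.
elim: r => // j r IH; rewrite inE big_cons le_max => /predU1P[->|/IH ->].
  by rewrite lexx.
by rewrite orbT.
Qed.

Theorem theorem3p1 (R : realType) (T S : R) (hT : 0 < T) (hS : 0 < S)
  (n : nat) (hn : (1 <= n)%N) (hn1 : n <> 1%N)
  (d : nat -> R)
  (hd : forall i, (1 <= i <= n)%N -> 0 <= d i)
  (hd0 : exists2 i, (1 <= i <= n)%N & d i <> 0)
  (alpha : nat -> R)
  (halpha_gt0 : 0 < alpha 1%N)
  (halpha_le : forall i, (1 <= i < n)%N -> alpha i <= alpha i.+1)
  (halpha_lt1 : alpha n < 1)
  (m : nat) (hm : (1 < m)%N)
  (phi : R -> R) (f : R -> R -> R)
  (hphi0 : phi 0 = 0) (hphiS : phi S = 0)
  (hphi : Hm S m phi)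
  (hf : forall t, t \in `[0, T] -> Hm S m (fun x => f x t)) :
  exists c : R, 0 < c /\
    forall NT N : nat, (1 <= NT)%N -> (2 <= N)%N ->
    forall (u : nat -> R -> R) (uN : nat -> {poly R}),
      semidiscrete_solution T S n d alpha NT f phi u ->
      fully_discrete_solution T S n d alpha NT f N (u 0%N) uN ->
      (forall k, (1 <= k <= NT)%N -> Hm S m (u k) /\ H10 S (u k)) ->
      forall k, (1 <= k <= NT)%N ->
        norm1N S N (kappa (tstep T NT) n d alpha) (fun x => u k x - (uN k).[x])
        <= c * expR (alpha n * T / (1 - alpha n)) *
           (N%:R ^ (- m%:Z)
              * \big[Num.max/0]_(0 <= l < k.+1) normm S m (fk T NT f l)
            + (N%:R - 1) ^ (1 - m%:Z)
              * \big[Num.max/0]_(0 <= l < k.+1) normm S m (u l)).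
Proof.
have [C C0 hC] := collocation_approx hS hm.
have [C' C'0 hC'] := collocation_load hS hm.
have [k0 [k1 [z [k00 k10 z0 hco]]]] :=
  coefficients_bounds hT hd hd0 halpha_gt0 halpha_le halpha_lt1.
(* The factor of [B] in [energy_step] when the coefficients sum to 1 and [kappa] lies between [k0]
   and [k1]. *)
pose D := (2 * S + 2 * k1) / Num.sqrt k0.
have D0 : 0 <= D.
  by rewrite divr_ge0 ?sqrtr_ge0 // addr_ge0 // mulr_ge0 // ltW.
(* [discrete_gronwall] with initial bound [B] and increment [D * B] gives [E1 * B]. *)
pose E1 := 1 + D / z; have E10 : 0 <= E1 by rewrite addr_ge0 // divr_ge0 // ltW.
(* The error splits into [u - q], with values and derivatives at most [B] in quadrature norm, and
   [theta], with energy at most [(E1 * B)^2]; the factors 2 are those of [innerN_sqr_tri]. *)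
pose G := 2 * (1 + k1) + 2 * E1 ^+ 2.
have G0 : 0 <= G by rewrite addr_ge0 ?mulr_ge0 ?sqr_ge0 // addr_ge0 // ltW.
pose E := Num.sqrt G * (C + C') + 1.
have E0 : 0 < E by rewrite ltr_wpDl // mulr_ge0 ?sqrtr_ge0 ?addr_ge0.
exists E; split => // NT N NT1 N2 u uN [u00 uH equ1 equ] [uN0 uNH eqN1 eqN] Hu k hk.
have [k1' kNT] := andP hk.
have [/andP[kap_ge kap_le] hzt] := hco NT NT1.
set kap := kappa _ _ _ _ in kap_ge kap_le equ1 equ eqN1 eqN *.
set zt := zeta _ _ _ _ in hzt equ1 equ eqN1 eqN.
have kap0 : 0 < kap by apply: lt_le_trans kap_ge.
suff bound Fm Um : (forall l, (l <= k)%N -> normm S m (fk T NT f l) <= Fm) ->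
    (forall l, (l <= k)%N -> normm S m (u l) <= Um) ->
    norm1N S N kap (fun x => u k x - (uN k).[x]) <=
    E * expR (alpha n * T / (1 - alpha n)) *
    (N%:R ^ (- m%:Z) * Fm + (N%:R - 1) ^ (1 - m%:Z) * Um).
  by apply: bound => l lk; [apply: (le_bigmax_mem (fun l => normm S m (fk T NT f l)))|
    apply: (le_bigmax_mem (fun l => normm S m (u l)))]; rewrite mem_index_iota.
move=> hFm hUm.
have Fm0 : 0 <= Fm by apply: le_trans (hFm 0%N isT); exact: normm_ge0.
have Um0 : 0 <= Um by apply: le_trans (hUm 0%N isT); exact: normm_ge0.
have N0 : 0 < N%:R :> R by rewrite ltr0n ltnW.
have M0 : 0 < N.-1%:R :> R by rewrite ltr0n; case: (N) N2 => [|[]].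
have -> : (N%:R : R) ^ (- m%:Z) = (N%:R ^+ m)^-1 by rewrite exprnN.
have -> : (N%:R - 1 : R) ^ (1 - m%:Z) = (N.-1%:R ^+ m.-1)^-1.
  rewrite exprnN (_ : N%:R - 1 = N.-1%:R); last by rewrite -subn1 natrB // ltnW.
  by congr (_ ^ _); move: hm; clear; lia.
rewrite (mulrC _ Fm) (mulrC _ Um); set W := Fm / _ + Um / _.
have W1 : Fm / N%:R ^+ m <= W by rewrite lerDl divr_ge0 // exprn_ge0 // ltW.
have W2 : Um / N.-1%:R ^+ m.-1 <= W by rewrite lerDr divr_ge0 // exprn_ge0 // ltW.
have W0 : 0 <= W by rewrite addr_ge0 // divr_ge0 // exprn_ge0 // ltW.
(* The reciprocal of [z] is contained in [E], so the exponential of the claim enters through this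
   lower bound. *)
have exp1 : 1 <= expR (alpha n * T / (1 - alpha n)).
  rewrite -[leLHS]expR0 ler_expR divr_ge0 ?mulr_ge0 ?subr_ge0 ?(ltW hT) ?(ltW halpha_lt1) //.
  rewrite (le_trans (ltW halpha_gt0)) // (@alpha_mono R n alpha) //.
suff main e : 0 < e ->
    norm1N S N kap (fun x => u k x - (uN k).[x]) <= E * W + e * E.
  apply: le_trans (le_of_small (ltW E0) main) _.
  by rewrite ler_wpM2r // ler_peMr // ltW.
move=> e0.
pose B := (C + C') * (W + e).
have We0 : 0 <= W + e by rewrite addr_ge0 // ltW.
have B0 : 0 <= B by rewrite mulr_ge0 // addr_ge0.
have Hu0 j : (j <= k)%N -> [/\ Hm S m (u j), u j 0 = 0 & u j S = 0].
  case: j => [_|j jk]; last first.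
    by have [|h [_ h0 hs]] := Hu j.+1; first rewrite (leq_trans jk).
  split; first by apply: eq_Hm hphi => x xI; rewrite u00.
    by rewrite u00 // in_itv /= lexx ltW.
  by rewrite u00 // in_itv /= lexx ltW.
have Fk l : (l <= NT)%N -> Hm S m (fk T NT f l).
  move=> lN; apply: hf; rewrite in_itv /= mulr_ge0 ?(ltW (tstep_gt0 hT NT1)) //=.
  exact: tstep_le.
(* The condition on [j] stands inside the existential so that [choice] yields a total family. *)
have exq j : exists q : {poly R}, (j <= k)%N ->
    [/\ (size q <= N)%N, q.[0] = 0, q.[S] = 0 &
    [/\ norm0 S (fun x => u j x - q.[x]) <= B,
        norm0 S (fun x => weak_derivative S 1 (u j) x - (q^`()).[x]) <= B,
        innerN S N (fun x => u j x - q.[x]) (fun x => u j x - q.[x]) <= B ^+ 2 &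
        forall w, innerN S N (fun x => deriv_on S (fun y => u j y - w.[y]) x - ((q - w)^`()).[x])
          (fun x => deriv_on S (fun y => u j y - w.[y]) x - ((q - w)^`()).[x]) <= B ^+ 2]].
  have [jk|jk] := leqP j k; last by exists 0.
  have [Hj uj0 ujS] := Hu0 j jk.
  have [q /= [sq q0 qS]] := hC (u j) N e Hj uj0 ujS N2 e0.
  set X := _ + e => -[h1 h2 h3 h4]; exists q => _.
  have X0 : 0 <= X by rewrite addr_ge0 ?(ltW e0) // divr_ge0 ?normm_ge0 // exprn_ge0 // ltW.
  have XB : C * X <= B.
    rewrite ler_pM // ?lerDl // /X lerD2r; apply: le_trans W2.
    rewrite ler_wpM2r ?invr_ge0 ?exprn_ge0 ?(ltW M0) //.
    exact: hUm.
  have XB2 : (C * X) ^+ 2 <= B ^+ 2 by rewrite ler_sqr ?nnegrE // mulr_ge0.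
  split => //; split; [exact: le_trans XB|exact: le_trans XB|exact: le_trans XB2|].
  by move=> w; apply: le_trans (h4 w) _.
have [q hq] := choice exq.
have load l (v : {poly R}) : (l <= k)%N -> (size v <= N.+1)%N -> v.[0] = 0 ->
    `|inner S (fk T NT f l) (horner v) - innerN S N (fk T NT f l) (horner v)|
    <= B * norm0 S (horner v^`()).
  move=> lk sv v0; apply: le_trans (hC' _ _ _ (Fk l (leq_trans lk kNT)) N2 sv v0) _.
  rewrite ler_wpM2r ?norm0_ge0 // ler_pM ?divr_ge0 ?normm_ge0 ?exprn_ge0 ?(ltW N0) ?lerDr //.
  apply: (@le_trans _ _ W); last by rewrite lerDl ltW.
  apply: le_trans W1; rewrite ler_wpM2r ?invr_ge0 ?exprn_ge0 ?(ltW N0) //.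
  exact: hFm.
(* The initial value becomes the past value with index 0, so that the first step and the later ones
   have one common form. *)
pose c l j := if j is 0%N then zt 1%N l else zt j.+1 l - zt j l.
have csum l (F : nat -> R) : (0 < l)%N -> \sum_(0 <= j < l) c l j * F j =
    \sum_(1 <= j < l) (zt j.+1 l - zt j l) * F j + zt 1%N l * F 0%N.
  move=> l0; rewrite big_ltn // addrC; congr (_ + _).
  by apply: eq_big_nat => -[|j].
have c0 l j : (1 <= l <= k)%N -> (j < l)%N -> 0 <= c l j.
  move=> /andP[l1 lk] jl; have [|z1 z2 _] := hzt l; first by rewrite l1 (leq_trans lk).
  case: j jl => [|j] jl; first by apply: le_trans z1; exact: ltW.
  by apply: z2.
have cz l : (1 <= l <= k)%N -> z <= c l 0%N /\ \sum_(0 <= j < l) c l j = 1.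
  move=> /andP[l1 lk]; have [|z1 _ z2] := hzt l; first by rewrite l1 (leq_trans lk).
  split => //; rewrite -[RHS]z2 big_ltn // addrC; congr (_ + _).
  by apply: eq_big_nat => -[|j].
have zt11 : zt 1%N 1%N = 1.
  by have [_ _] := hzt 1%N NT1; rewrite big_geq // add0r.
pose theta j := q j - uN j.
pose nN j := Num.sqrt (innerN S N (horner (theta j)) (horner (theta j))).
pose a j := Num.sqrt (innerN S N (horner (theta j)) (horner (theta j)) +
  kap * innerN S N (horner (theta j)^`()) (horner (theta j)^`())).
(* Interpolation controls nodal values but no derivatives of [theta 0]. Only its quadrature norm
   enters the later steps, so this norm replaces the energy at index 0. *)
pose b j := if j is 0%N then nN 0%N else a j.
have nb j : nN j <= b j.
  case: j => [|j] //; apply: ler_wsqrtr; rewrite lerDl.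
  by apply: mulr_ge0; [exact: ltW|exact: innerN_ge0].
have b0 : b 0%N <= B.
  rewrite /b /nN -[leRHS](ger0_norm B0) -sqrtr_sqr ler_sqrt ?sqr_ge0 //.
  have [_ _ _ [_ _ h _]] := hq 0%N isT; apply: le_trans h.
  (* At the nodes [uN 0] agrees with [u 0], so [theta 0] is minus the approximation error there. *)
  rewrite le_eqVlt; apply/orP; left; apply/eqP; apply: eq_bigr => i _.
  have [_ hi] := interpolantP hS N2 (u 0%N).
  by rewrite /theta hornerD hornerN uN0 hi; congr (_ * _); ring.
have HL2 j : (j <= k)%N -> in_L2 S (u j) by move=> /Hu0[/Hm_L2].
have step l : (1 <= l <= k)%N -> b l <= \sum_(0 <= j < l) c l j * b j + D * B.
  move=> /[dup] hl /andP[l1 lk]; have lNT := leq_trans lk kNT.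
  have hl' : (1 <= l <= NT)%N by rewrite l1.
  have [sq q0 qS [_ hB1 _ _]] := hq l lk.
  have [sN [_ N0' NS]] := uNH l hl'.
  have [Hl _ _] := Hu0 l lk.
  have Lw : in_L2 S (weak_derivative S 1 (u l)) by exact: (derivatives_L2 Hl (ltnW hm)).
  have := @energy_step R S N kap B hS N2 kap0 l (c l) u (fk T NT f l) q uN theta.
  have [_ ->] := cz l hl.
  rewrite -/(a l) (_ : b l = a l); last by case: (l) l1.
  move=> h; apply: le_trans (h _ _ _ _ _ _ _ _ _ _ _ _ _ _ _ _) _ => //.
  - by move=> j; apply: c0.
  - by move=> j jl; apply: HL2; rewrite (leq_trans jl).
  - move=> v v0 vS; have Hv := poly_H10 hS v0 vS.
    rewrite csum // -(inner_weak_derivative_poly hS Hv Lw).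
    have [l2|] := ltnP 1 l; first by apply: equ => //; rewrite l2.
    move=> l1'; have -> : l = 1%N by apply/eqP; rewrite eqn_leq l1'.
    by rewrite big_geq // add0r zt11 mul1r; apply: equ1.
  - move=> v sv v0 vS; have Hv : PN0 S N v by split => //; exact: poly_H10.
    rewrite csum //.
    have dE (p : {poly R}) : innerN S N (deriv_on S (horner p)) (deriv_on S (horner v)) =
        innerN S N (horner p^`()) (horner v^`()).
      by apply: innerN_eq => // x xI; rewrite deriv_on_poly.
    rewrite -dE; have [l2|] := ltnP 1 l; first by apply: eqN => //; rewrite l2.
    move=> l1'; have -> : l = 1%N by apply/eqP; rewrite eqn_leq l1'.
    by rewrite big_geq // add0r zt11 mul1r; apply: eqN1.
  - by move=> j jl; have [] := hq j (leq_trans jl lk).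
  - by move=> j jl; have [_ _ _ []] := hq j (leq_trans jl lk).
  - by move=> v sv v0; apply: load.
  apply: lerD.
    rewrite big_nat_cond [leRHS]big_nat_cond; apply: ler_sum => j; rewrite andbT => /andP[_ jl].
    by rewrite ler_wpM2l ?c0 // nb.
  rewrite ler_wpM2r // /D ler_pM ?invr_ge0 ?sqrtr_ge0 //.
  - by rewrite addr_ge0 // mulr_ge0 ?(ltW hS) ?(ltW kap0) // addr_ge0.
  - by rewrite (_ : 1 + 1 = 2) // (mulrC S) lerD2l ler_wpM2l.
  by rewrite lef_pV2 ?posrE ?sqrtr_gt0 // ler_sqrt // ltW.
have := discrete_gronwall z0 (mulr_ge0 D0 B0) B0 c0 cz b0 step (leqnn k).
rewrite (_ : b k = a k); last by case: (k) k1'.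
rewrite (_ : B + D * B / z = E1 * B); last by rewrite /E1; ring.
move=> ak; have [_ _ _ [_ _ h3 h4]] := hq k (leqnn k).
have a2 : a k ^+ 2 = innerN S N (horner (theta k)) (horner (theta k)) +
  kap * innerN S N (horner (theta k)^`()) (horner (theta k)^`()).
  by rewrite sqr_sqrtr // addr_ge0 ?mulr_ge0 ?innerN_ge0 // ltW.
have comb (A1 A2 t t' b2 e2 kp kp1 : R) : A1 <= 2 * b2 + 2 * t -> kp * A2 <= kp * (2 * b2 + 2 * t') ->
    t + kp * t' <= e2 * b2 -> kp * b2 <= kp1 * b2 -> A1 + kp * A2 <= (2 * (1 + kp1) + 2 * e2) * b2.
  by clear; lra.
have AB : AN S N kap (fun x => u k x - (uN k).[x]) (fun x => u k x - (uN k).[x])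
    <= G * B ^+ 2.
  have t1 := innerN_sqr_tri N hS (fun x => u k x - (uN k).[x]) (horner (theta k)).
  have t2 := innerN_sqr_tri N hS (deriv_on S (fun x => u k x - (uN k).[x])) (horner (theta k)^`()).
  have e1 : (fun x => u k x - (uN k).[x] - (theta k).[x]) = fun x => u k x - (q k).[x].
    by apply/funext => x; rewrite hornerD hornerN; ring.
  have ak0 : 0 <= a k by apply: sqrtr_ge0.
  have a2B : a k ^+ 2 <= E1 ^+ 2 * B ^+ 2.
    by rewrite -exprMn ler_sqr ?nnegrE // mulr_ge0.
  rewrite e1 in t1; have t3 := le_trans t1 (lerD (ler_wpM2l (ler0n R 2) h3) (lexx _)).
  have t4 := le_trans t2 (lerD (ler_wpM2l (ler0n R 2) (h4 (uN k))) (lexx _)).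
  have t5 := ler_wpM2l (ltW kap0) t4; rewrite a2 in a2B.
  exact: comb t3 t5 a2B (ler_wpM2r (sqr_ge0 B) kap_le).
rewrite (_ : E * W + e * E = E * (W + e)); last by rewrite [RHS]mulrDr (mulrC e).
apply: (@le_trans _ _ (Num.sqrt (G * B ^+ 2))).
  by rewrite ler_sqrt // mulr_ge0 ?sqr_ge0.
rewrite sqrtrM // sqrtr_sqr (ger0_norm B0) /B mulrA ler_wpM2r //.
by rewrite /E lerDl.
Qed.
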